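(* Let $0<|q|<1$ and let $\kappa_1,\dots,\kappa_n$, $\Xi=(\xi_0,\xi_1,\dots)$, $\mathsf{S}=(s_0,s_1,\dots)$ be complex numbers such that there exists a positively oriented simple contour $\mathcal{C}$ in the complex plane satisfying: - all points $0$ and $\xi_i^{-1}s_i$, $i\ge1$, are inside $\mathcal{C}$; - all points $\xi_i^{-1}s_i^{-1}$, $i\ge1$, are outside $\mathcal{C}$; - the image $q\mathcal{C}$ of $\mathcal{C}$ under multiplication by $q$ is inside $\mathcal{C}$. Then for every partition $\mu$, with $k=\mu_1$, $$\mathbb{F}_{\mu}(\kappa_1,\dots,\kappa_n\mid\Xi,\mathsf{S})=\oint_{\mathcal{C}}\frac{dz_1}{2\pi\mathbf{i}z_1}\cdots\oint_{\mathcal{C}}\frac{dz_k}{2\pi\mathbf{i}z_k}\prod_{1\le\alpha<\beta\le k}\frac{z_\alpha-z_\beta}{z_\alpha-qz_\beta}\prod_{\alpha=1}^k\left(\frac{\xi_0^{-1}}{z_\alpha-\xi^{-1}_{\mu'_\alpha}s_{\mu'_\alpha}}\prod_{j=1}^{\mu'_\alpha-1}\frac{1-s_j\xi_jz_\alpha}{z_\alpha\xi_j-s_j}\prod_{i=1}^n\frac{1-z_\alpha\kappa_i}{1-z_\alpha\xi_is_i}\right).$$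
   Context: Here $\mathbf{i}=\sqrt{-1}$. Write $(x;q)_n:=\prod_{i=1}^n(1-xq^{i-1})$, $(x;q)_0:=1$. A partition is a weakly decreasing sequence $\lambda=(\lambda_1\ge\lambda_2\ge\dots\ge0)$ of nonnegative integers with finitely many nonzero entries; $\varnothing$ is the zero partition, $l(\lambda)$ is the number of nonzero parts and $\lambda'$ is the conjugate partition, so the number of parts of $\lambda'$ equal to $j$ is $m_j(\lambda')=\lambda_j-\lambda_{j+1}$. The parameters $q,\xi_i,s_i$ are assumed generic (all denominators below nonzero), with fixed square roots $\sqrt{\xi_i},\sqrt{s_i}$. For $k\ge0$ put $s_i^{(k)}:=\sqrt{s_{i+k}\xi_{i+k}s_i/\xi_i}$ (formed from the fixed roots) and $\tau^k_{\Xi}\mathsf{S}:=(s^{(k)}_0,s^{(k)}_1,\dots)$. Put $\mathsf{c}_{\mathsf{S}}(\lambda):=\prod_{i\ge1}\frac{(s_i^2;q)_{\lambda_i-\lambda_{i+1}}}{(q;q)_{\lambda_i-\lambda_{i+1}}}$, $(-\mathsf{S})^\lambda:=\prod_{i\ge1}(-s_{i-1})^{\lambda_i}$ (likewise for other sequences in place of $\mathsf S$). For $i,j,k,l\in\mathbb{Z}_{\ge0}$ (labels of the bottom, left, top, right edge) let $$W_{t,s}(i,j;k,l):=\mathbf{1}_{i+j=k+l}\,\mathbf{1}_{i\ge l}\,(s^2/t^2)^{l}\frac{(s^2/t^2;q)_{i-l}(t^2;q)_l}{(s^2;q)_i}\frac{(q;q)_i}{(q;q)_{i-l}(q;q)_l}.$$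 For $a_1,\dots,a_n\in\mathbb{Z}_{\ge0}$ and $L>l(\lambda),l(\mu)$, $$ZW^{(a_1,\dots,a_n)}_{\lambda/\mu}(\kappa_1,\dots,\kappa_n\mid\Xi,\mathsf{S}):=\sum\prod_{r=1}^n\prod_{c=1}^L W_{t_{r,c},\,s^{(r)}_c}(v_{r,c},h_{r,c-1};v_{r-1,c},h_{r,c}),\qquad t_{r,c}^2=\frac{\xi_{r+c}s_{r+c}}{\kappa_r},$$ the sum being over all nonnegative integers $v_{r,c}$ ($0\le r\le n$, $1\le c\le L$) and $h_{r,c}$ ($1\le r\le n$, $0\le c\le L$) with $v_{0,c}=m_c(\lambda')$, $v_{n,c}=m_c(\mu')$, $h_{r,0}=a_r$, $h_{r,L}=0$ (independent of $L$). Then $$\mathbb{F}_{\lambda/\mu}(\kappa_1,\dots,\kappa_n\mid\Xi,\mathsf{S}):=\frac{(-\tau^n_\Xi\mathsf{S})^{\mu}}{(-\mathsf{S})^{\lambda}}\frac{\mathsf{c}_{\tau^n_\Xi\mathsf{S}}(\mu)}{\mathsf{c}_{\mathsf{S}}(\lambda)}\sum_{a_1+\dots+a_n=\lambda_1-\mu_1}\Bigl(\prod_{i=1}^n(\kappa_is_0/\xi_0)^{a_i}\frac{(\kappa_i^{-1}s_i\xi_i;q)_{a_i}}{(q;q)_{a_i}}\Bigr)ZW^{(a_1,\dots,a_n)}_{\lambda/\mu}(\kappa_1,\dots,\kappa_n\mid\Xi,\mathsf{S}),$$ which is a polynomial in $\kappa_1,\dots,\kappa_n$, and $\mathbb{F}_\lambda:=\mathbb{F}_{\lambda/\varnothing}$.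 *)

(* Defs.v *)
From mathcomp Require Import all_boot all_order all_algebra.
From mathcomp Require Import all_classical all_reals all_analysis.
From mathcomp.real_closed Require Import complex.
(* The notations of mpoly clash with those of MathComp-Analysis. *)
From mathcomp.multinomials Require Import -(notations) mpoly.

Set Implicit Arguments.
Unset Strict Implicit.
Unset Printing Implicit Defensive.

Import Order.TTheory GRing.Theory Num.Theory numFieldNormedType.Exports.

Local Open Scope classical_set_scope.
Local Open Scope complex_scope.
Local Open Scope ring_scope.

Section Partitions.

(* A partition is the sequence of its nonzero parts. *)
Definition is_part (la : seq nat) : bool := sorted geq la && (0%N \notin la).

(* la_i for i >= 1 *)
Definition part (la : seq nat) (i : nat) : nat := nth 0%N la i.-1.

Definition conjp (la : seq nat) : seq nat :=
  [seq count (fun x => (j < x)%N) la | j <- iota 0 (part la 1)].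

(* m_j(la) *)
Definition mult (la : seq nat) (j : nat) : nat := count_mem j la.

End Partitions.

Section Functions.

Variable C : fieldType.
Implicit Types (q x : C) (la mu : seq nat).

Definition qpoch (x q : C) (m : nat) : C :=
  \prod_(1 <= i < m.+1) (1 - x * q ^+ i.-1).

(* The weight depends on t only through t^2, the argument t2. *)
Definition Wt (q t2 s : C) (i j k l : nat) : C :=
  if (i + j == k + l)%N && (l <= i)%N then
    (s ^+ 2 / t2) ^+ l
    * (qpoch (s ^+ 2 / t2) q (i - l) * qpoch t2 q l / qpoch (s ^+ 2) q i)
    * (qpoch q q i / (qpoch q q (i - l) * qpoch q q l))
  else 0.

Definition cfac (q : C) (S : nat -> C) (la : seq nat) : C :=
  \prod_(1 <= i < (size la).+1)
    (qpoch (S i ^+ 2) q (part la i - part la i.+1)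
     / qpoch q q (part la i - part la i.+1)).

(* (-S)^la *)
Definition negpow (S : nat -> C) (la : seq nat) : C :=
  \prod_(1 <= i < (size la).+1) (- S i.-1) ^+ part la i.

(* s_i^(k) = sqrt (s_{i+k} xi_{i+k} s_i / xi_i), where rxi and rs are the
   chosen square roots of xi and s *)
Definition stau (rxi rs : nat -> C) (k i : nat) : C :=
  rs (i + k)%N * rxi (i + k)%N * rs i / rxi i.

(* Rows are numbered 1..n and columns 1..L in the partition function: the
   vertical label v_{r,c} (0 <= r <= n, 1 <= c <= L) is the entry (r, c - 1) of
   v, and the horizontal label h_{r,c} (1 <= r <= n, 0 <= c <= L) is the entry
   (r - 1, c) of h.  In the products below r and c stand for r - 1, c - 1. *)
Definition ZWstates (n L : nat) (a : {ffun 'I_n -> nat}) (la mu : seq nat) :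
    set ('M[nat]_(n.+1, L) * 'M[nat]_(n, L.+1)) :=
  [set vh : 'M[nat]_(n.+1, L) * 'M[nat]_(n, L.+1) |
     [/\ forall c, vh.1 ord0 c = mult (conjp la) c.+1,
         forall c, vh.1 ord_max c = mult (conjp mu) c.+1,
         forall r, vh.2 r ord0 = a r
       & forall r, vh.2 r ord_max = 0%N]].

Definition ZW (q : C) (xi s rxi rs : nat -> C) (n : nat) (kappa : 'I_n -> C)
    (L : nat) (a : {ffun 'I_n -> nat}) (la mu : seq nat) : C :=
  \sum_(vh \in @ZWstates n L a la mu)
    \prod_(r < n) \prod_(c < L)
      Wt q (xi (r.+1 + c.+1)%N * s (r.+1 + c.+1)%N / kappa r)
         (stau rxi rs r.+1 c.+1)
         (vh.1 (lift ord0 r) c) (vh.2 r (widen_ord (leqnSn L) c))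
         (vh.1 (widen_ord (leqnSn n) r) c) (vh.2 r (lift ord0 c)).

(* The defining formula of F_{la/mu}, meaningful when all kappa_i are nonzero.
   The number L of columns is the least one exceeding both lengths. *)
Definition Fformula (q : C) (xi s rxi rs : nat -> C) (n : nat) (la mu : seq nat)
    (kappa : 'I_n -> C) : C :=
  negpow (stau rxi rs n) mu / negpow s la
  * (cfac q (stau rxi rs n) mu / cfac q s la)
  * \sum_(a \in [set a : {ffun 'I_n -> nat} |
                   (\sum_(i < n) a i + part mu 1 = part la 1)%N])
      (\prod_(i < n) ((kappa i * s 0%N / xi 0%N) ^+ a i
                      * (qpoch ((kappa i)^-1 * s i.+1 * xi i.+1) q (a i)
                         / qpoch q q (a i)))
       * ZW q xi s rxi rs kappa (maxn (size la) (size mu)).+1 a la mu).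

(* F_{la/mu} as a polynomial in kappa: the (necessarily unique, C being
   infinite in the applications) polynomial given by the formula above at all
   points with nonzero coordinates.  It is what gives a meaning to F_{la/mu}
   when some kappa_i vanishes. *)
Definition Fpoly (q : C) (xi s rxi rs : nat -> C) (n : nat) (la mu : seq nat) :
    mpoly n C :=
  xget (0 : mpoly n C) [set P : mpoly n C |
    forall kappa : 'I_n -> C, (forall i, kappa i != 0) ->
      meval kappa P = Fformula q xi s rxi rs la mu kappa].

Definition Fskew (q : C) (xi s rxi rs : nat -> C) (n : nat) (la mu : seq nat)
    (kappa : 'I_n -> C) : C :=
  meval kappa (Fpoly q xi s rxi rs n la mu).

Definition Fla (q : C) (xi s rxi rs : nat -> C) (n : nat) (la : seq nat)
    (kappa : 'I_n -> C) : C :=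
  Fskew q xi s rxi rs la [::] kappa.

End Functions.

Section Contours.

Variable R : realType.
Local Notation C := (R[i]).

(* gamma is C^1 on [a, b], one-sidedly at the end points. *)
Definition C1_on (a b : R) (gamma : R -> C) : Prop :=
  exists dgamma : R -> C,
    [/\ {within `[a, b], continuous (fun t => complex.Re (dgamma t))},
        {within `[a, b], continuous (fun t => complex.Im (dgamma t))}
      & forall t, t \in `]a, b[ ->
          is_derive t 1 (fun u => complex.Re (gamma u)) (complex.Re (dgamma t)) /\
          is_derive t 1 (fun u => complex.Im (gamma u)) (complex.Im (dgamma t))].

Definition piecewise_C1 (gamma : R -> C) : Prop :=
  [/\ {within `[0, 1], continuous (fun t => complex.Re (gamma t))},
      {within `[0, 1], continuous (fun t => complex.Im (gamma t))}
    & exists ts : seq R,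
        [/\ path <%R 0 ts, last 0 ts = 1
          & forall i, (i < size ts)%N ->
              C1_on (nth 0 (0 :: ts) i) (nth 0 ts i) gamma]].

Definition simple_closed (gamma : R -> C) : Prop :=
  gamma 0 = gamma 1 /\ {in `[0, 1[ &, injective gamma}.

(* C^o carries the usual topology of the complex plane. *)
Definition curve (gamma : R -> C) : set C^o := gamma @` `[0, 1].

Definition inside (gamma : R -> C) (a : C) : Prop :=
  ~ curve gamma a /\
  bounded_set (connected_component (~` curve gamma) (a : C^o)).

Definition outside (gamma : R -> C) (a : C) : Prop :=
  ~ curve gamma a /\
  ~ bounded_set (connected_component (~` curve gamma) (a : C^o)).

Definition velocity (gamma : R -> C) (t : R) : C :=
  derive1 (fun u => complex.Re (gamma u)) t
  +i* derive1 (fun u => complex.Im (gamma u)) t.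

(* The finitely many break points of gamma do not contribute. *)
Definition oint (gamma : R -> C) (f : C -> C) : C :=
  (\int[lebesgue_measure]_(t in `[0, 1])
     complex.Re (f (gamma t) * velocity gamma t))
  +i* (\int[lebesgue_measure]_(t in `[0, 1])
         complex.Im (f (gamma t) * velocity gamma t)).

Definition twopii : C := 0 +i* (2 * pi).

Definition winding (gamma : R -> C) (a : C) : C :=
  oint gamma (fun z => (z - a)^-1) / twopii.

Definition positively_oriented (gamma : R -> C) : Prop :=
  forall a, inside gamma a -> winding gamma a = 1.

Definition pos_simple_contour (gamma : R -> C) : Prop :=
  [/\ piecewise_C1 gamma, simple_closed gamma & positively_oriented gamma].

(* oint dz_1/(2 pi i z_1) ... oint dz_k/(2 pi i z_k) f [:: z_1; ...; z_k] *)
Fixpoint iter_oint (gamma : R -> C) (k : nat) (f : seq C -> C) : C :=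
  if k is k'.+1 then
    oint gamma (fun z =>
      (twopii * z)^-1 * iter_oint gamma k' (fun zs => f (z :: zs)))
  else f [::].

(* z`_al and part (conjp mu) al.+1 are z_{al+1} and mu'_{al+1}. *)
Definition integrand (q : C) (xi s : nat -> C) (n : nat) (kappa : 'I_n -> C)
    (mu : seq nat) (z : seq C) : C :=
  (\prod_(be < part mu 1) \prod_(al < part mu 1 | (al < be)%N)
     ((z`_al - z`_be) / (z`_al - q * z`_be)))
  * \prod_(al < part mu 1)
      let m := part (conjp mu) al.+1 in
      (xi 0%N)^-1 / (z`_al - (xi m)^-1 * s m)
      * (\prod_(1 <= j < m) ((1 - s j * xi j * z`_al) / (z`_al * xi j - s j)))
      * \prod_(i < n)
          ((1 - z`_al * kappa i) / (1 - z`_al * xi i.+1 * s i.+1)).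

End Contours.

(* Main.v *)
Require Import Defs.
From mathcomp Require Import all_boot all_order all_algebra.
From mathcomp Require Import all_classical all_reals all_analysis.
From mathcomp.real_closed Require Import complex.
From mathcomp Require Import measurable_realfun zify ring lra.
From mathcomp.multinomials Require Import -(notations) mpoly.
Import Order.TTheory GRing.Theory Num.Theory.
Import numFieldNormedType.Exports.
Local Open Scope classical_set_scope.
Local Open Scope complex_scope.
Local Open Scope ring_scope.

(* Write p_c = s_c / xi_c and b_c = s_c xi_c: the row operation on the data
   (Xi, S) fixes all p_c and shifts all b_c by one.  Expanding the product of
   the weights of the first row shows that F_la obeys a recursion in n which
   replaces the m_c parts of la' equal to c by m_c - j_c + j_(c+1), with explicit
   coefficients that factor over c.  The integral obeys the same recursion.  Let
   phi_c be the function of z attached to a part c of la'; then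
   phi_c(z) (1 - kappa z) / (1 - b_1 z) is g(z) (1 - kappa z), whereas the
   functions for the shifted data are phi'_c = g (1 - b_c z) and
   phi'_(c-1) = g (z - p_c).  Since the kernel (z_a - z_b) / (z_a - q z_b) times
   z_a - q z_b is antisymmetric, Fubini gives the exchange relation z_a = q z_b
   for adjacent variables carrying the same g.  Modulo it, a product of affine
   functions is determined by its values at (q^(k-1) x, ..., q x, x), and the
   expansion becomes a q-Chu-Vandermonde identity.  Variables that reach level 0
   integrate out to 1 by the residue at 0, and for n = 0 moving z_1 innermost
   leaves a rational function decaying like z_1^-2 with all its poles inside.

   All the analysis rests on Riemann sums: on Lipschitz functions the contour
   integral is a limit of sums over points of the curve, uniformly for a given
   Lipschitz constant.  Linearity, Fubini and the vanishing of the integral of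
   an exact derivative are all read off finite sums. *)

(** * Riemann sums for contour integrals *)

(** The geometric hypotheses are used as winding numbers: 2 pi i around 0, the [p_c] with c >= 1 and
    the points [q z], and 0 around the [1 / b_c] and the points [z / q], for z on the curve.
    Contours are never deformed: nonnegative powers of z and powers (z - a)^-n with n >= 2 have
    primitives, so partial fractions reduce every rational integrand to winding numbers.

    The kernel is not symmetric, and this fixes all orders. In its last variable its poles are
    points [z / q], outside, and the factors containing that variable are 1 at 0; in its first
    variable its poles are points [q z], inside, and it is bounded at infinity. Variables of level 0
    must therefore sit at the right end, and functions are listed by decreasing level, the order of
    [conjp mu]. Within a group the factors [1 - b z] precede the factors [z - p], so that the list
    is grouped again after a row.

    On the lattice side the chosen square roots occur only through the squares [p_i b_(i+k)]. The
    coefficients are kept polynomial in kappa, because [Fla] evaluates a polynomial and must also be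
    matched where some kappa vanishes. *)

Section RealPart.
Local Set Implicit Arguments. Local Unset Strict Implicit.
Variable R : realType.
Implicit Types (a b c d K B e : R) (u x dx : R -> R).

Lemma lip_within a b K u : (forall s t, s \in `[a, b] -> t \in `[a, b] ->
   `|u s - u t| <= K * `|s - t|) -> {within `[a, b], continuous u}.
Proof.
move=> uL; apply/subspace_continuousP => s sab; apply/cvgrPdist_le => e e0.
near=> t.
have tab : t \in `[a, b] by near: t; exact: withinT.
apply: le_trans (uL s t sab tab) _.
have K0 : 0 < `|K| + 1 by rewrite ltr_wpDl.
apply: (@le_trans _ _ ((`|K| + 1) * `|s - t|)).
  by rewrite ler_wpM2r// (le_trans (ler_norm _))// lerDl.
rewrite mulrC -ler_pdivlMr//.
near: t; apply: cvg_within; apply: (@cvgr_dist_le _ _ _ (nbhs s) _ id) => //.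
by rewrite divr_gt0.
Unshelve. all: by end_near. Qed.

Lemma within_bounded a b u : a <= b -> {within `[a, b], continuous u} ->
  exists2 B, 0 <= B & forall t, t \in `[a, b] -> `|u t| <= B.
Proof.
move=> ab cu; have [c1 c1ab m1] := EVT_max ab cu.
have [c2 c2ab m2] := EVT_min ab cu.
exists (`|u c1| + `|u c2|) => [|t tab]; first by rewrite addr_ge0.
have := m1 t tab; have := m2 t tab; have := ler_norm (u c1).
have := ler_norm (- u c2); rewrite normrN => h1 h2 h3 h4.
rewrite ler_norml; apply/andP; split; last by have := normr_ge0 (u c2); lra.
have := normr_ge0 (u c1); lra.
Qed.

Lemma deriv_lip a b B x dx : 
  (forall t, t \in `]a, b[ -> is_derive t 1 x (dx t)) ->
  {within `[a, b], continuous x} ->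
  (forall t, t \in `[a, b] -> `|dx t| <= B) ->
  forall s t, s \in `[a, b] -> t \in `[a, b] -> `|x s - x t| <= B * `|s - t|.
Proof.
move=> hd cx hB s t sab tab.
wlog st : s t sab tab / s < t.
  move=> wl; case: (ltgtP s t) => [st|st|->]; first exact: wl.
    by rewrite distrC (distrC s t); apply: wl.
  by rewrite !subrr normr0 mulr0.
have sub : {subset `[s, t] <= `[a, b]}.
  by apply/subitvP; rewrite subitvE/= !bnd_simp; move: sab tab; rewrite !in_itv/= => /andP[-> _] /andP[_ ->].
have subo : {subset `]s, t[ <= `]a, b[}.
  by apply/subitvP; rewrite subitvE/= !bnd_simp; move: sab tab; rewrite !in_itv/= => /andP[-> _] /andP[_ ->].
have [c cst] := @MVT _ x dx s t st (fun y ys => hd y (subo y ys)) (continuous_subspaceW (fun y ys => sub y ys) cx).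
rewrite distrC => ->; rewrite normrM (distrC s t) ler_wpM2r//; apply: hB.
by apply: sub; apply: subset_itv_oo_cc cst.
Qed.

Lemma Rint_within a b u : {within `[a, b], continuous u} ->
  lebesgue_measure.-integrable `[a, b] (EFin \o u).
Proof. by apply: continuous_compact_integrable; apply: segment_compact. Qed.

(** By the fundamental theorem [x d - x c] is the integral of [dx], so the difference is the
    integral of [(u t - u c) * dx t], at most [e * B] pointwise. *)
Lemma piece_bound c d B e u x dx : c < d ->
  (forall t, t \in `]c, d[ -> is_derive t 1 x (dx t)) ->
  {within `[c, d], continuous x} -> {within `[c, d], continuous dx} ->
  {within `[c, d], continuous u} -> 
  (forall t, t \in `[c, d] -> `|dx t| <= B) ->
  (forall t, t \in `[c, d] -> `|u t - u c| <= e) ->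
  `|\int[lebesgue_measure]_(t in `[c, d]) (u t * dx t) - u c * (x d - x c)| <= e * B * (d - c).
Proof.
move=> cd hd cx cdx cu hB he.
have fund : \int[lebesgue_measure]_(t in `[c, d]) (dx t) = x d - x c.
  rewrite /Rintegral (@continuous_FTC2 _ dx x)//.
    have [h1 h2 h3] := (continuous_within_itvP x cd).1 cx.
    split=> // t tcd; exact: (@ex_derive _ _ _ _ _ _ _ (hd t tcd)).
  by move=> t tcd; rewrite derive1E; exact: (@derive_val _ _ _ _ _ _ _ (hd t tcd)).
have cm : {within `[c, d], continuous (fun t => (u t - u c) * dx t)}.
  move=> t; apply: cvgM; last exact: cdx.
  by apply: cvgB; [exact: cu|exact: cvg_cst].
have cm1 : {within `[c, d], continuous (fun t => u t  * dx t)}.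
  by move=> t; apply: cvgM; [exact: cu|exact: cdx].
have cc : {within `[c, d], continuous (fun t => `|(u t - u c) * dx t|)}.
  by move=> t; apply: cvg_norm; exact: cm.
have cc2 : {within `[c, d], continuous (fun t => e * B : R)} by move=> t; exact: cvg_cst.
have cc3 : {within `[c, d], continuous (fun t => u c * dx t)}.
  by move=> t; apply: cvgM; [exact: cvg_cst|exact: cdx].
rewrite -fund -RintegralZl//; last exact: Rint_within.
rewrite -RintegralB//; [|exact: Rint_within|exact: Rint_within].
under eq_Rintegral do rewrite -mulrBl.
apply: le_trans (le_normr_Rintegral _ _) _ => //; first exact: Rint_within.
apply: (@le_trans _ _ (\int[lebesgue_measure]_(t in `[c, d]) (e * B))).
  apply: le_Rintegral => //; [exact: Rint_within|exact: Rint_within|].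
  move=> t tcd; rewrite normrM ler_pM//; [exact: he|exact: hB].
rewrite Rintegral_cst//.
have E : lebesgue_measure (`[c, d]%classic : set R) = (d - c)%:E by rewrite lebesgue_measure_itv/= lte_fin cd EFinB.
by rewrite [X in _ * fine X <= _](_ : _ = (d - c)%:E) //; exact: E.
Qed.

(** Inside a piece [velocity] is the given derivative, but at a break point [derive1] need not be:
    end points are discarded as a null set, and measurability on the closed interval is recovered
    from the open one. *)
Lemma eq_int_open c d (f g : R -> R) : lebesgue_measure.-integrable `[c, d] (EFin \o g) ->
  {in `]c, d[, f =1 g} ->
  lebesgue_measure.-integrable `[c, d] (EFin \o f) /\
  \int[lebesgue_measure]_(t in `[c, d]) f t = \int[lebesgue_measure]_(t in `[c, d]) g t.
Proof.
move=> ig fg.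
have igo : lebesgue_measure.-integrable `]c, d[ (EFin \o g).
  by apply: integrableS ig => //; exact: subset_itv_oo_cc.
have fgE : {in `]c, d[%classic, (EFin \o g) =1 (EFin \o f)}.
  by move=> t /[!inE]/= tcd; congr EFin; rewrite fg.
have ifo : lebesgue_measure.-integrable `]c, d[ (EFin \o f).
  by apply: eq_integrable igo => // t tcd; exact: fgE.
have mf := measurable_int _ ifo; have mg := measurable_int _ igo.
split; last first.
  congr fine; apply: eq_integral_itv_bounded => //; exact/measurable_EFinP.
move/integrableP: ifo => [_ foo].
apply/integrableP; split.
  apply: emeasurable_fun_itv_cc.
  exact: mf.
rewrite integral_itv_bndoo//.
exact: measurableT_comp.
Qed.

End RealPart.

Section Modulus.
Local Set Implicit Arguments. Local Unset Strict Implicit.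
Variable R : realType.
Local Notation C := (R[i]).
Implicit Types (x y z w : C).

Definition modc : C -> R := @Normc.normc R.
Local Notation nc := modc.

Lemma modc_ge0 x : 0 <= nc x. Proof. by case: x => a b; exact: sqrtr_ge0. Qed.
Lemma modc0 : nc 0 = 0. Proof. exact: Normc.normc0. Qed.
Lemma modc1 : nc 1 = 1. Proof. exact: Normc.normc1. Qed.
Lemma modcM x y : nc (x * y) = nc x * nc y. Proof. exact: Normc.normcM. Qed.
Lemma modcV x : nc x^-1 = (nc x)^-1. Proof. exact: Normc.normcV. Qed.
Lemma modcN x : nc (- x) = nc x. Proof. exact: normcN. Qed.
Lemma modcD x y : nc (x + y) <= nc x + nc y. Proof. exact: le_normcD. Qed.
Lemma modcB x y : nc (x - y) <= nc x + nc y.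
Proof. by rewrite -(modcN y) modcD. Qed.
Lemma modcBC x y : nc (x - y) = nc (y - x). Proof. by rewrite -modcN opprB. Qed.
Lemma modc_eq0 x : (nc x == 0) = (x == 0).
Proof. by apply/eqP/eqP => [/Normc.eq0_normc//|->]; exact: modc0. Qed.
Lemma modc_gt0 x : (0 < nc x) = (x != 0).
Proof. by rewrite lt_neqAle modc_ge0 andbT eq_sym modc_eq0. Qed.
Lemma modcX x n : nc (x ^+ n) = nc x ^+ n.
Proof. by elim: n => [|n IH]; rewrite ?expr0 ?modc1// !exprS modcM IH. Qed.
Lemma modc_normE x : `|x| = (nc x)%:C. Proof. by rewrite normc_def; case: x. Qed.
Lemma modc_tri x y z : nc (x - z) <= nc (x - y) + nc (y - z).
Proof. by apply: le_trans (modcD _ _); rewrite addrA subrK. Qed.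
Lemma Re_modc x : `|complex.Re x| <= nc x.
Proof.
case: x => a b /=; rewrite -sqrtr_sqr ler_wsqrtr// lerDl; exact: sqr_ge0.
Qed.
Lemma Im_modc x : `|complex.Im x| <= nc x.
Proof.
case: x => a b /=; rewrite -sqrtr_sqr ler_wsqrtr// lerDr; exact: sqr_ge0.
Qed.
Lemma modc_ReIm x : nc x <= `|complex.Re x| + `|complex.Im x|.
Proof.
case: x => a b /=; rewrite -[leRHS]ger0_norm ?addr_ge0//.
rewrite -sqrtr_sqr ler_wsqrtr// sqrrD !real_normK ?num_real//.
by rewrite -addrA lerD2l lerDr mulrn_wge0// mulr_ge0.
Qed.
Lemma modc_sum (I : Type) (r : seq I) (P : pred I) (F : I -> C) :
  nc (\sum_(i <- r | P i) F i) <= \sum_(i <- r | P i) nc (F i).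
Proof.
elim/big_ind2: _ => [|x a y b xa yb|//]; first by rewrite modc0.
by apply: le_trans (modcD _ _) _; exact: lerD.
Qed.
End Modulus.

Section Piece.
Local Set Implicit Arguments. Local Unset Strict Implicit.
Variable R : realType.
Local Notation C := (R[i]).
Local Notation nc := (@modc R).
Variable gamma : R -> C.
Implicit Types (a b c d K B e : R) (g : C -> C).
Local Notation Re := complex.Re.
Local Notation Im := complex.Im.

Definition lip1 K g := forall x y, curve gamma x -> curve gamma y ->
  nc (g x - g y) <= K * nc (x - y).

Definition int_on a b g : C :=
  (\int[lebesgue_measure]_(t in `[a, b]) Re (g (gamma t) * velocity gamma t))
  +i* (\int[lebesgue_measure]_(t in `[a, b]) Im (g (gamma t) * velocity gamma t)).

Definition integrable_on a b g : Prop :=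
  lebesgue_measure.-integrable `[a, b]
    (EFin \o (fun t => Re (g (gamma t) * velocity gamma t))) /\
  lebesgue_measure.-integrable `[a, b]
    (EFin \o (fun t => Im (g (gamma t) * velocity gamma t))).

Lemma ReM (x y : C) : Re (x * y) = Re x * Re y - Im x * Im y.
Proof. by case: x; case: y. Qed.
Lemma ImM (x y : C) : Im (x * y) = Re x * Im y + Im x * Re y.
Proof. by case: x; case: y. Qed.
Lemma ReB (x y : C) : Re (x - y) = Re x - Re y.
Proof. by case: x; case: y. Qed.
Lemma ImB (x y : C) : Im (x - y) = Im x - Im y.
Proof. by case: x; case: y. Qed.

(** A one-point Riemann sum errs by a quantity quadratic in [d - c]: one factor is the oscillation
    of [g] along the piece, the other its length. [L] depends on the curve alone and [K] enters
    linearly, which makes all later approximations uniform in the integrand. *)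
Lemma C1_piece a b : 0 <= a -> a < b -> b <= 1 ->
  {within `[0, 1], continuous (fun t => Re (gamma t))} ->
  {within `[0, 1], continuous (fun t => Im (gamma t))} ->
  C1_on a b gamma ->
  exists2 L, 0 <= L & 
    (forall s t, s \in `[a, b] -> t \in `[a, b] -> nc (gamma s - gamma t) <= L * `|s - t|) /\
    forall K g c d, 0 <= K -> lip1 K g -> a <= c -> c < d -> d <= b ->
      integrable_on c d g /\
      nc (int_on c d g - g (gamma c) * (gamma d - gamma c)) <= L * K * (d - c) ^+ 2.
Proof.
move=> a0 ab b1 cx cy [dg [cdx cdy hd]].
have sub : {subset `[a, b] <= `[0, 1]} by apply/subitvP; rewrite subitvE/= !bnd_simp a0.
have [B1 B10 hB1] := within_bounded (ltW ab) cdx.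
have [B2 B20 hB2] := within_bounded (ltW ab) cdy.
pose B := B1 + B2.
have B0 : 0 <= B by rewrite addr_ge0.
have hx t : t \in `[a, b] -> `|Re (dg t)| <= B.
  by move=> /hB1 h; apply: le_trans h _; rewrite lerDl.
have hy t : t \in `[a, b] -> `|Im (dg t)| <= B.
  by move=> /hB2 h; apply: le_trans h _; rewrite lerDr.
have cxab : {within `[a, b], continuous (fun t => Re (gamma t))}.
  by apply: continuous_subspaceW cx => t; exact: sub.
have cyab : {within `[a, b], continuous (fun t => Im (gamma t))}.
  by apply: continuous_subspaceW cy => t; exact: sub.
have lipx := deriv_lip (fun t tab => (hd t tab).1) cxab hx.
have lipy := deriv_lip (fun t tab => (hd t tab).2) cyab hy.
have lipg s t : s \in `[a, b] -> t \in `[a, b] -> nc (gamma s - gamma t) <= 2 * B * `|s - t|.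
  move=> sab tab; apply: le_trans (modc_ReIm _) _; rewrite ReB ImB.
  by have := lipx s t sab tab; have := lipy s t sab tab; lra.
(* [2 * B] is a Lipschitz constant of [gamma]; [8 * B ^+ 2] collects four real integrals, each with
   oscillation [K * (2 * B) * (d - c)] and derivative at most [B]. *)
exists (2 * B + 8 * B ^+ 2); first by have := sqr_ge0 B; lra.
split.
  move=> s t sab tab; apply: le_trans (lipg s t sab tab) _.
  by rewrite ler_wpM2r// lerDl mulr_ge0// sqr_ge0.
move=> K g c d K0 lg ac cd db.
have subcd : {subset `[c, d] <= `[a, b]} by apply/subitvP; rewrite subitvE/= !bnd_simp ac.
have subcdo : {subset `]c, d[ <= `]a, b[} by apply/subitvP; rewrite subitvE/= !bnd_simp ac.
have cvt t : t \in `[a, b] -> curve gamma (gamma t).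
  by move=> tab; exists t => //; exact: sub.
have lipG s t : s \in `[a, b] -> t \in `[a, b] ->
    nc (g (gamma s) - g (gamma t)) <= K * (2 * B) * `|s - t|.
  move=> sab tab; apply: le_trans (lg _ _ (cvt _ sab) (cvt _ tab)) _.
  by rewrite -mulrA ler_wpM2l// lipg.
pose u t := Re (g (gamma t)); pose v t := Im (g (gamma t)).
have lu s t : s \in `[a, b] -> t \in `[a, b] -> `|u s - u t| <= K * (2 * B) * `|s - t|.
  by move=> sab tab; apply: le_trans (lipG _ _ sab tab); rewrite -ReB Re_modc.
have lv s t : s \in `[a, b] -> t \in `[a, b] -> `|v s - v t| <= K * (2 * B) * `|s - t|.
  by move=> sab tab; apply: le_trans (lipG _ _ sab tab); rewrite -ImB Im_modc.
have sW (f : R -> R) : {within `[a, b], continuous f} -> {within `[c, d], continuous f}.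
  by apply: continuous_subspaceW => t; exact: subcd.
have cu := sW _ (lip_within lu); have cv := sW _ (lip_within lv).
have ccab : c \in `[a, b] by rewrite in_itv/= ac ltW// (lt_le_trans cd).
have osc (f : R -> R) : (forall s t, s \in `[a, b] -> t \in `[a, b] -> `|f s - f t| <= K * (2 * B) * `|s - t|) -> 
    forall t, t \in `[c, d] -> `|f t - f c| <= K * (2 * B) * (d - c).
  move=> hf t tcd; apply: le_trans (hf t c (subcd _ tcd) ccab) _.
  apply: ler_wpM2l; first by rewrite !mulr_ge0.
  by move: tcd; rewrite in_itv/= => /andP[? ?]; rewrite ger0_norm; lra.
have pb (f h dh : R -> R) := @piece_bound R c d B (K * (2 * B) * (d - c)) f h dh cd.
have hdx t : t \in `]c, d[ -> is_derive t 1 (fun u0 => Re (gamma u0)) (Re (dg t)).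
  by move=> tcd; exact: (hd t (subcdo _ tcd)).1.
have hdy t : t \in `]c, d[ -> is_derive t 1 (fun u0 => Im (gamma u0)) (Im (dg t)).
  by move=> tcd; exact: (hd t (subcdo _ tcd)).2.
have hxcd t : t \in `[c, d] -> `|Re (dg t)| <= B by move=> /subcd; exact: hx.
have hycd t : t \in `[c, d] -> `|Im (dg t)| <= B by move=> /subcd; exact: hy.
have p1 := pb u _ _ hdx (sW _ cxab) (sW _ cdx) cu hxcd (osc u lu).
have p2 := pb v _ _ hdy (sW _ cyab) (sW _ cdy) cv hycd (osc v lv).
have p3 := pb u _ _ hdy (sW _ cyab) (sW _ cdy) cu hycd (osc u lu).
have p4 := pb v _ _ hdx (sW _ cxab) (sW _ cdx) cv hxcd (osc v lv).
have cM (f h : R -> R) : {within `[c, d], continuous f} -> {within `[c, d], continuous h} ->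
   lebesgue_measure.-integrable `[c, d] (EFin \o (fun t => f t * h t)).
  by move=> cf ch; apply: Rint_within => t; apply: cvgM; [exact: cf|exact: ch].
have iux := cM _ _ cu (sW _ cdx); have ivy := cM _ _ cv (sW _ cdy).
have iuy := cM _ _ cu (sW _ cdy); have ivx := cM _ _ cv (sW _ cdx).
have vel t : t \in `]c, d[ -> velocity gamma t = dg t.
  move=> tcd; rewrite /velocity !derive1E.
  rewrite (@derive_val _ _ _ _ _ _ _ (hdx t tcd)) (@derive_val _ _ _ _ _ _ _ (hdy t tcd)).
  by case: (dg t).
have [iR eR] : lebesgue_measure.-integrable `[c, d] (EFin \o (fun t => Re (g (gamma t) * velocity gamma t))) /\ 
   \int[lebesgue_measure]_(t in `[c, d]) Re (g (gamma t) * velocity gamma t) = \int[lebesgue_measure]_(t in `[c, d]) (u t * Re (dg t) - v t * Im (dg t)).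
  apply: eq_int_open; last by move=> t tcd; rewrite vel// ReM.
  exact: (integrableB _ iux ivy).
have [iI eI] : lebesgue_measure.-integrable `[c, d] (EFin \o (fun t => Im (g (gamma t) * velocity gamma t))) /\ 
   \int[lebesgue_measure]_(t in `[c, d]) Im (g (gamma t) * velocity gamma t) = \int[lebesgue_measure]_(t in `[c, d]) (u t * Im (dg t) + v t * Re (dg t)).
  apply: eq_int_open; last by move=> t tcd; rewrite vel// ImM.
  exact: (integrableD _ iuy ivx).
split; first by split.
rewrite /int_on eR eI RintegralB// RintegralD//.
apply: le_trans (modc_ReIm _) _; rewrite ReB ImB ReM ImM !ReB !ImB /=.
set I1 := Rintegral _ _ _ in p1 *; set I2 := Rintegral _ _ _ in p2 *.
set I3 := Rintegral _ _ _ in p3 *; set I4 := Rintegral _ _ _ in p4 *.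
rewrite -/(u c) -/(v c).
apply: (@le_trans _ _ (4 * (K * (2 * B) * (d - c) * B * (d - c)))).
  move: p1 p2 p3 p4; rewrite !ler_norml => /andP[? ?] /andP[? ?] /andP[? ?] /andP[? ?].
  set A := (`|_| : R) ; set A' := (`|_| : R).
  have hA : A <= 2 * (K * (2 * B) * (d - c) * B * (d - c)) by rewrite ler_norml; apply/andP; split; lra.
  have hA' : A' <= 2 * (K * (2 * B) * (d - c) * B * (d - c)) by rewrite ler_norml; apply/andP; split; lra.
  lra.
rewrite [leLHS](_ : _ = 8 * B ^+ 2 * K * (d - c) ^+ 2); last by ring.
by rewrite ler_wpM2r ?sqr_ge0// ler_wpM2r// lerDr mulr_ge0.
Qed.

End Piece.

Section Approx.
Local Set Implicit Arguments. Local Unset Strict Implicit.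
Variable R : realType.
Local Notation C := (R[i]).
Local Notation nc := (@modc R).
Variable gamma : R -> C.
Implicit Types (a b c d K B e : R) (g : C -> C).
Local Notation Re := complex.Re.
Local Notation Im := complex.Im.

Lemma integrable_concat a b c (f : R -> R) : a <= c -> c <= b ->
  lebesgue_measure.-integrable `[a, c] (EFin \o f) ->
  lebesgue_measure.-integrable `[c, b] (EFin \o f) ->
  lebesgue_measure.-integrable `[a, b] (EFin \o f) /\
  \int[lebesgue_measure]_(t in `[a, b]) f t =
  \int[lebesgue_measure]_(t in `[a, c]) f t + \int[lebesgue_measure]_(t in `[c, b]) f t.
Proof.
move=> ac cb i1 i2.
have i2' : lebesgue_measure.-integrable `]c, b] (EFin \o f).
  by apply: integrableS i2 => //; exact: subset_itv_oc_cc.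
have E : `[a, b]%classic = `[a, c]%classic `|` `]c, b]%classic.
  by apply: itv_bndbnd_setU; rewrite bnd_simp.
have D : [disjoint `[a, c]%classic & `]c, b]%classic].
  apply/disj_setPS => t [/=]; rewrite !in_itv/= => /andP[_ h1] /andP[h2 _].
  by have := le_lt_trans h1 h2; rewrite ltxx.
have iU : lebesgue_measure.-integrable `[a, b] (EFin \o f).
  move: i1 i2' => /integrableP[m1 f1] /integrableP[m2 f2].
  have mU : measurable_fun `[a, b]%classic (EFin \o f).
    by rewrite E; apply/measurable_funU.
  apply/integrableP; split => //.
  have mA : measurable_fun `[a, b]%classic (abse \o (EFin \o f)) by exact: measurableT_comp.
  rewrite E ge0_integral_setU//; last by rewrite -E.
  exact: lte_add_pinfty.
split=> //; rewrite E Rintegral_setU//; last by rewrite -E.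
by rewrite Rintegral_itv_obnd_cbnd.
Qed.

Lemma int_on_concat a b c g : a <= c -> c <= b ->
  integrable_on gamma a c g -> integrable_on gamma c b g ->
  integrable_on gamma a b g /\
  int_on gamma a b g = int_on gamma a c g + int_on gamma c b g.
Proof.
move=> ac cb [r1 i1] [r2 i2].
have [r3 er] := integrable_concat ac cb r1 r2.
have [i3 ei] := integrable_concat ac cb i1 i2.
by split; [split|rewrite /int_on er ei].
Qed.

Definition steps a (ts : seq R) : seq (R * R) := zip (a :: ts) ts.

Lemma steps_cat a ts us : steps a (ts ++ us) = steps a ts ++ steps (last a ts) us.
Proof. by elim: ts a => //= t ts IH a; rewrite /steps/= -IH. Qed.

Definition rsum a ts g : C :=
  \sum_(p <- steps a ts) g (gamma p.1) * (gamma p.2 - gamma p.1).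

(* The bound on the sum of squares makes second-order Taylor remainders negligible
   in [oint_FTC]. *)
Definition approximable a b L : Prop := 
  forall e, 0 < e -> exists ts, [/\ last a ts = b, all (mem `[a, b]) ts,
    \sum_(p <- steps a ts) nc (gamma p.2 - gamma p.1) <= L,
    \sum_(p <- steps a ts) nc (gamma p.2 - gamma p.1) ^+ 2 <= e &
    forall K g, 0 <= K -> lip1 gamma K g -> integrable_on gamma a b g /\
     nc (int_on gamma a b g - rsum a ts g) <= e * K].

Lemma approx_concat a b c L L' : a <= c -> c <= b -> approximable a c L -> approximable c b L' ->
  approximable a b (L + L').
Proof.
move=> ac cb A1 A2 e e0.
have e2 : 0 < e / 2 by rewrite divr_gt0.
have [ts [l1 a1 v1 q1 h1]] := A1 _ e2.
have [us [l2 a2 v2 q2 h2]] := A2 _ e2.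
exists (ts ++ us); rewrite steps_cat l1 !big_cat last_cat l1 /= all_cat; split => //.
- apply/andP; split.
    apply: sub_all a1 => t /=; rewrite !in_itv/= => /andP[-> tc]; exact: le_trans tc cb.
  apply: sub_all a2 => t /=; rewrite !in_itv/= => /andP[tc ->]; rewrite andbT; exact: le_trans ac tc.
- exact: lerD.
- by move: (lerD q1 q2); rewrite -splitr.
move=> K g K0 lg.
have [i1 e1] := h1 K g K0 lg; have [i2 e2'] := h2 K g K0 lg.
have [iU eU] := int_on_concat ac cb i1 i2.
split=> //; rewrite eU /rsum steps_cat l1 big_cat /= -/(rsum a ts g) -/(rsum c us g).
rewrite opprD addrACA; apply: le_trans (modcD _ _) _.
by have := lerD e1 e2'; rewrite -mulrDl -splitr.
Qed.

Fixpoint equi h N c : seq R := if N is N'.+1 then (c + h) :: equi h N' (c + h) else [::].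

Lemma approx_C1 a b : 0 <= a -> a < b -> b <= 1 ->
  {within `[0, 1], continuous (fun t => Re (gamma t))} ->
  {within `[0, 1], continuous (fun t => Im (gamma t))} ->
  C1_on a b gamma -> exists2 L, 0 <= L & approximable a b L.
Proof.
move=> a0 ab b1 cx cy cg.
have [L L0 [lg pc]] := C1_piece a0 ab b1 cx cy cg.
have key h : 0 < h -> forall N c, a <= c -> c + h *+ N.+1 <= b ->
  let ts := equi h N.+1 c in
   [/\ last c ts = c + h *+ N.+1, all (mem `[a, b]) ts,
    \sum_(p <- steps c ts) nc (gamma p.2 - gamma p.1) <= (L * h) *+ N.+1,
    \sum_(p <- steps c ts) nc (gamma p.2 - gamma p.1) ^+ 2 <= ((L * h) ^+ 2) *+ N.+1 &
    forall K g, 0 <= K -> lip1 gamma K g -> integrable_on gamma c (c + h *+ N.+1) g /\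
     nc (int_on gamma c (c + h *+ N.+1) g - rsum c ts g) <= (L * K * h ^+ 2) *+ N.+1].
  move=> h0; have step c : a <= c -> c + h <= b -> nc (gamma (c + h) - gamma c) <= L * h.
    move=> ac cb; have E : `|c + h - c| = h by rewrite addrC addKr gtr0_norm.
    by rewrite -{2}E; apply: lg; rewrite in_itv/=; apply/andP; split; lra.
  elim=> [|N IH] c ac cb; cbv zeta.
    rewrite /steps /rsum /= !big_cons !big_nil !addr0 !mulr1n in cb *.
    have st := step _ ac cb.
    have ch : c < c + h by rewrite ltrDl.
    split => //; first by rewrite /= in_itv/= cb andbT; apply/andP; split => //; lra.
      by rewrite lerXn2r ?nnegrE// ?modc_ge0// mulr_ge0// ltW.
    move=> K g K0 lgg; have [i1 e1] := pc K g c (c + h) K0 lgg ac ch cb.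
    split=> //; rewrite /rsum /steps /= big_cons big_nil addr0 /=.
    by move: e1; rewrite [c + h - c]addrC addKr.
  have hN : 0 <= h *+ N.+1 by rewrite mulrn_wge0// ltW.
  have chb : c + h <= b by move: cb; rewrite mulrS; lra.
  have chb2 : c + h + h *+ N.+1 <= b by rewrite -addrA -mulrS.
  have ach : a <= c + h by lra.
  have st := step _ ac chb.
  have ch : c < c + h by rewrite ltrDl.
  have [l1 a1 v1 q1 h1] := IH (c + h) ach chb2.
  rewrite [equi h N.+2 c]/= -/(equi h N.+1 (c + h)).
  set us := equi h N.+1 (c + h) in l1 a1 v1 q1 h1 *.
  clearbody us.
  have sE : steps c (c + h :: us) = (c, c + h) :: steps (c + h) us by [].
  rewrite !(mulrS _ N.+1) addrA sE !big_cons /=; split => //.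
  - by apply/andP; split => //; rewrite in_itv/=; apply/andP; split.
  - exact: lerD.
  - by apply: lerD => //; rewrite lerXn2r ?nnegrE// ?modc_ge0// mulr_ge0// ltW.
  move=> K g K0 lgg; have [i1 e1] := pc K g c (c + h) K0 lgg ac ch chb.
  have [i2 e2] := h1 K g K0 lgg.
  have ch3 : c + h <= c + h + h *+ N.+1 by rewrite lerDl.
  have [iU eU] := int_on_concat (ltW ch) ch3 i1 i2.
  split => //; rewrite eU /rsum sE big_cons -/(rsum (c + h) us g) /=.
  rewrite opprD addrACA; apply: le_trans (modcD _ _) _; apply: lerD => //.
  by move: e1; rewrite [c + h - c]addrC addKr.
exists (L * (b - a)) => [|e e0]; first by rewrite mulr_ge0// subr_ge0 ltW.
(* [L * (b - a) ^+ 2 / N.+1] bounds the quadrature error per unit of [K], and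
   [L ^+ 2 * (b - a) ^+ 2 / N.+1] the sum of the squared steps; [M] serves for both. *)
pose M := (L + L ^+ 2) * (b - a) ^+ 2.
have M0 : 0 <= M by rewrite mulr_ge0 ?sqr_ge0// addr_ge0// sqr_ge0.
pose N := Num.truncn (M / e).
have MN : M / e < N.+1%:R by apply: truncnS_gt.
have N0 : 0 < N.+1%:R :> R by rewrite ltr0n.
pose h := (b - a) / N.+1%:R.
have h0 : 0 < h by rewrite divr_gt0 // subr_gt0.
have hN : h *+ N.+1 = b - a by rewrite -mulr_natr divfK// gt_eqF.
have Me : M / N.+1%:R <= e.
  by rewrite ler_pdivrMr// mulrC -ler_pdivrMr// ltW.
have hh : h ^+ 2 *+ N.+1 = (b - a) ^+ 2 / N.+1%:R.
  rewrite expr2 -mulrnAr hN /h expr2; field; exact: lt0r_neq0.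
have [] := key h h0 N a (lexx a); first by rewrite hN; lra.
rewrite hN addrC subrK => l1 a1 v1 q1 h1.
exists (equi h N.+1 a); split => //.
- by apply: le_trans v1 _; rewrite -mulrnAr hN.
- apply: le_trans q1 _; rewrite exprMn -mulrnAr hh mulrA; apply: le_trans Me.
  rewrite ler_wpM2r ?invr_ge0 ?(ltW N0)// ler_wpM2r ?sqr_ge0// lerDr//.
move=> K g K0 lgg; have [i1 e1] := h1 K g K0 lgg; split => //.
apply: le_trans e1 _; rewrite -mulrnAr hh [L * K]mulrC -mulrA [e * K]mulrC ler_wpM2l//.
rewrite mulrA; apply: le_trans Me.
rewrite ler_wpM2r ?invr_ge0 ?(ltW N0)// ler_wpM2r ?sqr_ge0// lerDl sqr_ge0//.
Qed.

Lemma approx_contour : piecewise_C1 gamma -> exists2 L, 0 <= L & approximable 0 1 L.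
Proof.
move=> [cx cy [ts [pts lts hts]]].
have key : forall us a, 0 <= a -> a < 1 -> path <%R a us -> last a us = 1 ->
    (forall i, (i < size us)%N -> C1_on (nth 0 (a :: us) i) (nth 0 us i) gamma) ->
    exists2 L, 0 <= L & approximable a 1 L.
  elim=> [|t us IH] a a0 a1 /=; first by move=> _ e; rewrite e ltxx in a1.
  move=> /andP[at_ pu] lu hu.
  have h0 : C1_on a t gamma by exact: (hu 0%N isT).
  have t1 : t <= 1.
    rewrite -lu; have /= /allP := order_path_min lt_trans pu.
    case: (lastP us) => [//|s' x]; rewrite last_rcons => /(_ x) h.
    by apply: ltW; apply: h; rewrite mem_rcons inE eqxx.
  have [L L0 hL] := approx_C1 a0 at_ t1 cx cy h0.
  move: t1; rewrite le_eqVlt => /orP[/eqP tE|t1]; first by exists L => //; rewrite -tE.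
  have [|L' L0' hL'] := IH t (le_trans a0 (ltW at_)) t1 pu lu.
    by move=> i iu; exact: (hu i.+1 iu).
  exists (L + L'); first exact: addr_ge0.
  exact: approx_concat (ltW at_) (ltW t1) hL hL'.
exact: (key ts 0).
Qed.

End Approx.

Section Functional.
Local Set Implicit Arguments. Local Unset Strict Implicit.
Variable R : realType.
Local Notation C := (R[i]).
Local Notation nc := (@modc R).
Variables (gamma : R -> C) (L : R).
Hypotheses (L0 : 0 <= L) (hA : approximable gamma 0 1 L).
Local Notation crv := (curve gamma).
Local Notation I := (oint gamma).
Implicit Types (K e M : R) (f g F : C -> C) (z a : C).

(** The parametrization is forgotten and pairs of points of the curve are kept. The telescoping
    clause is what remains of the fact that consecutive pairs share a point. *)
Lemma oint_approx e : 0 < e -> exists ps : seq (C * C),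
  [/\ {in ps, forall p, crv p.1 /\ crv p.2},
    \sum_(p <- ps) nc (p.2 - p.1) <= L,
    \sum_(p <- ps) nc (p.2 - p.1) ^+ 2 <= e,
    forall F, \sum_(p <- ps) (F p.2 - F p.1) = F (gamma 1) - F (gamma 0) &
    forall K g, 0 <= K -> lip1 gamma K g ->
     nc (I g - \sum_(p <- ps) g p.1 * (p.2 - p.1)) <= e * K].
Proof.
move=> /hA[ts [l1 a1 v1 q1 h1]].
exists [seq (gamma p.1, gamma p.2) | p <- steps 0 ts].
rewrite !big_map; split => //.
- move=> p /mapP[x xs ->] /=.
  have : x.1 \in `[0, 1] /\ x.2 \in `[0, 1].
    have : all (mem `[0, 1]) (0 :: ts) by rewrite /= a1 andbT in_itv/= lexx ler01.
    have gen (J : interval R) (a : R) (us : seq R) : x \in zip (a :: us) us -> all (mem J) (a :: us) ->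
        x.1 \in J /\ x.2 \in J.
      elim: us a => //= t us IH a; rewrite inE => /orP[/eqP-> /and3P[]//|xs' /andP[_ h]].
      exact: (IH t).
    exact: gen.
  by move=> [x1 x2]; split; [exists x.1|exists x.2].
- move=> F; rewrite big_map /=.
  rewrite -l1; move: (0 : R); elim: ts {l1 a1 v1 q1 h1} => [|t ts IH] a.
    by rewrite /steps big_nil subrr.
  rewrite /steps /= big_cons -/(steps t ts) IH /=.
  by rewrite addrC addrA subrK.
by move=> K g K0 lg; rewrite big_map; exact: (h1 K g K0 lg).2.
Qed.

Lemma modc_small_eq0 (x : C) M : (forall e, 0 < e -> nc x <= e * M) -> x = 0.
Proof.
move=> h; apply/eqP; rewrite -modc_eq0; apply/eqP/le_anti; rewrite modc_ge0 andbT.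
apply/ler_addgt0Pr => e e0; rewrite add0r.
have M1 : 0 < `|M| + 1 by rewrite ltr_wpDl.
have := h (e / (`|M| + 1)) (divr_gt0 e0 M1) => /le_trans; apply.
rewrite mulrAC ler_pdivrMr// ler_wpM2l ?(ltW e0)//.
by rewrite (le_trans (ler_norm _))// lerDl.
Qed.

Lemma eq_oint g f : (forall z, crv z -> g z = f z) -> I g = I f.
Proof.
by move=> gf; rewrite /oint; congr (_ +i* _); apply: eq_Rintegral => t; rewrite inE /= => tI;
   rewrite gf//; exists t.
Qed.

Lemma lip1D K1 K2 f g : lip1 gamma K1 f -> lip1 gamma K2 g -> lip1 gamma (K1 + K2) (fun z => f z + g z).
Proof.
move=> lf lg x y cx cy; rewrite opprD addrACA mulrDl.
by apply: le_trans (modcD _ _) _; apply: lerD; [exact: lf|exact: lg].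
Qed.

Lemma lip1Z K a f : lip1 gamma K f -> lip1 gamma (nc a * K) (fun z => a * f z).
Proof.
by move=> lf x y cx cy; rewrite -mulrBr modcM -mulrA ler_wpM2l ?modc_ge0//; exact: lf.
Qed.

Lemma ointD K1 K2 f g : 0 <= K1 -> 0 <= K2 -> lip1 gamma K1 f -> lip1 gamma K2 g ->
  I (fun z => f z + g z) = I f + I g.
Proof.
move=> K10 K20 lf lg; apply/eqP; rewrite -subr_eq0; apply/eqP.
apply: (@modc_small_eq0 _ (K1 + K2 + (K1 + K2))) => e e0.
have [ps [_ _ _ _ h]] := oint_approx e0.
have h1 := h _ _ K10 lf; have h2 := h _ _ K20 lg.
have h3 := h _ _ (addr_ge0 K10 K20) (lip1D lf lg).
rewrite [X in nc X](_ : _ = (I (fun z => f z + g z) - \sum_(p <- ps) (f p.1 + g p.1) * (p.2 - p.1)) 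
  - ((I f - \sum_(p <- ps) f p.1 * (p.2 - p.1)) + (I g - \sum_(p <- ps) g p.1 * (p.2 - p.1)))).
  apply: le_trans (modcB _ _) _; rewrite [leRHS]mulrDr; apply: lerD => //.
  by apply: le_trans (modcD _ _) _; rewrite [leRHS]mulrDr; apply: lerD.
under [\sum_(p <- ps) (f p.1 + g p.1) * _]eq_bigr do rewrite mulrDl.
rewrite big_split /=; ring.
Qed.

Lemma ointZ K a g : 0 <= K -> lip1 gamma K g -> I (fun z => a * g z) = a * I g.
Proof.
move=> K0 lg; apply/eqP; rewrite -subr_eq0; apply/eqP.
apply: (@modc_small_eq0 _ (nc a * K + nc a * K)) => e e0.
have [ps [_ _ _ _ h]] := oint_approx e0.
have h1 := h _ _ K0 lg; have h3 := h _ _ (mulr_ge0 (modc_ge0 a) K0) (lip1Z a lg).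
rewrite [X in nc X](_ : _ = (I (fun z => a * g z) - \sum_(p <- ps) (a * g p.1) * (p.2 - p.1)) 
  - a * (I g - \sum_(p <- ps) g p.1 * (p.2 - p.1))).
  apply: le_trans (modcB _ _) _; rewrite [leRHS]mulrDr; apply: lerD => //.
  by rewrite modcM mulrCA ler_wpM2l ?modc_ge0.
under [\sum_(p <- ps) (a * g p.1) * _]eq_bigr do rewrite -mulrA.
rewrite -mulr_sumr; ring.
Qed.

Lemma oint_bound K M g : 0 <= K -> lip1 gamma K g -> (forall z, crv z -> nc (g z) <= M) ->
  nc (I g) <= L * M.
Proof.
move=> K0 lg hM; apply/ler_addgt0Pr => e e0.
have K1 : 0 < K + 1 by rewrite ltr_wpDl.
have [ps [cps v _ _ h]] := oint_approx (divr_gt0 e0 K1).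
have M0 : 0 <= M.
  by apply: le_trans (modc_ge0 _) (hM (gamma 0) _); exists 0 => //=; rewrite in_itv/= lexx ler01.
rewrite -[I g](subrK (\sum_(p <- ps) g p.1 * (p.2 - p.1))) addrC.
apply: le_trans (modcD _ _) _; rewrite addrC [leRHS]addrC; apply: lerD.
  apply: le_trans (h _ _ K0 lg) _; rewrite mulrAC ler_pdivrMr// ler_wpM2l ?(ltW e0)//.
  by rewrite lerDl.
apply: le_trans (modc_sum _ _ _) _.
apply: (@le_trans _ _ (\sum_(p <- ps) M * nc (p.2 - p.1))).
  rewrite big_seq_cond [leRHS]big_seq_cond; apply: ler_sum => p /andP[pps _].
  by rewrite modcM ler_wpM2r ?modc_ge0//; apply: hM; exact: (cps _ pps).1.
by rewrite -mulr_sumr mulrC ler_wpM2r.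
Qed.

(** The increments of [F] telescope to 0 on a closed curve, and each is [f dz] up to a quadratic
    remainder; the remainders add up to at most [K * e] by the sum-of-squares clause. *)
Lemma oint_FTC K K' F f : 0 <= K -> 0 <= K' -> gamma 0 = gamma 1 -> lip1 gamma K' f ->
  (forall x y, crv x -> crv y -> nc (F y - F x - f x * (y - x)) <= K * nc (y - x) ^+ 2) ->
  I f = 0.
Proof.
move=> K0 K'0 cl lf hF; apply: (@modc_small_eq0 _ (K' + K)) => e e0.
have [ps [cps _ q tele h]] := oint_approx e0.
have := tele F; rewrite cl subrr => t0.
rewrite -[I f](subrK (\sum_(p <- ps) f p.1 * (p.2 - p.1))).
apply: le_trans (modcD _ _) _; rewrite [leRHS]mulrDr; apply: lerD; first exact: h.
have -> : \sum_(p <- ps) f p.1 * (p.2 - p.1) = - \sum_(p <- ps) (F p.2 - F p.1 - f p.1 * (p.2 - p.1)).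
  by rewrite sumrB t0 sub0r opprK.
rewrite modcN.
apply: le_trans (modc_sum _ _ _) _.
apply: (@le_trans _ _ (\sum_(p <- ps) K * nc (p.2 - p.1) ^+ 2)).
  rewrite big_seq_cond [leRHS]big_seq_cond; apply: ler_sum => p /andP[pps _].
  by have [c1 c2] := cps _ pps; exact: hF.
by rewrite -mulr_sumr mulrC ler_wpM2r.
Qed.

Lemma oint_lip K (H : C -> C -> C) : 0 <= K ->
  (forall x x' y y', crv x -> crv x' -> crv y -> crv y' ->
     nc (H x y - H x' y') <= K * (nc (x - x') + nc (y - y'))) ->
  lip1 gamma (L * K) (fun x => I (H x)).
Proof.
move=> K0 lH x x' cx cx'.
have lx z : crv z -> lip1 gamma K (H z).
  by move=> cz y y' cy cy'; have := lH z z y y' cz cz cy cy'; rewrite subrr modc0 add0r.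
have -> : I (H x) - I (H x') = I (fun y => H x y + (- 1) * H x' y).
  rewrite (ointD K0 _ (lx _ cx) (lip1Z _ (lx _ cx'))); last by rewrite mulr_ge0 ?modc_ge0.
  by rewrite (ointZ _ K0 (lx _ cx')) mulN1r.
rewrite -mulrA; apply: (oint_bound _ (lip1D (lx _ cx) (lip1Z _ (lx _ cx')))).
  by rewrite addr_ge0// mulr_ge0 ?modc_ge0.
move=> y cy; rewrite mulN1r.
by have := lH x x' y y cx cx' cy cy; rewrite [y - y]subrr modc0 addr0.
Qed.

Lemma oint_Fubini K (H : C -> C -> C) : 0 <= K ->
  (forall x x' y y', crv x -> crv x' -> crv y -> crv y' ->
     nc (H x y - H x' y') <= K * (nc (x - x') + nc (y - y'))) ->
  I (fun x => I (fun y => H x y)) = I (fun y => I (fun x => H x y)).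
Proof.
move=> K0.
(* An iterated integral against the double sum over one list: the outer sum errs by [e * (L * K)],
   since [oint_lip] makes the inner integral Lipschitz, and the inner sums err by [e * K] per unit
   of length. Used in both orders with the same [ps], this leaves an exchange of finite sums. *)
have half (G : C -> C -> C) e ps : 0 < e -> {in ps, forall p, crv p.1 /\ crv p.2} ->
   \sum_(p <- ps) nc (p.2 - p.1) <= L ->
   (forall K g, 0 <= K -> lip1 gamma K g ->
     nc (I g - \sum_(p <- ps) g p.1 * (p.2 - p.1)) <= e * K) ->
   (forall x x' y y', crv x -> crv x' -> crv y -> crv y' ->
     nc (G x y - G x' y') <= K * (nc (x - x') + nc (y - y'))) ->
   nc (I (fun x => I (fun y => G x y)) - 
       \sum_(p <- ps) \sum_(r <- ps) G p.1 r.1 * (p.2 - p.1) * (r.2 - r.1)) <= e * (L * K + L * K).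
  move=> e0 cps v h lG.
  rewrite -[I (fun x => _)](subrK (\sum_(p <- ps) I (G p.1) * (p.2 - p.1))) -addrA.
  apply: le_trans (modcD _ _) _; rewrite [leRHS]mulrDr; apply: lerD.
    by apply: h; [rewrite mulr_ge0|exact: oint_lip].
  rewrite -sumrB; apply: le_trans (modc_sum _ _ _) _.
  apply: (@le_trans _ _ (\sum_(p <- ps) (e * K) * nc (p.2 - p.1))).
    rewrite big_seq_cond [leRHS]big_seq_cond; apply: ler_sum => p /andP[pps _].
    have [c1 c2] := cps _ pps.
    rewrite (_ : \sum_(r <- ps) _ = (\sum_(r <- ps) G p.1 r.1 * (r.2 - r.1)) * (p.2 - p.1)); last first.
      by rewrite mulr_suml; apply: eq_bigr => r _; rewrite mulrAC.
    rewrite -mulrBl modcM ler_wpM2r ?modc_ge0//; apply: h => //.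
    by move=> y y' cy cy'; have := lG p.1 p.1 y y' c1 c1 cy cy'; rewrite subrr modc0 add0r.
  by rewrite -mulr_sumr -mulrA ler_wpM2l ?(ltW e0)// mulrC ler_wpM2r.
move=> lH.
apply/eqP; rewrite -subr_eq0; apply/eqP.
apply: (@modc_small_eq0 _ ((L * K + L * K) + (L * K + L * K))) => e e0.
have [ps [cps v q tele h]] := oint_approx e0.
have h1 := half _ _ _ e0 cps v h lH.
have h2 := half (fun y x => H x y) _ _ e0 cps v h _.
rewrite -(subrKA (\sum_(p <- ps) \sum_(r <- ps) H p.1 r.1 * (p.2 - p.1) * (r.2 - r.1))).
apply: le_trans (modcD _ _) _; rewrite [leRHS]mulrDr; apply: lerD => //.
rewrite modcBC exchange_big /=.
under eq_bigr => p _ do under eq_bigr => r _ do rewrite mulrAC.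
by apply: h2 => y y' x x' cy cy' cx cx'; rewrite [nc (y - _) + _]addrC; exact: lH.
Qed.

(** Boundedness is part of the class so that products stay in it, with an explicit constant. *)
Definition bounded_lip f := exists2 K, 0 <= K & (forall z, crv z -> nc (f z) <= K) /\ lip1 gamma K f.

Lemma bounded_lip_oint_lip f : bounded_lip f -> exists2 K, 0 <= K & lip1 gamma K f.
Proof. by move=> [K K0 [_ l]]; exists K. Qed.

End Functional.

(** * Winding numbers and integrals of rational functions *)

Section Nice.
Local Set Implicit Arguments. Local Unset Strict Implicit.
Variable R : realType.
Local Notation C := (R[i]).
Local Notation nc := (@modc R).
Variable gamma : R -> C.
Hypothesis hgam : piecewise_C1 gamma /\ gamma 0 = gamma 1.
Let cx : {within `[0, 1], continuous (fun t => complex.Re (gamma t))}. Proof. by case: hgam => -[]. Qed.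
Let cy : {within `[0, 1], continuous (fun t => complex.Im (gamma t))}. Proof. by case: hgam => -[]. Qed.
Let approx := approx_contour (proj1 hgam).
Local Notation crv := (curve gamma).
Local Notation I := (oint gamma).
Local Notation bounded_lip := (bounded_lip gamma).
Implicit Types (K e M : R) (f g F G : C -> C) (z a : C).

Lemma curve0 : crv (gamma 0).
Proof. by exists 0 => //=; rewrite in_itv/= lexx ler01. Qed.

Let sq a t := (complex.Re (gamma t) - complex.Re a) ^+ 2 + (complex.Im (gamma t) - complex.Im a) ^+ 2.

Lemma modc_sq a t : nc (gamma t - a) = Num.sqrt (sq a t).
Proof. by rewrite /sq; case: (gamma t) a => x y [u v]. Qed.

Lemma sq_cont a : {within `[0, 1], continuous (sq a)}.
Proof.
move=> t; apply: cvgD; rewrite expr2; apply: cvgM; apply: cvgB;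
 by [exact: cx|exact: cy|exact: cvg_cst].
Qed.

Lemma curve_far a : exists2 z0, crv z0 & forall z, crv z -> nc (z - a) <= nc (z0 - a).
Proof.
have [c c01 h] := EVT_max ler01 (@sq_cont a).
exists (gamma c); first by exists c.
by move=> z [t t01 <-]; rewrite !modc_sq ler_wsqrtr// h.
Qed.

Lemma curve_near a : exists2 z0, crv z0 & forall z, crv z -> nc (z0 - a) <= nc (z - a).
Proof.
have [c c01 h] := EVT_min ler01 (@sq_cont a).
exists (gamma c); first by exists c.
by move=> z [t t01 <-]; rewrite !modc_sq ler_wsqrtr// h.
Qed.

Lemma curve_dist a : ~ crv a -> exists2 d, 0 < d & forall z, crv z -> d <= nc (z - a).
Proof.
move=> na; have [z0 cz0 h] := curve_near a; exists (nc (z0 - a)) => //.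
by rewrite modc_gt0 subr_eq0; apply/eqP => E; apply: na; rewrite -E.
Qed.

Lemma curve_bounded : exists2 B, 0 < B & forall z, crv z -> nc z <= B.
Proof.
have [z0 cz0 h] := curve_far 0; exists (nc z0 + 1); first by rewrite ltr_wpDl ?modc_ge0.
by move=> z /h; rewrite !subr0 => /le_trans; apply; rewrite lerDl.
Qed.

Lemma bounded_lip_cst a : bounded_lip (fun=> a).
Proof.
exists (nc a); first exact: modc_ge0.
by split=> // x y _ _; rewrite subrr modc0 mulr_ge0 ?modc_ge0.
Qed.

Lemma bounded_lip_id : bounded_lip id.
Proof.
have [B B0 hB] := curve_bounded; exists (B + 1); first by rewrite addr_ge0// ltW.
split=> [z /hB /le_trans|x y _ _]; first by apply; rewrite lerDl.
by rewrite ler_peMl ?modc_ge0// lerDr ltW.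
Qed.

Lemma bounded_lipD f g : bounded_lip f -> bounded_lip g -> bounded_lip (fun z => f z + g z).
Proof.
move=> [K K0 [bK lK]] [M M0 [bM lM]]; exists (K + M); first exact: addr_ge0.
split; last exact: lip1D.
by move=> z cz; apply: le_trans (modcD _ _) _; apply: lerD; [exact: bK|exact: bM].
Qed.

Lemma bounded_lipM f g : bounded_lip f -> bounded_lip g -> bounded_lip (fun z => f z * g z).
Proof.
move=> [K K0 [bK lK]] [M M0 [bM lM]]; exists (2 * (K * M)); first by rewrite !mulr_ge0.
have KM : 0 <= K * M by rewrite mulr_ge0.
split=> [z cz|x y cx' cy'].
  rewrite modcM; apply: (@le_trans _ _ (K * M)); last lra.
  by apply: ler_pM; rewrite ?modc_ge0 ?bK ?bM.
rewrite (_ : _ - _ = (f x - f y) * g x + f y * (g x - g y)); last by ring.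
apply: le_trans (modcD _ _) _; rewrite !modcM.
rewrite (_ : 2 * _ * _ = (K * nc (x - y)) * M + K * (M * nc (x - y))); last by ring.
by apply: lerD; apply: ler_pM; rewrite ?modc_ge0 ?bK ?bM ?lK ?lM.
Qed.

Lemma bounded_lip_ext f g : (forall z, crv z -> f z = g z) -> bounded_lip f -> bounded_lip g.
Proof.
move=> fg [K K0 [bK lK]]; exists K => //; split=> [z cz|x y cx' cy'].
  by rewrite -fg//; exact: bK.
by rewrite -!fg//; exact: lK.
Qed.

Lemma bounded_lipV f d : 0 < d -> (forall z, crv z -> d <= nc (f z)) -> bounded_lip f -> bounded_lip (fun z => (f z)^-1).
Proof.
move=> d0 hd [K K0 [bK lK]].
have f0 z : crv z -> f z != 0 by move=> /hd h; rewrite -modc_gt0 (lt_le_trans d0).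
have b1 z : crv z -> nc (f z)^-1 <= d^-1.
  by move=> cz; rewrite modcV lef_pV2 ?posrE ?hd// modc_gt0 f0.
have di : 0 <= d^-1 by rewrite invr_ge0 ltW.
exists (d^-1 + d^-1 * (K * d^-1)); first by rewrite addr_ge0// !mulr_ge0.
split=> [z cz|x y cx' cy'].
  by apply: le_trans (b1 z cz) _; rewrite lerDl !mulr_ge0.
rewrite (_ : _ - _ = (f x)^-1 * ((f y - f x) * (f y)^-1)); last first.
  by field; rewrite !f0.
rewrite !modcM mulrDl; apply: (@le_trans _ _ (d^-1 * (K * d^-1) * nc (x - y))); last first.
  by rewrite lerDr mulr_ge0 ?modc_ge0.
rewrite -!mulrA; apply: ler_pM; rewrite ?mulr_ge0 ?modc_ge0 ?b1//.
rewrite [d^-1 * _]mulrC mulrA; apply: ler_pM; rewrite ?modc_ge0 ?b1//.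
by rewrite modcBC; exact: lK.
Qed.

Lemma bounded_lip_invB a : ~ crv a -> bounded_lip (fun z => (z - a)^-1).
Proof.
move=> /curve_dist[d d0 hd]; apply: (bounded_lipV d0 hd).
exact: (bounded_lipD bounded_lip_id (bounded_lip_cst (- a))).
Qed.

Lemma bounded_lipX f n : bounded_lip f -> bounded_lip (fun z => f z ^+ n).
Proof.
move=> nf; elim: n => [|n IH]; first exact: bounded_lip_cst 1.
by apply: bounded_lip_ext (bounded_lipM nf IH) => z _; rewrite exprS.
Qed.

Lemma bounded_lip_prod (T : Type) (s : seq T) (P : pred T) (F : T -> C -> C) :
  (forall i, P i -> bounded_lip (F i)) -> bounded_lip (fun z => \prod_(i <- s | P i) F i z).
Proof.
move=> nF; elim: s => [|x s IH].
  by apply: bounded_lip_ext (bounded_lip_cst 1) => z _; rewrite big_nil.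
have [Px|Px] := boolP (P x).
  by apply: bounded_lip_ext (bounded_lipM (nF x Px) IH) => z _; rewrite big_cons Px.
by apply: bounded_lip_ext IH => z _; rewrite big_cons (negbTE Px).
Qed.

Lemma bounded_lip_poly (p : {poly C}) : bounded_lip (fun z => p.[z]).
Proof.
elim/poly_ind: p => [|p c IH].
  by apply: bounded_lip_ext (bounded_lip_cst 0) => z _; rewrite horner0.
by apply: bounded_lip_ext (bounded_lipD (bounded_lipM IH bounded_lip_id) (bounded_lip_cst c)) => z _; rewrite !hornerE.
Qed.

Lemma ointDn f g : bounded_lip f -> bounded_lip g -> I (fun z => f z + g z) = I f + I g.
Proof.
have [L L0 hA] := approx.
by move=> /bounded_lip_oint_lip[K1 ? ?] /bounded_lip_oint_lip[K2 ? ?]; apply: (ointD hA (K1 := K1) (K2 := K2)).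
Qed.

Lemma ointZn a g : bounded_lip g -> I (fun z => a * g z) = a * I g.
Proof.
have [L L0 hA] := approx.
by move=> /bounded_lip_oint_lip[K1 ? ?]; apply: (ointZ hA (K := K1)).
Qed.

Lemma oint0 : I (fun=> 0) = 0.
Proof.
rewrite -[RHS](mul0r (I (fun=> 0))) -ointZn; last exact: bounded_lip_cst.
by apply: eq_oint => z _; rewrite mulr0.
Qed.

Lemma oint_boundn : exists2 L, 0 <= L & forall M g, bounded_lip g ->
  (forall z, crv z -> nc (g z) <= M) -> nc (I g) <= L * M.
Proof.
have [L L0 hA] := approx; exists L => // M g /bounded_lip_oint_lip[K K0 lK] h.
exact: (oint_bound hA K0 lK h).
Qed.

(** A derivative along the curve, with a uniform quadratic Taylor bound between any two of its
    points: the form that [oint_FTC] takes, and one that is stable under products. *)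
Definition hasD F f := [/\ bounded_lip F, bounded_lip f & exists2 K, 0 <= K & forall x y, crv x -> crv y -> 
  nc (F y - F x - f x * (y - x)) <= K * nc (y - x) ^+ 2].

Lemma oint_hasD F f : hasD F f -> I f = 0.
Proof.
have [L L0 hA] := approx.
move=> [_ /bounded_lip_oint_lip[K' K'0 lf] [K K0 h]].
exact: (oint_FTC hA K0 K'0 hgam.2 lf h).
Qed.

Lemma hasD_id : hasD id (fun=> 1).
Proof.
split; [exact: bounded_lip_id|exact: bounded_lip_cst|exists 0 => // x y _ _].
by rewrite mul1r subrr modc0 mul0r.
Qed.

Lemma hasDM F f G g : hasD F f -> hasD G g -> hasD (fun z => F z * G z) (fun z => f z * G z + F z * g z).
Proof.
move=> [nF nf [K K0 hF]] [nG ng [M M0 hG]].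
split; [exact: bounded_lipM|by apply: bounded_lipD; apply: bounded_lipM|].
move: nF nf nG ng => [K1 K10 [bF lF]] [K2 K20 [bf lf]] [K3 K30 [bG lG]] [K4 K40 [bg lg]].
exists (K * K3 + K1 * M + K2 * K3); first by rewrite !addr_ge0// mulr_ge0.
move=> x y cx' cy'.
rewrite (_ : _ - _ - _ = (F y - F x - f x * (y - x)) * G y + F x * (G y - G x - g x * (y - x)) + 
   (f x * (y - x)) * (G y - G x)); last by ring.
apply: le_trans (modcD _ _) _; rewrite [leRHS]mulrDl; apply: lerD.
  apply: le_trans (modcD _ _) _; rewrite [leRHS]mulrDl !modcM; apply: lerD.
    by rewrite mulrAC; apply: ler_pM; rewrite ?modc_ge0 ?bG ?hF.
  by rewrite -mulrA; apply: ler_pM; rewrite ?modc_ge0 ?bF ?hG.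
rewrite !modcM expr2 mulrACA; apply: ler_pM; rewrite ?mulr_ge0 ?modc_ge0 ?lG//.
by rewrite ler_wpM2r ?modc_ge0 ?bf.
Qed.

Lemma hasD_invB a : ~ crv a -> hasD (fun z => (z - a)^-1) (fun z => - ((z - a)^-1 ^+ 2)).
Proof.
move=> na; have [d d0 hd] := curve_dist na.
have n1 := bounded_lip_invB na.
split => //.
  by apply: bounded_lip_ext (bounded_lipM (bounded_lip_cst (-1)) (bounded_lipX 2 n1)) => z _; rewrite mulN1r.
have f0 z : crv z -> z - a != 0 by move=> /hd h; rewrite -modc_gt0 (lt_le_trans d0).
have di : 0 <= d^-1 by rewrite invr_ge0 ltW.
have b1 z : crv z -> nc (z - a)^-1 <= d^-1.
  by move=> cz; rewrite modcV lef_pV2 ?posrE ?hd// modc_gt0 f0.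
(* The Taylor remainder of [(z - a)^-1] is exactly [(x - a)^-2 (y - a)^-1 (y - x)^2], and each
   inverse has modulus at most [d^-1]. *)
exists (d^-1 * (d^-1 * d^-1)); first by rewrite !mulr_ge0.
move=> x y cx' cy'.
rewrite (_ : _ - _ - _ = (x - a)^-1 * ((x - a)^-1 * (y - a)^-1) * (y - x) ^+ 2); last first.
  by field; rewrite !f0.
rewrite modcM modcX !modcM ler_wpM2r ?exprn_ge0 ?modc_ge0//.
by apply: ler_pM; rewrite ?mulr_ge0 ?modc_ge0 ?b1//; apply: ler_pM; rewrite ?modc_ge0 ?b1.
Qed.

Lemma hasDX F f n : hasD F f -> hasD (fun z => F z ^+ n.+1) (fun z => (n.+1)%:R * F z ^+ n * f z).
Proof.
move=> h; elim: n => [|n [n1 n2 [K K0 hK]]].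
  have [n1 n2 [K K0 hK]] := h.
  split; first by apply: bounded_lip_ext n1 => z _; rewrite expr1.
    by apply: bounded_lip_ext n2 => z _; rewrite expr0 !mul1r.
  by exists K => // x y cx' cy'; rewrite !expr1 expr0 !mul1r; exact: hK.
have /(hasDM h) [m1 m2 [M M0 hM]] : hasD (fun z => F z ^+ n.+1) (fun z => (n.+1)%:R * F z ^+ n * f z).
  by split => //; exists K.
have E z : f z * F z ^+ n.+1 + F z * (n.+1%:R * F z ^+ n * f z) = n.+2%:R * F z ^+ n.+1 * f z.
  by rewrite exprS -[n.+2%:R]natr1; ring.
split; first by apply: bounded_lip_ext m1 => z _; rewrite -exprS.
  by apply: bounded_lip_ext m2 => z _.
by exists M => // x y cx' cy'; rewrite !(exprS _ n.+1) -E; exact: hM.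
Qed.

Lemma oint_pow n : I (fun z => z ^+ n) = 0.
Proof.
have := oint_hasD (hasDX n hasD_id).
have -> : I (fun z => n.+1%:R * id z ^+ n * 1) = n.+1%:R * I (fun z => z ^+ n).
  rewrite -ointZn; last exact: bounded_lipX bounded_lip_id.
  by apply: eq_oint => z _; rewrite mulr1.
by move/eqP; rewrite mulf_eq0 pnatr_eq0 /= => /eqP.
Qed.

Lemma oint_invpow n a : ~ crv a -> I (fun z => (z - a)^-1 ^+ n.+2) = 0.
Proof.
move=> na.
have := oint_hasD (hasDX n (hasD_invB na)).
have -> : I (fun z => n.+1%:R * (z - a)^-1 ^+ n * - (z - a)^-1 ^+ 2) = - n.+1%:R * I (fun z => (z - a)^-1 ^+ n.+2).
  rewrite -ointZn; last exact/bounded_lipX/bounded_lip_invB.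
  by apply: eq_oint => z _; rewrite !exprS expr0 mulr1; ring.
by move/eqP; rewrite mulf_eq0 oppr_eq0 pnatr_eq0 /= => /eqP.
Qed.

End Nice.

(** * Local constancy of the winding number *)

Section Winding.
Local Set Implicit Arguments. Local Unset Strict Implicit.
Variable R : realType.
Local Notation C := (R[i]).
Local Notation nc := (@modc R).
Variable gamma : R -> C.
Hypothesis hgam : piecewise_C1 gamma /\ gamma 0 = gamma 1.
Local Notation crv := (curve gamma).
Local Notation I := (oint gamma).
Local Notation bounded_lip := (bounded_lip gamma).
Implicit Types (K e M r d B : R) (f g F G : C -> C) (z a : C).

Lemma modc_geom_eq0 (x : C) A r : 0 <= r -> r < 1 -> (forall m, nc x <= A * r ^+ m) -> x = 0.
Proof.
move=> r0 r1 h.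
(* Bernoulli's inequality, which yields an explicit exponent that makes the geometric bound smaller
   than a given multiple of [A]. *)
have bern m : r ^+ m * (1 + m%:R * (1 - r)) <= 1.
  elim: m => [|m IH]; first by rewrite expr0 !mul0r addr0 mulr1.
  apply: le_trans IH; rewrite exprSr -mulrA ler_wpM2l ?exprn_ge0//.
  rewrite -natr1 -subr_ge0 (_ : _ - _ = (m%:R + 1) * (1 - r) ^+ 2); last by ring.
  by rewrite mulr_ge0 ?sqr_ge0// addr_ge0.
have A0 : 0 <= A by have := h 0%N; rewrite expr0 mulr1; apply: le_trans; exact: modc_ge0.
apply: (@modc_small_eq0 _ _ A) => e e0.
pose m := Num.truncn (e^-1 / (1 - r)).
have mr : e^-1 / (1 - r) < m.+1%:R by apply: truncnS_gt.
have r1' : 0 < 1 - r by lra.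
apply: le_trans (h m.+1) _; rewrite mulrC ler_wpM2r//.
have me : e^-1 <= 1 + m.+1%:R * (1 - r).
  by move: mr; rewrite ltr_pdivrMr// => mr; lra.
have := bern m.+1.
rewrite -ler_pdivlMr ?mul1r; last by rewrite (lt_le_trans _ me)// invr_gt0.
by move/le_trans; apply; rewrite invf_ple// posrE// (lt_le_trans _ me)// invr_gt0.
Qed.

Definition wnd a : C := I (fun z => (z - a)^-1).

(* Truncating the geometric series of 1 / (z - a') around a leaves only 1 / (z - a)
   and the remainder, because higher inverse powers integrate to 0. *)
Lemma wnd_loc a d a' : 0 < d -> (forall z, crv z -> d <= nc (z - a)) -> nc (a' - a) <= d / 2 ->
  ~ crv a' /\ wnd a' = wnd a.
Proof.
move=> d0 hd haa'.
have na : ~ crv a by move=> /hd; rewrite subrr modc0 leNgt d0.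
have hd' z : crv z -> d / 2 <= nc (z - a').
  move=> /hd h; have := modc_tri z a' a; lra.
have d20 : 0 < d / 2 by rewrite divr_gt0.
have na' : ~ crv a' by move=> /hd'; rewrite subrr modc0 leNgt d20.
split=> //.
have f0 z : crv z -> z - a != 0 by move=> /hd h; rewrite -modc_gt0 (lt_le_trans d0).
have f0' z : crv z -> z - a' != 0 by move=> /hd' h; rewrite -modc_gt0 (lt_le_trans d20).
have n1 := bounded_lip_invB hgam na; have n2 := bounded_lip_invB hgam na'.
(* The remainder after m terms of the geometric series. On the curve the ratio has modulus at most
   1/2: [z] is at distance at least [d] from [a], and [a'] at most [d / 2]. *)
pose rem m z := ((a' - a) * (z - a)^-1) ^+ m * (z - a')^-1.
have nr m : bounded_lip (rem m) by apply: bounded_lipM => //; apply: bounded_lipX; apply: bounded_lipM => //; exact: bounded_lip_cst.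
have E m : wnd a' - wnd a = I (rem m.+1).
  elim: m => [|m IH].
    have -> : wnd a' = I (fun z => (z - a)^-1 + rem 1%N z).
      by apply: eq_oint => z cz; rewrite /rem expr1; field; rewrite f0// f0'.
    by rewrite (ointDn hgam) // addrC addKr.
  rewrite IH; have -> : I (rem m.+1) = I (fun z => (a' - a) ^+ m.+1 * (z - a)^-1 ^+ m.+2 + rem m.+2 z).
    apply: eq_oint => z cz; rewrite /rem [_ ^+ m.+2]exprS [in RHS](exprS _ m.+1) !exprMn.
    by field; rewrite f0// f0'.
  rewrite (ointDn hgam) //; last by apply: bounded_lipM; [exact: bounded_lip_cst|exact: bounded_lipX].
  by rewrite (ointZn hgam)// ?(oint_invpow hgam)// ?mulr0 ?add0r//; exact: bounded_lipX.
apply/eqP; rewrite -subr_eq0; apply/eqP.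
have [L L0 bnd] := oint_boundn hgam.
apply: (@modc_geom_eq0 _ (L * (2^-1 * (d / 2)^-1)) (2^-1)); rewrite ?invr_ge0 ?invf_lt1 ?ltr1n// => m.
rewrite (E m) -mulrA; apply: bnd => // z cz.
rewrite /rem modcM modcX modcM !modcV [leRHS](_ : _ = 2^-1 ^+ m.+1 * (d / 2)^-1); last by rewrite exprS; ring.
apply: ler_pM; rewrite ?exprn_ge0 ?mulr_ge0 ?invr_ge0 ?modc_ge0//; last first.
  by rewrite lef_pV2 ?posrE ?hd'// modc_gt0 f0'.
rewrite lerXn2r ?nnegrE ?mulr_ge0 ?invr_ge0 ?modc_ge0//.
rewrite ler_pdivrMr ?modc_gt0 ?f0//; have := hd z cz; lra.
Qed.

(** Expansion in powers of [z / a]: each power integrates to 0, and the remainders decay like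
    [(B / nc a) ^+ m]. *)
Lemma wnd_far a B : (forall z, crv z -> nc z <= B) -> B < nc a -> wnd a = 0.
Proof.
move=> hB Ba.
have B0 : 0 <= B by apply: le_trans (hB (gamma 0) (curve0 gamma)); exact: modc_ge0.
have a0 : a != 0 by rewrite -modc_gt0 (le_lt_trans B0).
have na : ~ crv a by move=> /hB; rewrite leNgt Ba.
have f0 z : crv z -> z - a != 0 by move=> cz; rewrite subr_eq0; apply/eqP => E; apply: na; rewrite -E.
have n1 := bounded_lip_invB hgam na.
pose rem m z := (a^-1 * z) ^+ m * (z - a)^-1.
have nr m : bounded_lip (rem m).
  by apply: bounded_lipM => //; apply: bounded_lipX; apply: bounded_lipM; [exact: bounded_lip_cst|exact: bounded_lip_id].
have E m : wnd a = I (rem m).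
  elim: m => [|m IH].
    by apply: eq_oint => z cz; rewrite /rem expr0 mul1r.
  rewrite IH; have -> : I (rem m) = I (fun z => - (a^-1 ^+ m.+1) * z ^+ m + rem m.+1 z).
    apply: eq_oint => z cz; rewrite /rem !exprMn [z ^+ m.+1]exprS [a^-1 ^+ m.+1]exprS.
    by field; rewrite a0 f0.
  rewrite (ointDn hgam) //; last by apply: bounded_lipM; [exact: bounded_lip_cst|apply: bounded_lipX; exact: bounded_lip_id].
  by rewrite (ointZn hgam)// ?(oint_pow hgam)// ?mulr0 ?add0r//; apply: bounded_lipX; exact: bounded_lip_id.
have [d d0 hd] := curve_dist hgam na.
have [L L0 bnd] := oint_boundn hgam.
apply: (@modc_geom_eq0 _ (L * d^-1) (B / nc a)).
- by rewrite divr_ge0 ?modc_ge0.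
- by rewrite ltr_pdivrMr ?mul1r// modc_gt0.
move=> m; rewrite (E m) -mulrA; apply: bnd => // z cz.
rewrite /rem modcM modcX modcM !modcV mulrC.
apply: ler_pM; rewrite ?exprn_ge0 ?mulr_ge0 ?invr_ge0 ?modc_ge0//.
  by rewrite lef_pV2 ?posrE ?hd// modc_gt0 f0.
rewrite lerXn2r ?nnegrE ?mulr_ge0 ?invr_ge0 ?modc_ge0//.
by rewrite mulrC ler_wpM2r ?invr_ge0 ?modc_ge0// hB.
Qed.

Lemma complex_ball (x y : C^o) r : (ball x (r%:C : C) y) = (nc (x - y) < r) :> Prop.
Proof. by rewrite /ball /= modc_normE ltcR. Qed.

Lemma open_modc (V : set C^o) : (forall x, V x -> exists2 r, 0 < r & forall y, nc (y - x) < r -> V y) -> open V.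
Proof.
move=> h; rewrite openE => x /h[r r0 hr].
apply/nbhs_ballP; exists (r%:C); first by rewrite /= ltcR.
by move=> y; rewrite complex_ball modcBC; exact: hr.
Qed.

(** By [wnd_loc] the points off the curve with a given winding number form an open set, and so do
    those with a different one; hence the former are open and closed in [S]. *)
Lemma wnd_connected (S : set C^o) x y : connected S -> (forall z, S z -> ~ crv z) ->
  S x -> S y -> wnd y = wnd x.
Proof.
move=> cS hS Sx Sy.
have loc (P : C -> Prop) : open ([set z | ~ crv z /\ P (wnd z)] : set C^o).
  apply: open_modc => z [cz Pz]; have [d d0 hd] := curve_dist hgam cz.
  exists (d / 2); first by rewrite divr_gt0.
  by move=> w /ltW zw; have [? E] := wnd_loc d0 hd zw; split=> //; rewrite E.
pose T := S `&` [set z | ~ crv z /\ wnd z = wnd x].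
suff TS : T = S by have [_ []] : T y by rewrite TS.
apply: cS.
- by exists x; split=> //; split=> //; exact: hS.
- by exists [set z | ~ crv z /\ wnd z = wnd x] => //; exact: (loc (fun w => w = wnd x)).
exists (~` [set z | ~ crv z /\ wnd z <> wnd x]).
  by apply: open_closedC; exact: (loc (fun w => w <> wnd x)).
apply/seteqP; split=> z [Sz hz]; split => //.
  by move=> [_]; case: hz.
split; first exact: hS.
by apply: contrapT => nz; apply: hz; split => //; exact: hS.
Qed.

(** An unbounded component reaches beyond the radius [B] of the curve, where [wnd_far] applies, and
    [wnd] is constant on it. *)
Lemma outside_wnd a : outside gamma a -> wnd a = 0.
Proof.
move=> [na nb]; have [B B0 hB] := curve_bounded hgam.
pose S : set C^o := connected_component (~` crv) (a : C^o).
have [x Sx Bx] : exists2 x, S x & B < nc x.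
  apply: contrapT => nx; apply: nb.
  exists (B%:C); split; first by apply: ger0_real; rewrite ler0c ltW.
  move=> M BM x Sx; apply: le_trans (ltW BM).
  rewrite /= modc_normE lecR leNgt; apply/negP => Bx; apply: nx; by exists x.
rewrite -(wnd_far hB Bx); apply: (@wnd_connected S) => //.
- exact: component_connected.
- by move=> z /connected_component_sub.
- exact: connected_component_refl.
Qed.

(* On the connected curve z / q the winding number is constant, and it vanishes at
   the point of maximal modulus. *)
Lemma wnd_div (q : C) : q != 0 -> nc q < 1 -> (forall z, crv z -> ~ crv (q * z)) ->
  (exists2 z, crv z & z != 0) ->
  forall z, crv z -> ~ crv (z / q) /\ wnd (z / q) = 0.
Proof.
move=> q0 q1 hq [z1 cz1 z10].
have h1 z : crv z -> ~ crv (z / q).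
  by move=> cz czq; apply: (hq _ czq); rewrite mulrC divfK.
move=> z cz; split; first exact: h1.
have [z0 cz0 hz0] := curve_far hgam 0.
have z00 : 0 < nc z0.
  have := hz0 _ cz1; rewrite !subr0; apply: lt_le_trans; by rewrite modc_gt0.
have far : wnd (z0 / q) = 0.
  apply: (@wnd_far _ (nc z0)) => [w cw|]; first by have := hz0 _ cw; rewrite !subr0.
  by rewrite modcM modcV ltr_pdivlMr ?modc_gt0// gtr_pMr.
rewrite -far.
pose f : R -> C^o := fun t => gamma t / q.
apply: (@wnd_connected (f @` `[0, 1])).
- apply: connected_continuous_connected; first exact: segment_connected.
  have [[hcx hcy _] _] := hgam.
  apply/subspace_continuousP => t t01; apply/cvgrPdist_le => e e0.
  (* Distances in [C^o] are compared with complex numbers; positivity of [e] forces it to be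
     real. *)
  have eE : e = (complex.Re e)%:C by move: e0; case: (e) => u v; rewrite ltcE/= => /andP[/eqP-> _].
  have e0' : 0 < complex.Re e by move: e0; rewrite ltcE => /andP[].
  have e1 : 0 < complex.Re e * nc q / 2 by rewrite divr_gt0// mulr_gt0// modc_gt0.
  move/subspace_continuousP: hcx => /(_ t t01)/cvgrPdist_le/(_ _ e1) hx.
  move/subspace_continuousP: hcy => /(_ t t01)/cvgrPdist_le/(_ _ e1) hy.
  near=> s.
  rewrite eE modc_normE lecR /f -mulrBl modcM modcV ler_pdivrMr ?modc_gt0//.
  apply: le_trans (modc_ReIm _) _; rewrite ReB ImB.
  have : `|complex.Re (gamma t) - complex.Re (gamma s)| <= complex.Re e * nc q / 2 by near: s.
  have : `|complex.Im (gamma t) - complex.Im (gamma s)| <= complex.Re e * nc q / 2 by near: s.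
  by lra.
- by move=> w [t t01 <-]; apply: h1; exists t.
- by case: cz0 => t t01 <-; exists t.
- by case: cz => t t01 <-; exists t.
Unshelve. all: by end_near. Qed.

End Winding.

(** * Residue calculus for rational functions by partial fractions *)

Section Rational.
Local Set Implicit Arguments. Local Unset Strict Implicit.
Variable R : realType.
Local Notation C := (R[i]).
Local Notation nc := (@modc R).
Variable gamma : R -> C.
Hypothesis hgam : piecewise_C1 gamma /\ gamma 0 = gamma 1.
Local Notation crv := (curve gamma).
Local Notation I := (oint gamma).
Local Notation bounded_lip := (bounded_lip gamma).
Local Notation wnd := (wnd gamma).
Implicit Types (f g : C -> C) (z a w : C) (s : seq C) (p : {poly C}).

Definition off_curve s := {in s, forall a, ~ crv a}.

Lemma bounded_lip_invs s : off_curve s -> bounded_lip (fun z => \prod_(a <- s) (z - a)^-1).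
Proof.
move=> hs; elim: s hs => [|a s IH] hs.
  by apply: bounded_lip_ext (bounded_lip_cst gamma 1) => z _; rewrite big_nil.
apply: (@bounded_lip_ext _ _ (fun z => (z - a)^-1 * \prod_(a <- s) (z - a)^-1)) => [z _|].
  by rewrite big_cons.
apply: bounded_lipM; first by apply: bounded_lip_invB => //; apply: hs; rewrite mem_head.
by apply: IH => b bs; apply: hs; rewrite inE bs orbT.
Qed.

Lemma bounded_lip_ratl p s : off_curve s -> bounded_lip (fun z => p.[z] * \prod_(a <- s) (z - a)^-1).
Proof. by move=> hs; apply: bounded_lipM; [exact: bounded_lip_poly|exact: bounded_lip_invs]. Qed.

(** Equal poles form a higher inverse power, which has a primitive. Two different poles are
    separated by partial fractions, which shortens the list; when both pieces are simple poles,
    their integrals are the same [w] and cancel. *)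
Lemma oint_invs s w : off_curve s -> {in s, forall a, wnd a = w} -> (1 < size s)%N ->
  I (fun z => \prod_(a <- s) (z - a)^-1) = 0.
Proof.
have [n] := ubnP (size s); elim: n s => // n IH [//|a [//|b s]] sn hs hw _.
have [sa|] := boolP (all (pred1 a) (b :: s)).
  have -> : a :: b :: s = nseq (size s).+2 a.
    by apply/all_pred1P; rewrite /= eqxx.
  rewrite -(@oint_invpow _ _ hgam (size s) a); last by apply: hs; rewrite mem_head.
  by apply: eq_oint => z _; rewrite big_nseq -Monoid.iteropE.
move=> /allPn[c cs /= ca].
have [u us] : exists u, perm_eq (a :: b :: s) (a :: c :: u).
  by exists (rem c (b :: s)); rewrite perm_cons perm_to_rem.
have hs' : off_curve [:: a, c & u] by move=> x; rewrite -(perm_mem us); exact: hs.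
have hw' : {in [:: a, c & u], forall x, wnd x = w} by move=> x; rewrite -(perm_mem us); exact: hw.
have sz := perm_size us.
rewrite -(@eq_oint _ _ (fun z => \prod_(a <- [:: a, c & u]) (z - a)^-1)); last first.
  by move=> z _; apply: perm_big; rewrite perm_sym.
have sub x : x \in [:: a; c] -> off_curve (x :: u).
  rewrite !inE => xac y; rewrite inE => /orP[/eqP->|yu]; apply: hs'; rewrite !inE ?xac// ?yu ?orbT//.
  by case/orP: xac => ->; rewrite ?orbT.
have ha : off_curve (a :: u) by apply: sub; rewrite !inE eqxx.
have hc : off_curve (c :: u) by apply: sub; rewrite !inE eqxx orbT.
have -> : I (fun z => \prod_(a <- [:: a, c & u]) (z - a)^-1) =
   I (fun z => (a - c)^-1 * \prod_(a <- a :: u) (z - a)^-1 + (- (a - c)^-1) * \prod_(a <- c :: u) (z - a)^-1).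
  apply: eq_oint => z cz; rewrite !big_cons; set P := \prod_(j <- u) _.
  have za : z - a != 0 by rewrite subr_eq0; apply/eqP => E; apply: (hs' a); rewrite ?mem_head -?E.
  have zc : z - c != 0 by rewrite subr_eq0; apply/eqP => E; apply: (hs' c); rewrite ?inE ?eqxx ?orbT -?E.
  have ac : a - c != 0 by rewrite subr_eq0 eq_sym.
  by field; rewrite za zc ac.
have na := bounded_lip_invs ha; have nn := bounded_lip_invs hc.
have nk x g : bounded_lip g -> bounded_lip (fun z => x * g z) by move=> ng; apply: bounded_lipM => //; exact: bounded_lip_cst.
rewrite (ointDn hgam (nk _ _ na) (nk _ _ nn)) !(ointZn hgam)//.
have [u0|u0] := posnP (size u).
  have -> : u = [::] by apply: size0nil.
  have E x : I (fun z => \prod_(a <- [:: x]) (z - a)^-1) = wnd x.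
    by apply: eq_oint => z _; rewrite big_seq1.
  by rewrite !E !hw' ?inE ?eqxx ?orbT// mulNr subrr.
have szu : ((size u).+1 < n)%N by move: sz sn => /= [<-].
rewrite !IH ?mulr0 ?addr0//=.
  by move=> x; rewrite inE => xu; apply: hw'; rewrite !inE; case/orP: xu => ->; rewrite ?orbT.
by move=> x; rewrite inE => xu; apply: hw'; rewrite !inE; case/orP: xu => ->; rewrite ?orbT.
Qed.

Lemma oint_poly p : I (fun z => p.[z]) = 0.
Proof.
have -> : I (fun z => p.[z]) = I (fun z => \sum_(i < size p) p`_i * z ^+ i).
  by apply: eq_oint => z _; rewrite horner_coef.
elim: (size p) => [|n IH].
  by rewrite -[RHS](oint0 hgam); apply: eq_oint => z _; rewrite big_ord0.
have -> : I (fun z => \sum_(i < n.+1) p`_i * z ^+ i) = I (fun z => (\poly_(i < n) p`_i).[z] + p`_n * z ^+ n).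
  by apply: eq_oint => z _; rewrite big_ord_recr /= horner_poly.
have nX : bounded_lip (fun z => z ^+ n) by apply: bounded_lipX; exact: bounded_lip_id.
rewrite (ointDn hgam) ?(ointZn hgam) ?(oint_pow hgam) ?mulr0 ?addr0//.
- rewrite -[RHS]IH; apply: eq_oint => z _; exact: horner_poly.
- exact: bounded_lip_poly.
- by apply: bounded_lipM => //; exact: bounded_lip_cst.
Qed.

Let rat_cons p q a s z : crv z -> off_curve (a :: s) -> p - p.[a]%:P = q * ('X - a%:P) ->
  p.[z] * \prod_(b <- a :: s) (z - b)^-1 =
  q.[z] * \prod_(b <- s) (z - b)^-1 + p.[a] * \prod_(b <- a :: s) (z - b)^-1.
Proof.
move=> cz hs pq; rewrite big_cons.
have za : z - a != 0 by rewrite subr_eq0; apply/eqP => E; apply: (hs a); rewrite ?mem_head -?E.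
have -> : p.[z] = q.[z] * (z - a) + p.[a].
  have := congr1 (fun r : {poly C} => r.[z]) pq; rewrite !hornerE => <-; by rewrite subrK.
by field.
Qed.

(** Dividing [p] by ['X - a] splits off a fraction with one pole fewer and one with a constant
    numerator; the latter falls under [oint_invs], or under the hypothesis on [wnd a] if [a] is the
    only pole. *)
Lemma oint_rat0 p s : off_curve s -> {in s, forall a, wnd a = 0} ->
  I (fun z => p.[z] * \prod_(a <- s) (z - a)^-1) = 0.
Proof.
elim: s p => [|a s IH] p hs hw.
  rewrite -[RHS](oint_poly p); apply: eq_oint => z _; by rewrite big_nil mulr1.
have /factor_theorem[q pq] : root (p - p.[a]%:P) a by rewrite /root !hornerE subrr.
have hs' : off_curve s by move=> b bs; apply: hs; rewrite inE bs orbT.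
rewrite (eq_oint (fun z cz => rat_cons cz hs pq)).
have n1 := bounded_lip_invs hs.
rewrite (ointDn hgam) ?(ointZn hgam)//; last 2 first.
- exact: bounded_lip_ratl.
- by apply: bounded_lipM => //; exact: bounded_lip_cst.
rewrite IH//; last by move=> b bs; apply: hw; rewrite inE bs orbT.
case: s IH hs hw hs' pq n1 => [|b s] IH hs hw hs' pq n1; last by rewrite (oint_invs hs hw)// mulr0 addr0.
have -> : I (fun z => \prod_(b <- [:: a]) (z - b)^-1) = wnd a.
  by apply: eq_oint => z _; rewrite big_seq1.
by rewrite hw ?mem_head// mulr0 addr0.
Qed.

(** All finite poles being encircled alike, only the residue at infinity counts. Since [size p] is
    the degree plus one, the integrand is of order z^-2 at most and has no such residue. *)
Lemma oint_rat_decay p s w : off_curve s -> {in s, forall a, wnd a = w} -> (size p < size s)%N ->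
  I (fun z => p.[z] * \prod_(a <- s) (z - a)^-1) = 0.
Proof.
elim: s p => [//|a s IH] p hs hw sp.
have [->|p0] := eqVneq p 0.
  by rewrite -[RHS](oint0 hgam); apply: eq_oint => z _; rewrite horner0 mul0r.
have /factor_theorem[q pq] : root (p - p.[a]%:P) a by rewrite /root !hornerE subrr.
have hs' : off_curve s by move=> b bs; apply: hs; rewrite inE bs orbT.
rewrite (eq_oint (fun z cz => rat_cons cz hs pq)).
have n1 := bounded_lip_invs hs.
have sp0 : (0 < size p)%N by rewrite size_poly_gt0.
have s1 : (0 < size s)%N by rewrite (leq_trans sp0).
rewrite (ointDn hgam) ?(ointZn hgam)//; last 2 first.
- exact: bounded_lip_ratl.
- by apply: bounded_lipM => //; exact: bounded_lip_cst.
rewrite IH// ?(oint_invs hs hw)// ?mulr0 ?addr0//.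
  by move=> b bs; apply: hw; rewrite inE bs orbT.
have [->|q0] := eqVneq q 0; first by rewrite size_poly0.
have : (size (q * ('X - a%:P) : {poly C})%R <= size p)%N.
  rewrite -pq (leq_trans (size_polyD _ _))// geq_max leqnn size_polyN size_polyC.
  by case: (p.[a] != 0).
rewrite size_Mmonic ?monicXsubC// size_XsubC addn2 /= => qp.
exact: leq_trans qp (ltnSE sp).
Qed.

Lemma oint_rat_res0 p s : off_curve s -> {in s, forall a, wnd a = 0} -> ~ crv 0 -> 0 \notin s ->
  I (fun z => z^-1 * (p.[z] * \prod_(a <- s) (z - a)^-1)) =
  wnd 0 * (p.[0] * \prod_(a <- s) (0 - a)^-1).
Proof.
move=> hs hw n0 s0; set h0 := p.[0] * _.
(* Subtracting the value [h0] at 0 leaves a fraction divisible by z, so the integrand is [h0 / z]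
   plus a fraction with poles in [s] only. *)
have /factor_theorem[q pq] : root (p - h0 *: \prod_(a <- s) ('X - a%:P)) 0.
  rewrite /root !hornerE horner_prod /h0 -mulrA.
  under [X in _ * (_ * X)]eq_bigr do rewrite !hornerE.
  rewrite -big_split /= big_seq big1 ?mulr1 ?subrr// => a sa.
  by rewrite sub0r mulVf// oppr_eq0; apply: contraNneq s0 => <-.
have E z : crv z -> z^-1 * (p.[z] * \prod_(a <- s) (z - a)^-1) =
    q.[z] * \prod_(a <- s) (z - a)^-1 + h0 * (z - 0)^-1.
  move=> cz; have z0 : z != 0 by apply/eqP => zE; apply: n0; rewrite -zE.
  have -> : p.[z] = q.[z] * z + h0 * \prod_(a <- s) (z - a).
    have := congr1 (fun r : {poly C} => r.[z]) pq; rewrite !hornerE horner_prod.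
    by under eq_bigr do rewrite !hornerE; rewrite subr0 => <-; rewrite subrK.
  rewrite subr0.
  rewrite mulrDl mulrDr; congr (_ + _); first by field.
  rewrite -[h0 * _ * _]mulrA -big_split /= big_seq big1 ?mulr1 ; first by rewrite mulrC.
  move=> a sa; rewrite mulfV// subr_eq0; apply/eqP => zE; apply: (hs a) => //; by rewrite -zE.
rewrite (eq_oint E) (ointDn hgam) ?(ointZn hgam) ?(oint_rat0 _ hs hw) ?add0r//.
- by rewrite mulrC.
- exact: bounded_lip_invB.
- exact: bounded_lip_ratl.
- by apply: bounded_lipM; [exact: bounded_lip_cst|exact: bounded_lip_invB].
Qed.

End Rational.

(** * Iterated contour integrals *)

Section Iterated.
Local Set Implicit Arguments. Local Unset Strict Implicit.
Variable R : realType.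
Local Notation C := (R[i]).
Local Notation nc := (@modc R).
Variable gamma : R -> C.
Hypothesis hgam : piecewise_C1 gamma /\ gamma 0 = gamma 1.
Hypothesis h0 : ~ curve gamma 0.
Local Notation crv := (curve gamma).
Local Notation I := (oint gamma).
Local Notation bounded_lip := (bounded_lip gamma).
Implicit Types (K e M : R) (z a x y : C) (zs xs : seq C) (f g : seq C -> C) (k : nat).

Definition oncurve zs := {in zs, forall z, crv z}.

Lemma oncurve_cons z zs : oncurve (z :: zs) <-> crv z /\ oncurve zs.
Proof.
split=> [h|[h1 h2] x]; last by rewrite inE => /orP[/eqP->//|]; exact: h2.
by split; [apply: h; rewrite mem_head|move=> x xs; apply: h; rewrite inE xs orbT].
Qed.

Lemma oncurve_cat xs zs : oncurve (xs ++ zs) <-> oncurve xs /\ oncurve zs.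
Proof.
split=> [h|[h1 h2] x]; last by rewrite mem_cat => /orP[]; [exact: h1|exact: h2].
by split=> x xs'; apply: h; rewrite mem_cat xs' ?orbT.
Qed.

Definition sdist zs zs' : R := \sum_(p <- zip zs zs') nc (p.1 - p.2).

Lemma sdist_ge0 zs zs' : 0 <= sdist zs zs'.
Proof. by apply: sumr_ge0 => p _; exact: modc_ge0. Qed.

Lemma sdist_nth zs zs' i : (i < size zs)%N -> size zs = size zs' ->
  nc (zs`_i - zs'`_i) <= sdist zs zs'.
Proof.
elim: zs zs' i => [//|z zs IH] [//|z' zs'] [|i] /= isz [ss].
  by rewrite /sdist /= big_cons /= lerDl sdist_ge0.
by rewrite /sdist /= big_cons /=; apply: le_trans (IH zs' i isz ss) _; rewrite lerDr modc_ge0.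
Qed.

(** The analogue of [bounded_lip] in several variables; tuples are lists, hence the conditions on
    sizes, and [sdist] is the l1 distance. *)
Definition lipn k f := exists2 K, 0 <= K &
  (forall zs, size zs = k -> oncurve zs -> nc (f zs) <= K) /\
  (forall zs zs', size zs = k -> size zs' = k -> oncurve zs -> oncurve zs' ->
     nc (f zs - f zs') <= K * sdist zs zs').

Lemma lipn_ext k f g : (forall zs, size zs = k -> oncurve zs -> f zs = g zs) -> lipn k f -> lipn k g.
Proof.
move=> fg [K K0 [b l]]; exists K => //; split=> [zs s o|zs zs' s s' o o'].
  by rewrite -fg//; exact: b.
by rewrite -!fg//; exact: l.
Qed.

Lemma lipn_cst k a : lipn k (fun=> a).
Proof.
exists (nc a); first exact: modc_ge0.
by split=> // *; rewrite subrr modc0 mulr_ge0 ?modc_ge0 ?sdist_ge0.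
Qed.

Lemma lipnD k f g : lipn k f -> lipn k g -> lipn k (fun zs => f zs + g zs).
Proof.
move=> [K K0 [bK lK]] [M M0 [bM lM]]; exists (K + M); first exact: addr_ge0.
split=> [zs s o|zs zs' s s' o o'].
  by apply: le_trans (modcD _ _) _; apply: lerD; [exact: bK|exact: bM].
rewrite opprD addrACA [leRHS]mulrDl.
by apply: le_trans (modcD _ _) _; apply: lerD; [exact: lK|exact: lM].
Qed.

Lemma lipnM k f g : lipn k f -> lipn k g -> lipn k (fun zs => f zs * g zs).
Proof.
move=> [K K0 [bK lK]] [M M0 [bM lM]]; exists (2 * (K * M)); first by rewrite !mulr_ge0.
have KM : 0 <= K * M by rewrite mulr_ge0.
split=> [zs s o|zs zs' s s' o o'].
  rewrite modcM; apply: (@le_trans _ _ (K * M)); last lra.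
  by apply: ler_pM; rewrite ?modc_ge0 ?bK ?bM.
rewrite (_ : _ - _ = (f zs - f zs') * g zs + f zs' * (g zs - g zs')); last by ring.
apply: le_trans (modcD _ _) _; rewrite !modcM.
rewrite (_ : 2 * _ * _ = (K * sdist zs zs') * M + K * (M * sdist zs zs')); last by ring.
by apply: lerD; apply: ler_pM; rewrite ?modc_ge0 ?bK ?bM ?lK ?lM.
Qed.

Lemma lipnZ k a f : lipn k f -> lipn k (fun zs => a * f zs).
Proof. by move=> gf; apply: lipnM => //; exact: lipn_cst. Qed.

Lemma lipnV k f d : 0 < d -> (forall zs, size zs = k -> oncurve zs -> d <= nc (f zs)) ->
  lipn k f -> lipn k (fun zs => (f zs)^-1).
Proof.
move=> d0 hd [K K0 [bK lK]].
have f0 zs : size zs = k -> oncurve zs -> f zs != 0.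
  by move=> s o; rewrite -modc_gt0 (lt_le_trans d0)// hd.
have b1 zs : size zs = k -> oncurve zs -> nc (f zs)^-1 <= d^-1.
  by move=> s o; rewrite modcV lef_pV2 ?posrE ?hd// modc_gt0 f0.
have di : 0 <= d^-1 by rewrite invr_ge0 ltW.
exists (d^-1 + d^-1 * (K * d^-1)); first by rewrite addr_ge0// !mulr_ge0.
split=> [zs s o|zs zs' s s' o o'].
  by apply: le_trans (b1 zs s o) _; rewrite lerDl !mulr_ge0.
rewrite (_ : _ - _ = (f zs)^-1 * ((f zs' - f zs) * (f zs')^-1)); last first.
  by field; rewrite !f0.
rewrite !modcM [leRHS]mulrDl; apply: (@le_trans _ _ (d^-1 * (K * d^-1) * sdist zs zs')); last first.
  by rewrite lerDr mulr_ge0 ?sdist_ge0.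
rewrite -!mulrA; apply: ler_pM; rewrite ?mulr_ge0 ?modc_ge0 ?b1//.
rewrite [d^-1 * _]mulrC mulrA; apply: ler_pM; rewrite ?modc_ge0 ?b1//.
by rewrite modcBC; exact: lK.
Qed.

Lemma lipn_nth k i (h : C -> C) : (i < k)%N -> bounded_lip h -> lipn k (fun zs => h zs`_i).
Proof.
move=> ik [K K0 [bK lK]]; exists K => //; split=> [zs s o|zs zs' s s' o o'].
  by apply: bK; apply: o; rewrite mem_nth// s.
apply: le_trans (lK _ _ _ _) _; [by apply: o; rewrite mem_nth// s|by apply: o'; rewrite mem_nth// s'|].
by rewrite ler_wpM2l// sdist_nth ?s ?s'.
Qed.

Lemma lipn_cons k f z : crv z -> lipn k.+1 f -> lipn k (fun zs => f (z :: zs)).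
Proof.
move=> cz [K K0 [b l]]; exists K => //; split=> [zs s o|zs zs' s s' o o'].
  by apply: b; rewrite /= ?s//; apply/oncurve_cons.
have := l (z :: zs) (z :: zs'); rewrite /sdist /= big_cons /= subrr modc0 add0r.
by apply; rewrite ?s ?s'//; apply/oncurve_cons.
Qed.

Lemma lipn_behead k f : lipn k f -> lipn k.+1 (fun zs => f (behead zs)).
Proof.
move=> [K K0 [b l]]; exists K => //; split=> [[|z zs]//= [s] /oncurve_cons[_ o]|]; first exact: b.
move=> [|z zs] [|z' zs']//= [s] [s'] /oncurve_cons[_ o] /oncurve_cons[_ o'].
apply: le_trans (l _ _ s s' o o') _; rewrite ler_wpM2l//.
by rewrite /sdist /= big_cons /= lerDr modc_ge0.
Qed.

Lemma lipn_prod (T : Type) (s : seq T) k (F : T -> seq C -> C) :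
  (forall i, lipn k (F i)) -> lipn k (fun zs => \prod_(i <- s) F i zs).
Proof.
move=> nF; elim: s => [|x s IH].
  by apply: lipn_ext (lipn_cst k 1) => z _ _; rewrite big_nil.
by apply: lipn_ext (lipnM (nF x) IH) => z _ _; rewrite big_cons.
Qed.

Lemma lipn1_bounded_lip (h : C -> C) : lipn 1 (fun zs => h zs`_0) -> bounded_lip h.
Proof.
move=> [K K0 [b l]]; exists K => //; split=> [z cz|x y cx cy].
  by apply: (b [:: z]) => // u; rewrite inE => /eqP->.
have := l [:: x] [:: y] erefl erefl; rewrite /sdist /= big_seq1 /=.
by apply=> u; rewrite inE => /eqP->.
Qed.

Definition dz_weight z : C := (twopii R * z)^-1.

Lemma twopii_neq0 : twopii R != 0.
Proof. by rewrite eq_complex /= eqxx /= mulf_neq0 ?pnatr_eq0// gt_eqF// pi_gt0. Qed.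

Lemma bounded_lip_dz_weight : bounded_lip dz_weight.
Proof.
apply: bounded_lip_ext (bounded_lipM (bounded_lip_cst gamma (twopii R)^-1) (bounded_lip_invB hgam h0)) => z _.
by rewrite /dz_weight subr0 invfM.
Qed.

Lemma iter_ext k f g : (forall zs, size zs = k -> oncurve zs -> f zs = g zs) ->
  iter_oint gamma k f = iter_oint gamma k g.
Proof.
elim: k f g => [|k IH] f g fg /=; first exact: fg.
apply: eq_oint => z cz; congr (_ * _); apply: IH => zs s o.
by apply: fg; rewrite /= ?s//; apply/oncurve_cons.
Qed.

(** Linearity and the bound go through one induction on k: linearity of [oint] is available for
    Lipschitz integrands, here inner integrals as functions of the outer variable, and this
    regularity follows from linearity and the bound for one variable less. *)
Let lin k := (forall f g, lipn k f -> lipn k g -> 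
     iter_oint gamma k (fun zs => f zs + g zs) = iter_oint gamma k f + iter_oint gamma k g) /\
   (forall a f, lipn k f -> iter_oint gamma k (fun zs => a * f zs) = a * iter_oint gamma k f).

Let bnd k := exists2 A, 0 <= A & forall f M, lipn k f ->
  (forall zs, size zs = k -> oncurve zs -> nc (f zs) <= M) -> nc (iter_oint gamma k f) <= A * M.

Let lipn_iter_aux j k f : lin k -> bnd k -> lipn (j + k) f ->
  lipn j (fun xs => iter_oint gamma k (fun zs => f (xs ++ zs))).
Proof.
move=> [lD lZ] [A A0 hA] [K K0 [b l]].
have gk xs : size xs = j -> oncurve xs -> lipn k (fun zs => f (xs ++ zs)).
  move=> sx ox; exists K => //; split=> [zs s o|zs zs' s s' o o'].
    by apply: b; [rewrite size_cat sx s|apply/oncurve_cat].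
  apply: le_trans (l _ _ _ _ _ _) _; [by rewrite size_cat sx s|by rewrite size_cat sx s'|
    by apply/oncurve_cat|by apply/oncurve_cat|].
  rewrite ler_wpM2l// /sdist zip_cat// big_cat /= [X in X + _](_ : _ = 0) ?add0r//.
  by elim: (xs) => [|x u IHu]; rewrite /= ?big_nil// big_cons /= subrr modc0 add0r.
exists (A * K); first exact: mulr_ge0.
split=> [xs s o|xs xs' s s' o o'].
  apply: hA; first exact: gk.
  by move=> zs sz oz; apply: b; [rewrite size_cat s sz|apply/oncurve_cat].
rewrite -[X in nc (_ - X)]mul1r -mulNr -lZ; last exact: gk.
rewrite -lD; [|exact: gk|by apply: lipnZ; exact: gk].
rewrite -mulrA; apply: hA; first by apply: lipnD; [exact: gk|apply: lipnZ; exact: gk].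
move=> zs sz oz; rewrite mulN1r; apply: le_trans (l _ _ _ _ _ _) _.
- by rewrite size_cat s sz.
- by rewrite size_cat s' sz.
- by apply/oncurve_cat.
- by apply/oncurve_cat.
rewrite ler_wpM2l// /sdist zip_cat ?s ?s'// big_cat /= [X in _ + X](_ : _ = 0) ?addr0//.
by elim: (zs) => [|x u IHu]; rewrite /= ?big_nil// big_cons /= subrr modc0 add0r.
Qed.

Let bounded_lip_iter_aux k f : lin k -> bnd k -> lipn k.+1 f ->
  bounded_lip (fun z => dz_weight z * iter_oint gamma k (fun zs => f (z :: zs))).
Proof.
move=> lk bk gf; apply: bounded_lipM; first exact: bounded_lip_dz_weight.
apply: lipn1_bounded_lip; have := @lipn_iter_aux 1 k f lk bk gf.
apply: lipn_ext => -[|x [|]]//.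
Qed.

Let lin_bnd k : lin k /\ bnd k.
Proof.
elim: k => [|k [lk bk]].
  split; first by split.
  by exists 1 => // f M gf h; rewrite mul1r; exact: h.
have ni f : lipn k.+1 f -> bounded_lip (fun z => dz_weight z * iter_oint gamma k (fun zs => f (z :: zs))).
  exact: bounded_lip_iter_aux.
split; first split.
- move=> f g gf gg /=; rewrite -(ointDn hgam (ni f gf) (ni g gg)).
  by apply: eq_oint => z cz; rewrite -/(dz_weight z) lk.1 ?mulrDr//; exact: lipn_cons.
- move=> a f gf /=; rewrite -(ointZn hgam a (ni f gf)).
  by apply: eq_oint => z cz; rewrite -/(dz_weight z) lk.2 1?mulrCA//; exact: lipn_cons.
have [A A0 hA] := bk; have [L L0 hL] := oint_boundn hgam.
have [K K0 [bK _]] := bounded_lip_dz_weight.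
exists (L * (K * A)) => [|f M gf hM /=]; first by rewrite !mulr_ge0.
rewrite -mulrA; apply: (hL _ _ (ni f gf)).
move=> z cz; rewrite modcM -mulrA; apply: ler_pM; rewrite ?modc_ge0 ?bK//.
apply: hA; first exact: lipn_cons.
by move=> zs s o; apply: hM; rewrite /= ?s//; apply/oncurve_cons.
Qed.

Lemma iter_ointD k f g : lipn k f -> lipn k g ->
  iter_oint gamma k (fun zs => f zs + g zs) = iter_oint gamma k f + iter_oint gamma k g.
Proof. exact: (lin_bnd k).1.1. Qed.

Lemma iter_ointZ k a f : lipn k f -> iter_oint gamma k (fun zs => a * f zs) = a * iter_oint gamma k f.
Proof. exact: (lin_bnd k).1.2. Qed.

Lemma lipn_iter j k f : lipn (j + k) f ->
  lipn j (fun xs => iter_oint gamma k (fun zs => f (xs ++ zs))).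
Proof. by have [] := lin_bnd k; exact: lipn_iter_aux. Qed.

Lemma bounded_lip_iter k f : lipn k.+1 f ->
  bounded_lip (fun z => dz_weight z * iter_oint gamma k (fun zs => f (z :: zs))).
Proof. by have [] := lin_bnd k; exact: bounded_lip_iter_aux. Qed.

Definition swap01 (T : Type) (s : seq T) := if s is x :: y :: r then y :: x :: r else s.

Lemma size_swap01 (T : Type) (s : seq T) : size (swap01 s) = size s.
Proof. by case: s => [|x [|y r]]. Qed.

Lemma perm_swap01 (T : eqType) (s : seq T) : perm_eq (swap01 s) s.
Proof. by case: s => [|x [|y r]]//=; rewrite -[y :: _]/([:: y] ++ [:: x] ++ r) perm_catCA. Qed.

Lemma oncurve_swap01 zs : oncurve zs -> oncurve (swap01 zs).
Proof. by move=> o z; rewrite (perm_mem (perm_swap01 zs)); exact: o. Qed.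

Lemma lipn_swap01 k f : lipn k f -> lipn k (fun zs => f (swap01 zs)).
Proof.
move=> [K K0 [b l]]; exists K => //; split=> [zs s o|zs zs' s s' o o'].
  by apply: b; rewrite ?size_swap01//; exact: oncurve_swap01.
have -> : sdist zs zs' = sdist (swap01 zs) (swap01 zs').
  rewrite /sdist; case: zs zs' s s' {o o'} => [|x [|y r]] [|x' [|y' r']]//=; last by move=> _ _; rewrite !big_cons /= addrCA.
    by move=> <-.
  by move=> <-.
by apply: l; rewrite ?size_swap01//; exact: oncurve_swap01.
Qed.

(* This is where Fubini enters; the remaining k integrals are Lipschitz in x and y. *)
Lemma iter_swap0 k f : lipn k.+2 f ->
  iter_oint gamma k.+2 f = iter_oint gamma k.+2 (fun zs => f (swap01 zs)).
Proof.
move=> gf /=; rewrite -!/(dz_weight _).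
pose G x y := iter_oint gamma k (fun zs => f [:: x, y & zs]).
have gG : lipn 2 (fun xs => dz_weight xs`_0 * dz_weight xs`_1 * G xs`_0 xs`_1).
  apply: lipnM; first by apply: lipnM; apply: lipn_nth => //; exact: bounded_lip_dz_weight.
  by have := @lipn_iter 2 k f gf; apply: lipn_ext => -[|x [|y [|]]].
have nG x : crv x -> bounded_lip (fun y => dz_weight y * G x y).
  by move=> cx; have := bounded_lip_iter (lipn_cons cx gf).
have nG' y : crv y -> bounded_lip (fun x => dz_weight x * G x y).
  by move=> cy; have := bounded_lip_iter (lipn_cons cy (lipn_swap01 gf)).
transitivity (I (fun x => I (fun y => dz_weight x * dz_weight y * G x y))).
  apply: eq_oint => x cx; rewrite -(ointZn hgam); last exact: nG.
  by apply: eq_oint => y cy; rewrite mulrA.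
transitivity (I (fun y => I (fun x => dz_weight x * dz_weight y * G x y))).
  have [L L0 hA] := approx_contour hgam.1.
  have [K K0 [_ l]] := gG.
  apply: (oint_Fubini L0 hA K0) => x x' y y' cx cx' cy cy'.
  have := l [:: x; y] [:: x'; y'] erefl erefl; rewrite /sdist /= !big_cons big_nil /= addr0; apply.
    by move=> u; rewrite !inE => /orP[]/eqP->.
  by move=> u; rewrite !inE => /orP[]/eqP->.
apply: eq_oint => y cy; rewrite -(ointZn hgam); last exact: nG'.
by apply: eq_oint => x cx; rewrite mulrCA mulrA.
Qed.

Lemma iter_swap k i f : lipn k f -> (i.+1 < k)%N ->
  iter_oint gamma k f = iter_oint gamma k (fun zs => f (take i zs ++ swap01 (drop i zs))).
Proof.
elim: i k f => [|i IH] [//|[//|k]] f gf ik.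
  by rewrite iter_swap0//; apply: iter_ext => zs _ _; rewrite take0 drop0.
rewrite [LHS]/= [RHS]/=; apply: eq_oint => z cz; congr (_ * _).
exact: (IH k.+1 (fun zs => f (z :: zs)) (lipn_cons cz gf) ik).
Qed.

Lemma iter_innermost k f :
  iter_oint gamma k.+1 f =
  iter_oint gamma k (fun zs => I (fun z => dz_weight z * f (rcons zs z))).
Proof.
elim: k f => [//|k IH] f; apply: eq_oint => z cz; congr (_ * _).
exact: (IH (fun zs => f (z :: zs))).
Qed.

(** The first variable travels inwards by one adjacent swap at each level. *)
Lemma iter_head_innermost k f : lipn k.+1 f ->
  iter_oint gamma k.+1 f =
  iter_oint gamma k (fun zs => I (fun z => dz_weight z * f (z :: zs))).
Proof.
elim: k f => [//|k IH] f gf; rewrite iter_swap0//; apply: eq_oint => y cy; congr (_ * _).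
exact: (IH (fun zs => f (swap01 (y :: zs))) (lipn_cons cy (lipn_swap01 gf))).
Qed.

End Iterated.

(** * The kernel pairing and its three rules: exchange, residue at 0, decay *)

Section Pairing.
Local Set Implicit Arguments. Local Unset Strict Implicit.
Variable R : realType.
Local Notation C := (R[i]).
Local Notation nc := (@modc R).
Variable gamma : R -> C.
Hypothesis hgam : piecewise_C1 gamma /\ gamma 0 = gamma 1.
Hypothesis h0 : ~ curve gamma 0.
Variable q : C.
Hypothesis q0 : q != 0.
Hypothesis hq : forall z, curve gamma z -> ~ curve gamma (q * z).
Local Notation crv := (curve gamma).
Local Notation I := (oint gamma).
Local Notation bounded_lip := (bounded_lip gamma).
Local Notation dz_weight := (@dz_weight R).
Implicit Types (z a x y : C) (zs xs : seq C) (f g h : C -> C) (fs gs : seq (C -> C)) (k : nat).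

Definition cross x y : C := (x - y) / (x - q * y).

Fixpoint cross_prod zs : C := if zs is z :: zs' then \prod_(y <- zs') cross z y * cross_prod zs' else 1.

Definition fun_prod fs zs : C := \prod_(p <- zip fs zs) p.1 p.2.

Definition Jint fs : C := iter_oint gamma (size fs) (fun zs => cross_prod zs * fun_prod fs zs).

(** [d x] is the distance from x to the image of the curve under multiplication by q. It is
    1-Lipschitz, hence attains its minimum along the curve, and the minimum is positive because that
    image misses the curve. This uniform gap makes the kernel Lipschitz. *)
Lemma sep : exists2 d, 0 < d & forall x y, crv x -> crv y -> d <= nc (x - q * y).
Proof.
pose P (x : C) (t : R) := t \in `[0, 1] /\ forall y, crv y -> nc (gamma t - x / q) <= nc (y - x / q).
have hP x : exists t, P x t.
  have [z0 [t t01 <-] hz] := curve_near hgam (x / q).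
  by exists t; split.
have [T hT] := choice hP.
pose d x : R := nc (x - q * gamma (T x)).
have dmin x y : crv y -> d x <= nc (x - q * y).
  move=> cy; have [_ /(_ y cy)] := hT x.
  have E w : nc (w - x / q) = nc (x - q * w) / nc q.
    by rewrite -modcV -modcM modcBC; congr modc; field.
  by rewrite !E ler_pM2r // invr_gt0 modc_gt0.
have cT x : crv (gamma (T x)) by exists (T x) => //; exact: (hT x).1.
have dlip x y : `|d x - d y| <= nc (x - y).
  have := dmin x _ (cT y); have := modc_tri x y (q * gamma (T y)).
  have := dmin y _ (cT x); have := modc_tri y x (q * gamma (T x)).
  rewrite (modcBC y x) -/(d x) -/(d y) ler_norml => ? ? ? ?.
  by apply/andP; split; lra.
have [[hcx hcy _] _] := hgam.
have cd : {within `[0, 1], continuous (fun t => d (gamma t))}.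
  apply/subspace_continuousP => t t01; apply/cvgrPdist_le => e e0.
  have e1 : 0 < e / 2 by rewrite divr_gt0.
  move/subspace_continuousP: hcx => /(_ t t01)/cvgrPdist_le/(_ _ e1) hx.
  move/subspace_continuousP: hcy => /(_ t t01)/cvgrPdist_le/(_ _ e1) hy.
  near=> s.
  apply: le_trans (dlip _ _) _; apply: le_trans (modc_ReIm _) _; rewrite ReB ImB.
  have : `|complex.Re (gamma t) - complex.Re (gamma s)| <= e / 2 by near: s.
  have : `|complex.Im (gamma t) - complex.Im (gamma s)| <= e / 2 by near: s.
  by lra.
have [c c01 hc] := EVT_min ler01 cd.
exists (d (gamma c)).
  rewrite modc_gt0 subr_eq0; apply/eqP => E.
  by apply: (hq (cT (gamma c))); rewrite -E; exists c.
by move=> x y [t t01 <-] cy; apply: le_trans (hc t t01) (dmin _ _ cy).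
Unshelve. all: by end_near. Qed.

Lemma cross_neq0 x y : crv x -> crv y -> x - q * y != 0.
Proof.
by move=> cx cy; rewrite subr_eq0; apply/eqP => E; apply: (hq cy); rewrite -E.
Qed.

Lemma lipn_cross k i j : (i < k)%N -> (j < k)%N -> i != j -> lipn gamma k (fun zs => cross zs`_i zs`_j).
Proof.
move=> ik jk ij; have [d d0 hd] := sep.
have gi l : (l < k)%N -> lipn gamma k (fun zs => zs`_l).
  by move=> lk; apply: (lipn_nth (h := id)) => //; exact: bounded_lip_id.
apply: lipnM.
  apply: lipn_ext (lipnD (gi i ik) (lipnZ (-1) (gi j jk))) => zs _ _; by rewrite mulN1r.
apply: (lipnV d0).
  move=> zs s o; apply: hd; apply: o; by rewrite mem_nth ?s.
apply: lipn_ext (lipnD (gi i ik) (lipnZ (- q) (gi j jk))) => zs _ _; by rewrite mulNr.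
Qed.

Lemma lipn_cross_prod k : lipn gamma k cross_prod.
Proof.
elim: k => [|k IH].
  by apply: lipn_ext (lipn_cst gamma 0 1) => -[].
have h := lipnM (lipn_prod (index_enum 'I_k) (fun i : 'I_k => lipn_cross (ltn0Sn k) (ltn_ord (lift ord0 i)) isT)) (lipn_behead IH).
apply: lipn_ext h => -[//|z zs] [sz] _ /=; congr (_ * _).
by rewrite (big_nth 0) big_mkord sz.
Qed.

Definition bounded_lips fs := forall i, (i < size fs)%N -> bounded_lip (nth (fun=> 0) fs i).

Lemma bounded_lips_cons f fs : bounded_lips (f :: fs) <-> bounded_lip f /\ bounded_lips fs.
Proof.
split=> [h|[h1 h2] [|i]//]; last exact: h2.
by split; [exact: (h 0%N)|move=> i isz; exact: (h i.+1)].
Qed.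

Lemma bounded_lips_cat fs gs : bounded_lips (fs ++ gs) <-> bounded_lips fs /\ bounded_lips gs.
Proof.
elim: fs => [|f fs IH] /=; first by split=> [?|[]].
by rewrite !bounded_lips_cons IH; split=> [[? [? ?]]|[[? ?] ?]].
Qed.

Lemma lipn_fun_prod fs : bounded_lips fs -> lipn gamma (size fs) (fun_prod fs).
Proof.
elim: fs => [|f fs IH].
  by move=> _; apply: lipn_ext (lipn_cst gamma 0 1) => -[|//] _ _; rewrite /fun_prod big_nil.
move=> /bounded_lips_cons[nf /IH gf].
apply: lipn_ext (lipnM (lipn_nth (ltn0Sn (size fs)) nf) (lipn_behead gf)).
by move=> [//|z zs] _ _; rewrite /fun_prod /= big_cons.
Qed.

Lemma lipn_Jint fs : bounded_lips fs -> lipn gamma (size fs) (fun zs => cross_prod zs * fun_prod fs zs).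
Proof. by move=> nf; apply: lipnM; [exact: lipn_cross_prod|exact: lipn_fun_prod]. Qed.

Lemma fun_prod_cat fs gs zs : fun_prod (fs ++ gs) zs = fun_prod fs (take (size fs) zs) * fun_prod gs (drop (size fs) zs).
Proof.
elim: fs zs => [|f fs IH] zs /=.
  by rewrite take0 drop0 {2}/fun_prod big_nil mul1r.
case: zs => [|z zs]; first by case: (gs) => [|? ?]; rewrite /fun_prod /= !big_nil mulr1.
by rewrite /fun_prod /= !big_cons -!/(fun_prod _ _) IH mulrA.
Qed.

Lemma fun_prod_cons f fs z zs : fun_prod (f :: fs) (z :: zs) = f z * fun_prod fs zs.
Proof. by rewrite /fun_prod /= big_cons. Qed.

Lemma fun_prod_mid fs f gs zs : (size fs < size zs)%N ->
  fun_prod (fs ++ f :: gs) zs = f zs`_(size fs) * (fun_prod fs (take (size fs) zs) * fun_prod gs (drop (size fs).+1 zs)).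
Proof.
move=> s; rewrite fun_prod_cat (drop_nth 0 s) fun_prod_cons; ring.
Qed.

Lemma Jint_ext fs f g gs : (forall z, crv z -> f z = g z) -> Jint (fs ++ f :: gs) = Jint (fs ++ g :: gs).
Proof.
move=> fg; rewrite /Jint !size_cat /=; apply: iter_ext => zs s o; congr (_ * _).
have sz : (size fs < size zs)%N by rewrite s addnS ltnS leq_addr.
by rewrite !fun_prod_mid// fg//; apply: o; rewrite mem_nth.
Qed.

Lemma Jint_lin fs f g h a b gs : bounded_lips fs -> bounded_lips gs -> bounded_lip f -> bounded_lip g ->
  (forall z, crv z -> h z = a * f z + b * g z) ->
  Jint (fs ++ h :: gs) = a * Jint (fs ++ f :: gs) + b * Jint (fs ++ g :: gs).
Proof.
move=> nfs ngs nf ng hE.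
have nF : bounded_lips (fs ++ f :: gs) by apply/bounded_lips_cat; split=> //; apply/bounded_lips_cons.
have nG : bounded_lips (fs ++ g :: gs) by apply/bounded_lips_cat; split=> //; apply/bounded_lips_cons.
rewrite /Jint !size_cat /=; have := lipn_Jint nF; have := lipn_Jint nG; rewrite !size_cat /= => gG gF.
rewrite -!(iter_ointZ hgam h0)// -(iter_ointD hgam h0); [|exact: lipnZ..].
apply: iter_ext => zs s o.
have sz : (size fs < size zs)%N by rewrite s addnS ltnS leq_addr.
rewrite !fun_prod_mid// hE; first by ring.
by apply: o; rewrite mem_nth.
Qed.

Lemma cross_prod_swap xs x y zs : x - q * y != 0 -> y - q * x != 0 ->
  cross_prod (xs ++ x :: y :: zs) * (x - q * y) = - (cross_prod (xs ++ y :: x :: zs) * (y - q * x)).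
Proof.
move=> xy yx; elim: xs => [|z xs IH] /=.
  rewrite !big_cons /cross.
  set P := \prod_(j <- zs) _; set Q := \prod_(j <- zs) _.
  field; by rewrite xy yx.
rewrite -!mulrA IH mulrN; congr (- (_ * _)).
by apply: perm_big; rewrite perm_cat2l (perm_catCA [:: x] [:: y] zs).
Qed.

(** In the difference of the two sides the neighbours x, y enter through [g x * g y] times the
    kernel times [x - q * y], which changes sign when they are swapped; by Fubini the integral is
    its own opposite. *)
Lemma Jint_exchange fs g gs : bounded_lips fs -> bounded_lips gs -> bounded_lip g ->
  Jint (fs ++ [:: (fun z => g z * z), g & gs]) = q * Jint (fs ++ [:: g, (fun z => g z * z) & gs]).
Proof.
move=> nfs ngs ng.
have ngz : bounded_lip (fun z => g z * z) by apply: bounded_lipM => //; exact: bounded_lip_id.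
have nF : bounded_lips (fs ++ [:: (fun z => g z * z), g & gs]) by apply/bounded_lips_cat; split=> //; do 2!(apply/bounded_lips_cons; split=> //).
have nG : bounded_lips (fs ++ [:: g, (fun z => g z * z) & gs]) by apply/bounded_lips_cat; split=> //; do 2!(apply/bounded_lips_cons; split=> //).
have := lipn_Jint nF; have := lipn_Jint nG; rewrite /Jint !size_cat /= => gG gF.
set k := (size fs + (size gs).+2)%N in gG gF *.
apply/eqP; rewrite -subr_eq0; apply/eqP.
rewrite -(iter_ointZ hgam h0)// -[X in _ - X]mul1r -mulNr -(iter_ointZ hgam h0); last exact: lipnZ.
rewrite -(iter_ointD hgam h0)//; last by do 2!apply: lipnZ.
set D := fun zs => _.
have gD : lipn gamma k D by apply: lipnD => //; do 2!apply: lipnZ.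
have split_mid zs : size zs = k -> exists p x y r, [/\ zs = p ++ [:: x, y & r], size p = size fs & size r = size gs].
  move=> s; exists (take (size fs) zs), zs`_(size fs), zs`_(size fs).+1, (drop (size fs).+2 zs).
  have s1 : (size fs < size zs)%N by rewrite s /k addnS ltnS leq_addr.
  have s2 : ((size fs).+1 < size zs)%N by rewrite s /k !addnS !ltnS leq_addr.
  split; first by rewrite -(drop_nth 0 s2) -(drop_nth 0 s1) cat_take_drop.
    by rewrite size_take s1.
  by rewrite size_drop s /k !addnS subSS subSS addKn.
have DE p x y r : size p = size fs -> size r = size gs ->
   D (p ++ [:: x, y & r]) = cross_prod (p ++ [:: x, y & r]) * (x - q * y) * (g x * g y * (fun_prod fs p * fun_prod gs r)).
  move=> sp sr; rewrite /D !fun_prod_cat -sp take_size_cat// drop_size_cat// !fun_prod_cons; ring.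
have anti : iter_oint gamma k D = iter_oint gamma k (fun zs => (-1) * D zs).
  rewrite (iter_swap hgam h0 (i := size fs) gD); last by rewrite /k !addnS !ltnS leq_addr.
  apply: iter_ext => zs s o; have [p [x [y [r [E sp sr]]]]] := split_mid zs s.
  rewrite E -sp take_size_cat// drop_size_cat// [swap01 _]/= !DE//.
  have cx : crv x by apply: o; rewrite E mem_cat mem_head orbT.
  have cy : crv y by apply: o; rewrite E mem_cat !inE eqxx !orbT.
  rewrite cross_prod_swap ?cross_neq0//; ring.
rewrite (iter_ointZ hgam h0)// mulN1r in anti.
have /eqP : iter_oint gamma k D *+ 2 = 0 by rewrite mulr2n {1}anti addNr.
by rewrite mulrn_eq0 /= => /eqP.
Qed.

Lemma cross_prod_rcons zs z : cross_prod (rcons zs z) = cross_prod zs * \prod_(x <- zs) cross x z.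
Proof.
elim: zs => [|x zs IH] /=; first by rewrite !big_nil mulr1.
by rewrite IH big_cons -cats1 big_cat big_seq1 /=; ring.
Qed.

Lemma fun_prod_rcons fs f zs z : size zs = size fs -> fun_prod (rcons fs f) (rcons zs z) = fun_prod fs zs * f z.
Proof.
by move=> s; rewrite -!cats1 fun_prod_cat -s take_size_cat// drop_size_cat// fun_prod_cons /fun_prod /= big_nil mulr1.
Qed.

(** The last variable occurs in the kernel only in factors [cross x z], whose pole [x / q] has
    winding number 0 and whose value at z = 0 is 1. The weight dz / z supplies the one residue that
    counts. *)
Lemma Jint_rcons fs h (p : {poly C}) (s : seq C) :
  bounded_lips fs -> (forall z, crv z -> ~ crv (z / q) /\ wnd gamma (z / q) = 0) -> wnd gamma 0 = twopii R ->
  off_curve gamma s -> {in s, forall a, wnd gamma a = 0} -> 0 \notin s ->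
  (forall z, crv z -> h z = p.[z] * \prod_(a <- s) (z - a)^-1) ->
  Jint (rcons fs h) = p.[0] * \prod_(a <- s) (0 - a)^-1 * Jint fs.
Proof.
move=> nfs hdiv w0 os ws s0 hE.
set v := p.[0] * _.
have val zs : oncurve gamma zs -> bounded_lip (fun z => dz_weight z * (\prod_(x <- zs) cross x z * h z)) /\
    I (fun z => dz_weight z * (\prod_(x <- zs) cross x z * h z)) = v.
  (* [cross x z] is rewritten as [q^-1 * (z - x) / (z - x / q)] to expose its pole in z. *)
  move=> o; pose p' := p * \prod_(x <- zs) (q^-1 *: ('X - x%:P)).
  pose s' := s ++ [seq x / q | x <- zs].
  have os' : off_curve gamma s'.
    by move=> a; rewrite mem_cat => /orP[/os//|/mapP[x xs ->]]; have [] := hdiv x (o x xs).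
  have ws' : {in s', forall a, wnd gamma a = 0}.
    by move=> a; rewrite mem_cat => /orP[/ws//|/mapP[x xs ->]]; have [] := hdiv x (o x xs).
  have x0 x : x \in zs -> x != 0 by move=> /o cx; apply/eqP => E; apply: h0; rewrite -E.
  have s0' : 0 \notin s'.
    rewrite mem_cat (negbTE s0) /=; apply/mapP => -[x xs /eqP].
    by rewrite eq_sym mulf_eq0 invr_eq0 (negbTE q0) orbF (negbTE (x0 x xs)).
  have nr := bounded_lip_ratl hgam p' os'.
  have E z : crv z -> dz_weight z * (\prod_(x <- zs) cross x z * h z) =
     (twopii R)^-1 * (z^-1 * (p'.[z] * \prod_(a <- s') (z - a)^-1)).
    move=> cz; rewrite /dz_weight invfM -mulrA; congr (_ * (_ * _)).
    rewrite hE// /p' /s' hornerM big_cat big_map /= horner_prod.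
    rewrite mulrC -!mulrA; congr (_ * _); rewrite mulrCA; congr (_ * _).
    rewrite -big_split /= big_seq [RHS]big_seq; apply: eq_bigr => x xs.
    rewrite !hornerE /cross.
    have cx := o x xs; have n1 := cross_neq0 cx cz.
    have n2 : z - x / q != 0.
      by rewrite subr_eq0; apply/eqP => zE; apply: (proj1 (hdiv x cx)); rewrite -zE.
    have n3 : z * q - x != 0 by rewrite -oppr_eq0 opprB mulrC.
    by field; rewrite n1 q0 n3.
  have nI : bounded_lip (fun z => z^-1 * (p'.[z] * \prod_(a <- s') (z - a)^-1)).
    apply: bounded_lipM => //; apply: bounded_lip_ext (bounded_lip_invB hgam h0) => z _; by rewrite subr0.
  split; first by apply: bounded_lip_ext (bounded_lipM (bounded_lip_cst gamma (twopii R)^-1) nI) => z cz; rewrite E.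
  rewrite (eq_oint E) (ointZn hgam)//.
  rewrite (oint_rat_res0 hgam _ os' ws' h0 s0') w0 mulKf ?twopii_neq0//.
  rewrite /p' /s' hornerM big_cat big_map /= horner_prod mulrACA /v -[RHS]mulr1; congr (_ * _).
  rewrite -big_split /= big_seq big1// => x xs.
  by rewrite !hornerE; field; rewrite q0 x0.
have nh : bounded_lip h.
  by apply: bounded_lip_ext (bounded_lip_ratl hgam p os) => z cz; rewrite hE.
rewrite /Jint size_rcons (iter_innermost gamma) -[RHS](iter_ointZ hgam h0 _ (lipn_Jint nfs)).
apply: iter_ext => zs sz o; rewrite mulrC -(val zs o).2 -(ointZn hgam); last exact: (val zs o).1.
by apply: eq_oint => z cz; rewrite cross_prod_rcons fun_prod_rcons// ; ring.
Qed.

(** Each [cross z x] has equal degrees above and below, so [f] need only decay like 1 / z: the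
    weight dz / z supplies the second power. The poles 0, [s] and [q * x] are all encircled
    alike. *)
Lemma Jint_decay fs f (p : {poly C}) (s : seq C) w : bounded_lips fs -> bounded_lip f ->
  (forall z, crv z -> wnd gamma (q * z) = w) -> wnd gamma 0 = w ->
  off_curve gamma s -> {in s, forall a, wnd gamma a = w} -> (size p <= size s)%N -> 
  (forall z, crv z -> f z = p.[z] * \prod_(a <- s) (z - a)^-1) ->
  Jint (f :: fs) = 0.
Proof.
move=> nfs nf wq w0 os ws sp fE.
have nF : bounded_lips (f :: fs) by apply/bounded_lips_cons.
rewrite /Jint [LHS](iter_head_innermost hgam h0 (lipn_Jint nF : lipn gamma (size fs).+1 _)).
have -> : 0 = 0 * iter_oint gamma (size fs) (fun=> 0) by rewrite mul0r.
rewrite -(iter_ointZ hgam h0 0 (lipn_cst gamma (size fs) 0)).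
apply: iter_ext => zs sz o; rewrite mulr0.
pose p' := p * \prod_(x <- zs) ('X - x%:P).
pose s' := 0 :: s ++ [seq q * x | x <- zs].
have os' : off_curve gamma s'.
  move=> a; rewrite inE mem_cat => /or3P[/eqP->//|/os//|/mapP[x xs ->]].
  by apply: hq; exact: o.
have ws' : {in s', forall a, wnd gamma a = w}.
  move=> a; rewrite inE mem_cat => /or3P[/eqP->//|/ws//|/mapP[x xs ->]].
  by apply: wq; exact: o.
have sp' : (size p' < size s')%N.
  rewrite /s' /= size_cat size_map ltnS.
  have [p0|p0] := eqVneq p 0; first by rewrite /p' p0 mul0r size_poly0.
  rewrite /p' size_Mmonic ?monic_prod_XsubC// size_prod_XsubC.
  by rewrite addnS /= leq_add2r.
rewrite -[RHS](mulr0 ((twopii R)^-1 * (cross_prod zs * fun_prod fs zs))) -(oint_rat_decay hgam os' ws' sp').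
rewrite -(ointZn hgam); last exact: bounded_lip_ratl.
apply: eq_oint => z cz; rewrite fun_prod_cons fE// /p' /s' hornerM big_cons big_cat big_map /= horner_prod subr0.
rewrite /dz_weight invfM.
have -> : \prod_(y <- zs) cross z y = \prod_(x <- zs) ('X - x%:P).[z] * \prod_(x <- zs) (z - q * x)^-1.
  by rewrite -big_split /=; apply: eq_bigr => x _; rewrite !hornerE.
ring.
Qed.

End Pairing.

(** * The q-Vandermonde identity and affine words *)

Section GroupExpansion.
Local Set Implicit Arguments. Local Unset Strict Implicit.
Variable F : numFieldType.
Implicit Types (q x p b kap : F) (k j m : nat).

Lemma qpochE x q m : qpoch x q m = \prod_(i < m) (1 - x * q ^+ i).
Proof. by rewrite /qpoch big_add1 /= big_mkord. Qed.

Lemma qpoch0 x q : qpoch x q 0 = 1.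
Proof. by rewrite qpochE big_ord0. Qed.

Lemma qpochS x q m : qpoch x q m.+1 = qpoch x q m * (1 - x * q ^+ m).
Proof. by rewrite !qpochE big_ord_recr. Qed.

Lemma qpochSl x q m : qpoch x q m.+1 = (1 - x) * qpoch (x * q) q m.
Proof.
rewrite !qpochE big_ord_recl expr0 mulr1; congr (_ * _).
by apply: eq_bigr => i _; rewrite exprS mulrA.
Qed.

(** The coefficients of [qvandermonde]. The product of the [b * q ^+ i - kap] replaces a [qpoch] in
    [b / kap], which keeps them polynomial in [kap]. *)
Definition group_coef q kap p b k j : F :=
  qpoch q q k / (qpoch q q (k - j) * qpoch q q j) *
  (qpoch (kap * p) q (k - j) * \prod_(i < j) (b * q ^+ i - kap) / qpoch (p * b) q k).

(** The value at (q^(k-1) x, ..., q x, x) of the word with k - j letters [1 - b z] followed by j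
    letters [z - p]. *)
Definition basis q p b k j x : F :=
  (\prod_(j <= i < k) (1 - b * q ^+ i * x)) * \prod_(i < j) (q ^+ i * x - p).

(** [1 - b * q ^+ j * x] and [q ^+ j * x - p] are independent because [1 - p * b] is nonzero; the
    coefficients express [q ^+ j * (1 - kap * x)] in them. *)
Lemma basis_shift q p b kap k j x : (j <= k)%N -> 1 - p * b != 0 ->
  (1 - kap * x) * basis q (q * p) b k j (q * x) =
  (q ^+ j - kap * p) / (1 - p * b) * basis q p b k.+1 j x +
  (b * q ^+ j - kap) / (1 - p * b) * basis q p b k.+1 j.+1 x.
Proof.
move=> jk pb.
have E1 : \prod_(j <= i < k) (1 - b * q ^+ i * (q * x)) = \prod_(j.+1 <= i < k.+1) (1 - b * q ^+ i * x).
  by rewrite big_add1 /=; apply: eq_bigr => i _; rewrite exprSr; ring.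
have E2 : \prod_(i < j) (q ^+ i * (q * x) - q * p) = q ^+ j * \prod_(i < j) (q ^+ i * x - p).
  elim: j {jk E1} => [|j IH]; first by rewrite !big_ord0 expr0 mulr1.
  by rewrite !big_ord_recr /= IH exprS; ring.
rewrite /basis E1 E2 [\prod_(j <= i < k.+1) _]big_ltn// [\prod_(i < j.+1) _]big_ord_recr /=.
set P := \prod_(j.+1 <= i < k.+1) _; set Q := \prod_(i < j) _.
field; exact: pb.
Qed.

(** The Pascal rule behind [qvandermonde]: a basis element with j + 1 letters [z - p] arises from j
    + 1 or from j of them. *)
Lemma group_coef_rec q kap p b k j : (forall m, qpoch q q m != 0) -> qpoch (p * b) q k.+1 != 0 -> (j < k)%N ->
  group_coef q kap (q * p) b k j.+1 * ((q ^+ j.+1 - kap * p) / (1 - p * b)) +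
  group_coef q kap (q * p) b k j * ((b * q ^+ j - kap) / (1 - p * b)) = group_coef q kap p b k.+1 j.+1.
Proof.
move=> hq hpb jk; rewrite /group_coef.
have [d kE] : exists d, k = (d + j.+1)%N by exists (k - j.+1)%N; rewrite subnK.
have k1 : (k - j.+1 = d)%N by rewrite kE addnK.
have k2 : (k - j = d.+1)%N by rewrite kE addnS subSn ?addnK ?leq_addl.
have k3 : (k.+1 - j.+1 = d.+1)%N by rewrite subSS.
rewrite k1 k2 k3 (qpochSl (kap * p)) (qpochSl (p * b)) [q * p]mulrC.
rewrite [p * q * b]mulrAC ![kap * (p * q)]mulrA [qpoch (kap * p * q) q d.+1]qpochS big_ord_recr /=.
move: hpb; rewrite qpochSl mulf_eq0 negb_or => /andP[pb hG].
have := hq j.+1; have := hq d.+1; have := hq k.+1.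
rewrite !(qpochS q q) !mulf_eq0 !negb_or -!exprS => /andP[hk hk1] /andP[hd hd1] /andP[hj hj1].
have -> : q ^+ k.+1 = q ^+ d.+1 * q ^+ j.+1 by rewrite kE -addSn exprD.
rewrite [kap * p * q * q ^+ d](_ : _ = kap * p * q ^+ d.+1); last by rewrite exprS mulrA.
set u := qpoch (kap * p * q) q d; set D := \prod_(i < j) _; set G := qpoch (p * b * q) q k in hG *.
(* Powers of [q] become free variables, and the rule an identity of rational functions. *)
move: (q ^+ d.+1) hd1 => w hd1.
rewrite [q ^+ j.+1]exprS in hj1 *.
move: (q ^+ j) hj1 => y hj1.
by field; rewrite pb hG hd hd1 hj hj1.
Qed.

(** Induction on k: the factor i = 0 is split off, and the others form the product for k - 1 at
    [q * x], expanded with [q * p] in place of [p] so that [basis_shift] applies. *)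
Lemma qvandermonde q kap p b k x : (forall m, qpoch q q m != 0) -> qpoch (p * b) q k != 0 ->
  \prod_(i < k) (1 - kap * q ^+ i * x) = \sum_(j < k.+1) group_coef q kap p b k j * basis q p b k j x.
Proof.
move=> hq; elim: k p x => [|k IH] p x hpb.
  rewrite big_ord1 big_ord0 /basis /group_coef /= subn0 !qpoch0 !big_ord0 big_geq//.
  by rewrite !mulr1 !invr1 !mulr1.
have [pb hG] : 1 - p * b != 0 /\ qpoch (q * p * b) q k != 0.
  move: hpb; rewrite qpochSl mulf_eq0 negb_or => /andP[-> ].
  by rewrite (_ : p * b * q = q * p * b) => [->|]; last by ring.
rewrite big_ord_recl expr0 mulr1.
have -> : \prod_(i < k) (1 - kap * q ^+ (bump 0 i) * x) = \prod_(i < k) (1 - kap * q ^+ i * (q * x)).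
  by apply: eq_bigr => i _; rewrite /bump add1n exprSr; ring.
rewrite (IH _ _ hG) mulr_sumr.
have -> : \sum_(i < k.+1) (1 - kap * x) * (group_coef q kap (q * p) b k i * basis q (q * p) b k i (q * x)) =
  \sum_(j < k.+1) (group_coef q kap (q * p) b k j * ((q ^+ j - kap * p) / (1 - p * b)) * basis q p b k.+1 j x) +
  \sum_(j < k.+1) (group_coef q kap (q * p) b k j * ((b * q ^+ j - kap) / (1 - p * b)) * basis q p b k.+1 j.+1 x).
  rewrite -big_split /=; apply: eq_bigr => j _.
  by rewrite mulrCA basis_shift// ?(ltnSE (ltn_ord j))//; ring.
rewrite big_ord_recl [X in _ + X]big_ord_recr /=.
rewrite [RHS]big_ord_recl [X in _ = _ + X]big_ord_recr /=.
have e1 : kap * (q * p) = kap * p * q by ring.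
have e2 : q * p * b = p * b * q by ring.
have hG' : qpoch (p * b * q) q k != 0 by rewrite -e2.
rewrite -!addrA; congr (_ + _).
  congr (_ * _); rewrite /group_coef !subn0 !qpoch0 !big_ord0 expr0 e1 e2 (qpochSl (kap * p)) (qpochSl (p * b)).
  by field; rewrite pb hG' !hq.
rewrite addrA -big_split /=; congr (_ + _).
  apply: eq_bigr => j _; rewrite /bump /= !add1n -mulrDl; congr (_ * _).
  exact: group_coef_rec.
congr (_ * _); rewrite /group_coef !subnn !qpoch0 e2 big_ord_recr /= (qpochSl (p * b)).
by field; rewrite pb hG' !hq.
Qed.

Lemma poly_eq_horner (f g : {poly F}) : (forall x, f.[x] = g.[x]) -> f = g.
Proof.
move=> h; apply/eqP; rewrite -subr_eq0; apply/eqP; apply: contraTeq isT => n0.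
pose s := [seq n%:R : F | n <- iota 0 (size (f - g))].
have us : uniq s by rewrite map_inj_uniq ?iota_uniq// => m n /eqP; rewrite eqr_nat => /eqP.
have rs : all (root (f - g)) s.
  by apply/allP => x _; rewrite /root hornerD hornerN h subrr.
by have := max_poly_roots n0 rs us; rewrite size_map size_iota ltnn.
Qed.

(* The word (c_1, d_1) ... (c_k, d_k) stands for the product of the affine
   functions c_i + d_i z_i. *)
Section Words.
Variables (q : F) (q0 : q != 0).

(** The letter (1, 0) is the constant 1 and (0, 1) the variable, so the second clause is the
    exchange relation of [Jint_exchange]. *)
Definition wordfun (A : seq (F * F) -> F) :=
  (forall u c d c' d' a a' v, A (u ++ (a * c + a' * c', a * d + a' * d') :: v) =
      a * A (u ++ (c, d) :: v) + a' * A (u ++ (c', d') :: v)) /\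
  (forall u v, A (u ++ (0, 1) :: (1, 0) :: v) = q * A (u ++ (1, 0) :: (0, 1) :: v)).

Fixpoint spec (w : seq (F * F)) : {poly F} :=
  if w is l :: w' then (l.1%:P + (l.2 * q ^+ size w') *: 'X) * spec w' else 1.

Lemma size_spec w : (size (spec w) <= (size w).+1)%N.
Proof.
elim: w => [|l w IH] /=; first by rewrite size_poly1.
apply: leq_trans (size_polyMleq _ _) _.
have : (size (l.1%:P + (l.2 * q ^+ size w) *: 'X)%R <= 2)%N.
  rewrite (leq_trans (size_polyD _ _))// geq_max (leq_trans (size_polyC_leq1 _))//=.
  by rewrite (leq_trans (size_scale_leq _ _))// size_polyX.
by move=> h; rewrite -subn1 leq_subLR (leq_trans (leq_add h IH)).
Qed.

(** The value attached to the monomial x^r: the [spec] of k - r constants followed by r variables is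
    x^r times [q ^+ 'C(r, 2)]. *)
Definition sorted_value (A : seq (F * F) -> F) k r : F :=
  q ^- 'C(r, 2) * A (nseq (k - r) (1, 0) ++ nseq r (0, 1)).

Lemma wordfun_cons A l : wordfun A -> wordfun (fun w => A (l :: w)).
Proof. by move=> [h1 h2]; split=> [u|u] *; [exact: (h1 (l :: u))|exact: (h2 (l :: u))]. Qed.

(* Moving every z to the right by the exchange relation amounts to evaluating
   at a geometric progression (z_1, ..., z_k) = (q^(k-1) x, ..., q x, x). *)
Lemma word_spec A w : wordfun A ->
  A w = \sum_(r < (size w).+1) (spec w)`_r * sorted_value A (size w) r.
Proof.
elim: w A => [|l w IH] A hA.
  by rewrite big_ord1 /= coef1 eqxx /sorted_value /= mul1r expr0 invr1 mul1r.
rewrite (IH _ (wordfun_cons l hA)); set k := size w.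
have move_z m v : A ((0, 1) :: nseq m (1, 0) ++ v) = q ^+ m * A (nseq m (1, 0) ++ (0, 1) :: v).
  have gen u : A (u ++ (0, 1) :: nseq m (1, 0) ++ v) = q ^+ m * A (u ++ nseq m (1, 0) ++ (0, 1) :: v).
    elim: m u => [|m IHm] u /=; first by rewrite expr0 mul1r.
    by have := IHm (rcons u (1, 0)); rewrite hA.2 !cat_rcons => ->; rewrite exprS mulrA.
  exact: (gen [::]).
(* The variable part of [l] crosses k - r constants, which gives q^(k - r); the normalizations for r
   and r + 1 differ by q^r, so the total factor is q^k, as in [spec]. *)
have step r : (r < k.+1)%N -> sorted_value (fun w => A (l :: w)) k r =
    l.1 * sorted_value A k.+1 r + l.2 * q ^+ k * sorted_value A k.+1 r.+1.
  move=> rk; rewrite /sorted_value subSS subSn ?(ltnSE rk)//.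
  have -> : l = (l.1 * 1 + l.2 * 0, l.1 * 0 + l.2 * 1).
    by case: l => c d /=; rewrite !mulr0 !mulr1 addr0 add0r.
  have := hA.1 [::] 1 0 0 1 l.1 l.2 (nseq (k - r) (1, 0) ++ nseq r (0, 1)).
  rewrite /= => ->; rewrite move_z.
  have kE : q ^+ k = q ^+ (k - r) * q ^+ r by rewrite -exprD subnK ?(ltnSE rk).
  rewrite binS bin1 addnC exprD kE.
  have hr : q ^+ r != 0 by rewrite expf_neq0.
  have hc : q ^+ 'C(r, 2) != 0 by rewrite expf_neq0.
  have -> : (0, 1) :: nseq r (0, 1) = nseq r.+1 (0, 1) :> seq (F * F) by [].
  have -> : (1, 0) :: nseq (k - r) (1, 0) ++ nseq r (0, 1) = nseq (k - r).+1 (1, 0) ++ nseq r (0, 1) :> seq (F * F) by [].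
  rewrite !mulr0 !mulr1 !addr0 !add0r /=.
  by field; rewrite hr hc.
rewrite (eq_bigr _ (fun (r : 'I_k.+1) _ => congr1 (fun y => _ * y) (step r (ltn_ord r)))).
rewrite /= -/k.
have -> : \sum_(r < k.+2) ((l.1%:P + (l.2 * q ^+ k) *: 'X) * spec w)`_r * sorted_value A k.+1 r =
   \sum_(r < k.+2) l.1 * (spec w)`_r * sorted_value A k.+1 r +
   \sum_(r < k.+2) (l.2 * q ^+ k) * (if (r : nat) == 0%N then 0 else (spec w)`_r.-1) * sorted_value A k.+1 r.
  rewrite -big_split /=; apply: eq_bigr => r _.
  rewrite mulrDl coefD coefCM -scalerAl coefZ coefXM.
  by rewrite mulrDl.
rewrite [X in _ = X + _]big_ord_recr /=.
rewrite [(spec w)`_k.+1]nth_default ?size_spec// mulr0 mul0r addr0.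
rewrite [X in _ = _ + X]big_ord_recl /= mulr0 mul0r add0r -big_split /=.
by apply: eq_bigr => r _; rewrite /bump /= add1n /=; ring.
Qed.

Lemma horner_spec_nseq k c d w x :
  (spec (nseq k (c, d) ++ w)).[x] =
  (\prod_(size w <= i < size w + k) (c + d * q ^+ i * x)) * (spec w).[x].
Proof.
elim: k => [|k IH] /=; first by rewrite addn0 big_geq// mul1r.
rewrite hornerM IH addnS big_nat_recr ?leq_addr//= size_cat size_nseq addnC mulrA; congr (_ * _).
by rewrite mulrC !hornerE addnC.
Qed.

(** By [word_spec] the value of a word depends linearly on its [spec], and [qvandermonde] is the
    identity between the specs of the two sides. *)
Lemma group_expansion A kap p b k : (forall m, qpoch q q m != 0) -> qpoch (p * b) q k != 0 ->
  wordfun A ->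
  A (nseq k (1, - kap)) =
  \sum_(j < k.+1) group_coef q kap p b k j * A (nseq (k - j) (1, - b) ++ nseq j (- p, 1)).
Proof.
move=> hq hpb hA.
rewrite (word_spec _ hA) size_nseq.
have -> : spec (nseq k (1, - kap)) =
   \sum_(j < k.+1) group_coef q kap p b k j *: spec (nseq (k - j) (1, - b) ++ nseq j (- p, 1)).
  apply: poly_eq_horner => x; rewrite horner_sum.
  rewrite -[nseq k _]cats0 horner_spec_nseq /= [1.[x]]hornerE mulr1 big_mkord.
  rewrite (eq_bigr (fun i : 'I_k => 1 - kap * q ^+ i * x)); last by move=> i _; rewrite !mulNr.
  rewrite (qvandermonde _ _ hq hpb); apply: eq_bigr => j _.
  rewrite hornerZ horner_spec_nseq size_nseq subnKC ?(ltnSE (ltn_ord j))//; congr (_ * (_ * _)).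
    by apply: eq_bigr => i _; rewrite !mulNr.
  rewrite -[nseq j _]cats0 horner_spec_nseq /= [1.[x]]hornerE mulr1 big_mkord.
  by apply: eq_bigr => i _; rewrite mul1r addrC.
under eq_bigr => r _ do rewrite coef_sum mulr_suml.
rewrite exchange_big /=; apply: eq_bigr => j _.
rewrite (word_spec (nseq (k - j) _ ++ _) hA) size_cat !size_nseq subnK ?(ltnSE (ltn_ord j))//.
by rewrite mulr_sumr; apply: eq_bigr => r _; rewrite coefZ -mulrA.
Qed.

End Words.
End GroupExpansion.

(** * The row recursion *)

Section Rows.
Local Set Implicit Arguments. Local Unset Strict Implicit.
Variable F : numFieldType.
Variables (q : F) (p b : nat -> F).
Implicit Types (ms js : seq nat) (o r : nat).

Fixpoint row_moves ms : seq (seq nat) :=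
  if ms is m :: ms' then [seq j :: js | j <- iota 0 m.+1, js <- row_moves ms'] else [:: [::]].

(* ms lists the multiplicities of 1, ..., L on the vertical edges, js the labels of
   the horizontal edges 0, ..., L - 1 (the last one, number L, is 0): js_c of the
   parts c + 1 become parts c. *)
Fixpoint next_row ms js : seq nat :=
  match ms, js with
  | m :: ms', j :: js' => (m - j + head 0%N js')%N :: next_row ms' js'
  | _, _ => [::]
  end.

(** [o] counts the columns already passed and [r] the rows, so the head of [ms] belongs to column o
    + 1 and meets [b] at o + 1 + r. *)
Fixpoint wrow (kap : F) r o ms js : F :=
  match ms, js with
  | m :: ms', j :: js' => group_coef q kap (p o.+1) (b (o.+1 + r)%N) m j * wrow kap r o.+1 ms' js'
  | _, _ => 1
  end.

(** The base case is the empty bottom boundary on the lattice side and, on the integral side, the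
    vanishing in [Jint_phi_eq0]. *)
Fixpoint transfer (ks : seq F) r ms : F :=
  if ks is kap :: ks' then
    \sum_(js <- row_moves ms) wrow kap r 0 ms js * transfer ks' r.+1 (next_row ms js)
  else (sumn ms == 0%N)%:R.

(** Decreasing levels: level 0, once reached, comes last, where [Jint_rcons] applies. *)
Fixpoint levels o ms : seq nat :=
  if ms is m :: ms' then levels o.+1 ms' ++ nseq m o.+1 else [::].

Fixpoint moved o ms js : seq nat :=
  match ms, js with
  | m :: ms', j :: js' => moved o.+1 ms' js' ++ nseq (m - j) o.+1 ++ nseq j o
  | _, _ => [::]
  end.

(** In each group the moved parts come last, next to the parts of the following group that stay at
    the same level, so the list is grouped again as it stands. *)
Lemma moved_levels o ms js : size js = size ms ->
  moved o ms js = levels o (next_row ms js) ++ nseq (head 0%N js) o.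
Proof.
elim: ms js o => [|m ms IH] [|j js]//= o [s].
by rewrite IH// -!catA; congr (_ ++ _); rewrite catA -nseqD addnC.
Qed.

Lemma size_row_moves ms js : js \in row_moves ms -> size js = size ms.
Proof.
elim: ms js => [|m ms IH] js; first by rewrite inE => /eqP->.
rewrite [row_moves _]/(allpairs_dep _ _ _) => /allpairsPdep[j [js' [_ h ->]]] /=.
by rewrite IH.
Qed.

End Rows.

(** * The row recursion for the integral *)

Section Integral.
Local Set Implicit Arguments. Local Unset Strict Implicit.
Variable R : realType.
Local Notation C := (R[i]).
Variable gamma : R -> C.
Hypothesis hgam : piecewise_C1 gamma /\ gamma 0 = gamma 1.
Hypothesis h0 : ~ curve gamma 0.
Variable q : C.
Hypothesis q0 : q != 0.
Hypothesis hq : forall z, curve gamma z -> ~ curve gamma (q * z).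
Local Notation crv := (curve gamma).
Local Notation bounded_lip := (bounded_lip gamma).
Local Notation bounded_lips := (bounded_lips gamma).
Local Notation Jint := (Jint gamma q).
Implicit Types (z a x y : C) (f g h : C -> C) (fs gs : seq (C -> C)) (k : nat).

Lemma bounded_lips_nseq k f : bounded_lip f -> bounded_lips (nseq k f).
Proof. by move=> nf i; rewrite size_nseq => ik; rewrite nth_nseq ik. Qed.

Lemma Jint_nseq_ext fs k f g gs : (forall z, crv z -> f z = g z) ->
  Jint (fs ++ nseq k f ++ gs) = Jint (fs ++ nseq k g ++ gs).
Proof.
move=> fg; elim: k fs => [//|k IH] fs /=.
by rewrite (Jint_ext q fs _ fg) -!cat_rcons IH.
Qed.

(** With all other functions frozen, [Jint] is a [wordfun] of the affine factors that multiply the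
    common [g] in this group. *)
Lemma Jint_group fs g gs kap p b k : bounded_lips fs -> bounded_lips gs -> bounded_lip g ->
  (forall m, qpoch q q m != 0) -> qpoch (p * b) q k != 0 ->
  Jint (fs ++ nseq k (fun z => g z * (1 - kap * z)) ++ gs) =
  \sum_(j < k.+1) group_coef q kap p b k j *
    Jint (fs ++ (nseq (k - j) (fun z => g z * (1 - b * z)) ++ nseq j (fun z => g z * (z - p))) ++ gs).
Proof.
move=> nfs ngs ng hqq hpb.
pose G (l : C * C) z := g z * (l.1 + l.2 * z).
have nG l : bounded_lip (G l).
  apply: bounded_lipM => //; apply: bounded_lipD; first exact: bounded_lip_cst.
  by apply: bounded_lipM; [exact: bounded_lip_cst|exact: bounded_lip_id].
have nGs w : bounded_lips [seq G l | l <- w].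
  by elim: w => [//|l w IH] /=; apply/bounded_lips_cons; split.
pose A w := Jint (fs ++ [seq G l | l <- w] ++ gs).
have hA : wordfun q A.
  split=> [u c d c' d' a a' v|u v]; rewrite /A !map_cat /= -!catA !catA -!(catA (fs ++ _)) /=.
    apply: (Jint_lin hgam h0 q0 hq) => //.
    - by apply/bounded_lips_cat.
    - by apply/bounded_lips_cat.
    by move=> z _; rewrite /G /=; ring.
  have E1 z : crv z -> G (1, 0) z = g z by rewrite /G /= mul0r addr0 mulr1.
  have E2 z : crv z -> G (0, 1) z = g z * z by rewrite /G /= mul1r add0r.
  set X := fs ++ _; set Y := _ ++ gs.
  rewrite (Jint_ext q X _ E2) -(cat_rcons _ X) (Jint_ext q (rcons X _) _ E1) cat_rcons.
  rewrite (Jint_ext q X _ E1) -(cat_rcons g X) (Jint_ext q (rcons X _) _ E2) cat_rcons.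
  by apply: (Jint_exchange hgam h0 q0 hq) => //; apply/bounded_lips_cat.
have := group_expansion q0 kap hqq hpb hA.
rewrite /A map_nseq.
have -> : Jint (fs ++ nseq k (G (1, - kap)) ++ gs) = Jint (fs ++ nseq k (fun z => g z * (1 - kap * z)) ++ gs).
  by apply: Jint_nseq_ext => z _; rewrite /G /= mulNr.
move=> ->; apply: eq_bigr => j _; congr (_ * _).
rewrite map_cat !map_nseq -!catA.
rewrite (Jint_nseq_ext fs (k - j) (g := fun z => g z * (1 - b * z))); last by move=> z _; rewrite /G /= mulNr.
rewrite !catA -!(catA (fs ++ _)); apply: Jint_nseq_ext => z _.
by rewrite /G /= mul1r addrC.
Qed.

Variables (p b : nat -> C).
Hypothesis hp : forall i, (1 <= i)%N -> ~ crv (p i) /\ wnd gamma (p i) = twopii R.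
Hypothesis hb : forall i, (1 <= i)%N -> [/\ b i != 0, ~ crv (b i)^-1 & wnd gamma (b i)^-1 = 0].
Hypothesis w0 : wnd gamma 0 = twopii R.
Hypothesis hwq : forall z, crv z -> wnd gamma (q * z) = twopii R.
Hypothesis hdiv : forall z, crv z -> ~ crv (z / q) /\ wnd gamma (z / q) = 0.
Hypothesis hqq : forall m, qpoch q q m != 0.

(* After r rows b is shifted by r.  Level 0 only occurs for r >= 1, so the pole
   1 / b_r of its function is always one of those outside the contour. *)
Definition numer r c z : C :=
  if c is c'.+1 then \prod_(i < c') (1 - b (i + r.+1)%N * z) else (1 - b r * z)^-1.

Definition phi r c z : C := numer r c z * \prod_(1 <= j < c.+1) (z - p j)^-1.

Fixpoint tail_fun (r : nat) (ks : seq C) z : C :=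
  if ks is kap :: ks' then (1 - kap * z) * (1 - b r.+1 * z)^-1 * tail_fun r.+1 ks' z else 1.

Lemma onemM_neq0 i z : (1 <= i)%N -> crv z -> 1 - b i * z != 0.
Proof.
move=> /hb[b0 nb _] cz; rewrite subr_eq0; apply/eqP => E; apply: nb.
by rewrite -[_^-1]mulr1 E mulKf.
Qed.

Lemma bounded_lip_onem a : bounded_lip (fun z => 1 - a * z).
Proof.
apply: bounded_lip_ext (bounded_lipD (bounded_lip_cst gamma 1) (bounded_lipM (bounded_lip_cst gamma (- a)) (bounded_lip_id hgam))) => z _ /=.
by rewrite mulNr.
Qed.

Lemma inv_onemE i z : (1 <= i)%N -> crv z -> (1 - b i * z)^-1 = - (b i)^-1 * (z - (b i)^-1)^-1.
Proof.
move=> i1 cz; have n1 := onemM_neq0 i1 cz; have [b0 _ _] := hb i1.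
have n2 : z * b i - 1 != 0 by rewrite -oppr_eq0 opprB mulrC.
by field; rewrite n2 b0 n1.
Qed.

Lemma bounded_lip_inv_onem i : (1 <= i)%N -> bounded_lip (fun z => (1 - b i * z)^-1).
Proof.
move=> i1; have [b0 nb _] := hb i1.
apply: bounded_lip_ext (bounded_lipM (bounded_lip_cst gamma (- (b i)^-1)) (bounded_lip_invB hgam nb)) => z cz.
by rewrite inv_onemE.
Qed.

Lemma bounded_lip_phi r c : (1 <= c + r)%N -> bounded_lip (phi r c).
Proof.
move=> cr1; apply: bounded_lipM.
  case: c cr1 => [|c] cr1 /=; first exact: bounded_lip_inv_onem.
  by apply: bounded_lip_prod => i _; exact: bounded_lip_onem.
rewrite (_ : (fun z => _) = (fun z => \prod_(a <- [seq p j | j <- index_iota 1 c.+1]) (z - a)^-1)); last first.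
  by apply: funext => z; rewrite big_map.
apply: bounded_lip_invs => // a /mapP[j]; rewrite mem_index_iota => /andP[j1 _] ->.
exact: (hp j1).1.
Qed.

Lemma bounded_lip_tail_fun r ks : bounded_lip (tail_fun r ks).
Proof.
elim: ks r => [|kap ks IH] r; first exact: bounded_lip_cst.
by apply: bounded_lipM => //; apply: bounded_lipM; [exact: bounded_lip_onem|exact: bounded_lip_inv_onem].
Qed.

Definition level_fun r ks c z : C := phi r c z * tail_fun r ks z.

Lemma bounded_lip_level_fun r ks c : (1 <= c + r)%N -> bounded_lip (level_fun r ks c).
Proof. by move=> cr1; apply: bounded_lipM; [exact: bounded_lip_phi|exact: bounded_lip_tail_fun]. Qed.

(** The common [g] of a group: the function before the row, the one of a part that stays and the one
    of a part that moves are [g] times [1 - kap z], [1 - b z] and [z - p]. *)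
Definition level_core r ks c z : C := phi r.+1 c z * (z - p c.+1)^-1 * tail_fun r.+1 ks z.

Lemma bounded_lip_level_core r ks c : bounded_lip (level_core r ks c).
Proof.
apply: bounded_lipM; last exact: bounded_lip_tail_fun.
apply: bounded_lipM; first by apply: bounded_lip_phi; rewrite addnS.
by apply: bounded_lip_invB => //; exact: (hp (ltn0Sn c)).1.
Qed.

Lemma zp_neq0 c z : crv z -> z - p c.+1 != 0.
Proof.
move=> cz; rewrite subr_eq0; apply/eqP => E.
by apply: (hp (ltn0Sn c)).1; rewrite -E.
Qed.

Lemma level_fun_old r kap ks c z : crv z ->
  level_fun r (kap :: ks) c.+1 z = level_core r ks c z * (1 - kap * z).
Proof.
move=> cz; rewrite /level_fun /level_core /phi /= [\prod_(1 <= j < c.+2) _]big_nat_recr//=.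
set D := \prod_(1 <= j < c.+1) _.
have n1 : 1 - b r.+1 * z != 0 by exact: onemM_neq0.
(* For c = 0 the inverse in [numer r.+1 0] cancels [1 - b r.+1 * z]: the convention at level 0 makes
   the formula uniform in c. *)
have -> : \prod_(i < c) (1 - b (i + r.+1)%N * z) = numer r.+1 c z * (1 - b r.+1 * z).
  case: c D => [|c] D /=; first by rewrite big_ord0 mulVf.
  rewrite big_ord_recl add0n mulrC; congr (_ * _).
  by apply: eq_bigr => i _; rewrite lift0 addSnnS.
have n2 := zp_neq0 c cz.
field; by rewrite n1 n2.
Qed.

Lemma level_fun_stay r ks c z : crv z ->
  level_fun r.+1 ks c.+1 z = level_core r ks c z * (1 - b (c.+1 + r)%N * z).
Proof.
move=> cz; rewrite /level_fun /level_core /phi /= [\prod_(1 <= j < c.+2) _]big_nat_recr//=.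
set D := \prod_(1 <= j < c.+1) _.
have -> : \prod_(i < c) (1 - b (i + r.+2)%N * z) = numer r.+1 c z * (1 - b (c.+1 + r)%N * z).
  case: c D => [|c] D /=; first by rewrite big_ord0 mulVf// onemM_neq0.
  by rewrite big_ord_recr /= !addSnnS.
ring.
Qed.

Lemma level_fun_move r ks c z : crv z ->
  level_fun r.+1 ks c z = level_core r ks c z * (z - p c.+1).
Proof. by move=> cz; rewrite /level_fun /level_core; field; rewrite zp_neq0. Qed.

Lemma Jint_rows r kap ks o ms gs : bounded_lips gs ->
  (forall c m, (1 <= c)%N -> qpoch (p c * b (c + r)%N) q m != 0) ->
  Jint ([seq level_fun r (kap :: ks) c | c <- levels o ms] ++ gs) =
  \sum_(js <- row_moves ms) wrow q p b kap r o ms js *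
     Jint ([seq level_fun r.+1 ks c | c <- moved o ms js] ++ gs).
Proof.
move=> + hgen; elim: ms o gs => [|m ms IH] o gs ngs.
  by rewrite big_seq1 /= mul1r.
have nl o' ms' : bounded_lips [seq level_fun r (kap :: ks) c | c <- levels o' ms'].
  elim: ms' o' => [//|m' ms' IHm] o' /=; rewrite map_cat map_nseq.
  by apply/bounded_lips_cat; split; [exact: IHm|apply: bounded_lips_nseq; exact: bounded_lip_level_fun].
rewrite [levels o (m :: ms)]/= [row_moves _]/(allpairs_dep _ _ _).
rewrite map_cat map_nseq -catA (Jint_nseq_ext _ _ _ (@level_fun_old r kap ks o)).
rewrite (@Jint_group _ (level_core r ks o) gs kap (p o.+1) (b (o.+1 + r)%N)) //; [|exact: bounded_lip_level_core|exact: hgen].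
rewrite big_allpairs_dep -[iota 0 m.+1]/(index_iota 0 m.+1) big_mkord; apply: eq_bigr => j _.
set gs' := (nseq _ _ ++ nseq _ _) ++ gs.
have ngs' : bounded_lips (nseq (m - j) (level_fun r.+1 ks o.+1) ++ nseq j (level_fun r.+1 ks o) ++ gs).
  by do 2!(apply/bounded_lips_cat; split; [apply: bounded_lips_nseq; apply: bounded_lip_level_fun; by rewrite addnS|]).
have -> : Jint ([seq level_fun r (kap :: ks) c | c <- levels o.+1 ms] ++ gs') =
  Jint ([seq level_fun r (kap :: ks) c | c <- levels o.+1 ms] ++ nseq (m - j) (level_fun r.+1 ks o.+1) ++ nseq j (level_fun r.+1 ks o) ++ gs).
  rewrite /gs' -catA -(Jint_nseq_ext _ _ _ (@level_fun_stay r ks o)).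
  by rewrite !catA -!(catA (_ ++ _)) -(Jint_nseq_ext _ _ _ (@level_fun_move r ks o)).
rewrite (IH _ _ ngs') mulr_sumr; apply: eq_bigr => js _ /=.
by rewrite mulrA !map_cat !map_nseq -!catA.
Qed.

(** Rational on the curve, with nonzero poles of winding number 0 and the value v at the origin: the
    shape that [Jint_rcons] takes. *)
Definition regular h v := exists (P : {poly C}) (s : seq C),
  [/\ off_curve gamma s, {in s, forall a, wnd gamma a = 0}, 0 \notin s,
      P.[0] * \prod_(a <- s) (0 - a)^-1 = v &
      forall z, crv z -> h z = P.[z] * \prod_(a <- s) (z - a)^-1].

Lemma regularM f g u v : regular f u -> regular g v -> regular (fun z => f z * g z) (u * v).
Proof.
move=> [P [s [os ws s0 <- hE]]] [P' [s' [os' ws' s0' <- hE']]].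
exists (P * P'), (s ++ s'); split.
- by move=> a; rewrite mem_cat => /orP[]; [exact: os|exact: os'].
- by move=> a; rewrite mem_cat => /orP[]; [exact: ws|exact: ws'].
- by rewrite mem_cat negb_or s0.
- by rewrite hornerM big_cat /=; ring.
- by move=> z cz; rewrite hE// hE'// hornerM big_cat /=; ring.
Qed.

Lemma regular_onem a : regular (fun z => 1 - a * z) 1.
Proof.
exists (1 - a *: 'X), [::]; split=> //.
- by rewrite big_nil !hornerE; ring.
- by move=> z _; rewrite big_nil !hornerE; ring.
Qed.

Lemma regular_inv_onem i : (1 <= i)%N -> regular (fun z => (1 - b i * z)^-1) 1.
Proof.
move=> i1; have [b0 nb wb] := hb i1.
exists (- (b i)^-1)%:P, [:: (b i)^-1]; split.
- by move=> a; rewrite inE => /eqP->.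
- by move=> a; rewrite inE => /eqP->.
- by rewrite inE eq_sym invr_eq0.
- by rewrite big_seq1 hornerC; field.
- by move=> z cz; rewrite big_seq1 hornerC inv_onemE.
Qed.

Lemma regular_tail_fun r ks : regular (tail_fun r ks) 1.
Proof.
elim: ks r => [|kap ks IH] r /=.
  exists 1, [::]; split=> //; first by rewrite big_nil hornerC mulr1.
  by move=> z _; rewrite big_nil hornerC mulr1.
by have := regularM (regularM (regular_onem kap) (regular_inv_onem (ltn0Sn r))) (IH r.+1); rewrite !mulr1.
Qed.

(** Every factor of a function of level 0 is 1 at z = 0, so each removed variable contributes 1. *)
Lemma Jint_zero_level r ks fs k : bounded_lips fs -> Jint (fs ++ nseq k (level_fun r.+1 ks 0)) = Jint fs.
Proof.
move=> nfs; elim: k => [|k IH]; first by rewrite cats0.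
rewrite -[k.+1]addn1 nseqD catA cats1.
have [P [s [os ws s0 v hE]]] := regularM (regular_inv_onem (ltn0Sn r)) (regular_tail_fun r.+1 ks).
rewrite (Jint_rcons hgam h0 q0 hq (p := P) (s := s)) //.
- by rewrite v mulr1 mul1r.
- by apply/bounded_lips_cat; split=> //; apply: bounded_lips_nseq; apply: bounded_lip_level_fun; rewrite addnS.
- by move=> z cz; rewrite -hE// /level_fun /phi /= big_geq// mulr1.
Qed.

(** There are c affine factors above against the c + 1 poles [p_1], ..., [p_(c+1)], all inside: the
    function decays like 1 / z. *)
Lemma Jint_phi_eq0 r c fs : bounded_lips fs -> Jint (level_fun r [::] c.+1 :: fs) = 0.
Proof.
move=> nfs.
apply: (@Jint_decay _ _ hgam h0 q q0 hq fs _ (\prod_(i < c) (1 - b (i + r.+1)%N *: 'X))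
  [seq p j | j <- index_iota 1 c.+2] (twopii R)) => //.
- exact: bounded_lip_level_fun.
- by move=> a /mapP[j]; rewrite mem_index_iota => /andP[j1 _] ->; exact: (hp j1).1.
- by move=> a /mapP[j]; rewrite mem_index_iota => /andP[j1 _] ->; exact: (hp j1).2.
- rewrite size_map size_iota subn1 /=.
  elim: c => [|c IH]; first by rewrite big_ord0 size_poly1.
  rewrite big_ord_recr /=; apply: leq_trans (size_polyMleq _ _) _.
  have : (size (1 - b (c + r.+1)%N *: 'X : {poly C})%R <= 2)%N.
    rewrite (leq_trans (size_polyD _ _))// size_polyN geq_max size_poly1 /=.
    by rewrite (leq_trans (size_scale_leq _ _))// size_polyX.
  by move=> h; rewrite -subn1 leq_subLR (leq_trans (leq_add IH h))// addn2 add1n.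
move=> z _; rewrite big_map horner_prod /level_fun /phi mulr1; congr (_ * _).
by apply: eq_bigr => i _; rewrite !hornerE.
Qed.

Lemma Jint_transfer ks r ms :
  (forall r' c m, (r' < r + size ks)%N -> (1 <= c)%N -> qpoch (p c * b (c + r')%N) q m != 0) ->
  Jint [seq level_fun r ks c | c <- levels 0 ms] = transfer q p b ks r ms.
Proof.
have nl r' o' ks' ms' : bounded_lips [seq level_fun r' ks' c | c <- levels o' ms'].
  elim: ms' o' => [//|m' ms' IHm] o' /=; rewrite map_cat map_nseq.
  by apply/bounded_lips_cat; split; [exact: IHm|apply: bounded_lips_nseq; exact: bounded_lip_level_fun].
elim: ks r ms => [|kap ks IH] r ms hgen.
  rewrite /=.
  have lvl o : levels o ms = [::] /\ sumn ms = 0%N \/ (0 < sumn ms)%N /\ exists c w, levels o ms = c.+1 :: w.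
    elim: ms o => [|m ms IHm] o /=; first by left.
    have [[-> ->]|[s0 [c [w ->]]]] := IHm o.+1.
      by case: m => [|m]; [left|right; rewrite addn0; split=> //; exists o, (nseq m o.+1)].
    by right; rewrite addn_gt0 s0 orbT; split=> //; exists c, (w ++ nseq m o.+1).
  have [[-> ->]|[s0 [c [w E]]]] := lvl 0%N.
    by rewrite /Jint /= /cross_prod /fun_prod big_nil mulr1.
  have := nl r 0%N [::] ms; rewrite E /= (gtn_eqF s0) => /bounded_lips_cons[_ nw].
  exact: Jint_phi_eq0.
rewrite -[[seq _ | _ <- _]]cats0 Jint_rows //; last first.
  by move=> c m c1; apply: hgen => //=; rewrite addnS ltnS leq_addr.
rewrite /=; rewrite big_seq [RHS]big_seq; apply: eq_bigr => js /size_row_moves sjs; congr (_ * _).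
rewrite cats0 moved_levels// map_cat map_nseq Jint_zero_level; last exact: nl.
by apply: IH => r' c m; rewrite addSnnS; exact: hgen.
Qed.

End Integral.

(** * From the partition function to the row recursion *)

Section Partitions.
Local Set Implicit Arguments. Local Unset Strict Implicit.
Implicit Types (la ms js : seq nat) (o r c j : nat).

Lemma nth_next_row ms js c : size js = size ms -> (c < size ms)%N ->
  nth 0%N (next_row ms js) c = (nth 0 ms c - nth 0 js c + nth 0 js c.+1)%N.
Proof.
elim: ms js c => [|m ms IH] [|j js]//= [|c] [sj] cm /=; last exact: IH.
by rewrite nth0.
Qed.

Lemma size_next_row ms js : size js = size ms -> size (next_row ms js) = size ms.
Proof. by elim: ms js => [|m ms IH] [|j js]//= [/IH->]. Qed.

Lemma mem_row_moves ms js :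
  (js \in row_moves ms) = (size js == size ms) && all (fun u => u.1 <= u.2)%N (zip js ms).
Proof.
elim: ms js => [|m ms IH] js; first by rewrite inE; case: js.
rewrite [row_moves _]/(allpairs_dep _ _ _).
apply/allpairsPdep/idP => [[j [js' [jm h ->]]]|].
  by move: h => /=; rewrite IH eqSS => /andP[-> ->]; move: jm; rewrite mem_iota add0n ltnS => /andP[_ ->].
case: js => [//|j js] /=; rewrite eqSS => /andP[sj /andP[jm al]].
exists j, js; split=> //; last by rewrite /= IH sj.
by rewrite -[0%N :: _]/(iota 0 m.+1) mem_iota add0n ltnS jm.
Qed.

Lemma sumn_next_row ms js : js \in row_moves ms -> (sumn (next_row ms js) + head 0 js = sumn ms)%N.
Proof.
elim: ms js => [|m ms IH] [|j js]//; rewrite ?mem_row_moves ?andbF//= eqSS => /andP[sj /andP[jm al]].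
have := IH js; rewrite mem_row_moves sj al => /(_ isT) <-.
by lia.
Qed.

Lemma uniq_row_moves ms : uniq (row_moves ms).
Proof.
elim: ms => [//|m ms IH]; rewrite [row_moves _]/(allpairs_dep _ _ _).
apply: allpairs_uniq_dep; [exact: iota_uniq|by []|].
by move=> [j js] [j' js'] _ _ /= [-> ->].
Qed.

(** Both sides say that the cell (c, j) lies in the Young diagram. *)
Lemma nth_count_gt la c j : sorted geq la ->
  (j < nth 0 la c)%N = (c < count (fun x => (j < x)%N) la)%N.
Proof.
elim: la c => [|x la IH] c sla; first by rewrite nth_nil.
have sla' := path_sorted sla.
have tr : transitive geq by move=> a b d ab bd; exact: leq_trans bd ab.
have xmax := order_path_min tr sla.
rewrite /=; case: (ltnP j x) => jx; first by case: c => [|c] //=; rewrite add1n ltnS IH.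
rewrite add0n (eq_in_count (a2 := pred0)) ?count_pred0; last first.
  by move=> y /(allP xmax) /= yx; rewrite ltnNge (leq_trans yx jx).
rewrite ltn0; apply/negbTE; rewrite -leqNgt; case: c => [//|c] /=.
case: (ltnP c (size la)) => cs; last by rewrite nth_default.
apply: leq_trans jx; exact: (allP xmax _ (mem_nth 0 cs)).
Qed.

Section Conj.
Variable la : seq nat.
Hypothesis hla : is_part la.
Let L := (size la).+1.

(** [L] exceeds the length of [la] by one, as in [Fformula] for an empty [mu]; the last entry is
    0. *)
Definition mults : seq nat := mkseq (fun c => mult (conjp la) c.+1) L.

Lemma count_conjp c : count (fun x => (c < x)%N) (conjp la) = nth 0 la c.
Proof.
have sla : sorted geq la by case/andP: hla.
rewrite /conjp count_map.
rewrite (eq_in_count (a2 := fun j => (j < nth 0 la c)%N)); last first.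
  by move=> j _ /=; rewrite nth_count_gt.
have le0 : (nth 0 la c <= part la 1)%N.
  rewrite /part /= leqNgt nth_count_gt// -leqNgt.
  rewrite (eq_in_count (a2 := pred0)) ?count_pred0// => y yla /=.
  apply/negbTE; rewrite -leqNgt; have := nth_count_gt 0 (nth 0 la 0) sla.
  rewrite ltnn => /esym/negbT; rewrite -leqNgt leqn0 => /eqP h.
  rewrite leqNgt; apply/negP => yy; have : has (fun x => nth 0 la 0 < x)%N la by apply/hasP; exists y.
  by rewrite has_count h.
rewrite -(subnKC le0) iotaD count_cat.
rewrite (eq_in_count (a2 := predT)); last by move=> j; rewrite mem_iota /= => ->.
rewrite count_predT size_iota (eq_in_count (a2 := pred0)) ?count_pred0 ?addn0//.
by move=> j; rewrite mem_iota add0n /= => /andP[h _]; rewrite ltnNge h.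
Qed.

Lemma conjp_bounds x : x \in conjp la -> (0 < x < L)%N.
Proof.
move=> /mapP[j]; rewrite mem_iota add0n => /andP[_ jl] ->.
rewrite /L ltnS count_size andbT.
by rewrite -nth_count_gt//; case/andP: hla.
Qed.

Lemma count_levels ms o x : count_mem x (levels o ms) =
  if (o < x)%N then nth 0 ms (x - o.+1) else 0%N.
Proof.
elim: ms o => [|m ms IH] o /=; first by rewrite nth_nil if_same.
rewrite count_cat IH count_nseq /=.
case: (ltngtP o.+1 x) => [ox|ox|<-].
- by rewrite mul0n addn0 -(subnSK ox).
- by rewrite mul0n.
- by rewrite subnn mul1n add0n.
Qed.

Lemma levels_sorted ms o : sorted geq (levels o ms) /\ all (fun x => o < x)%N (levels o ms).
Proof.
elim: ms o => [//|m ms IH] o /=; have [s a] := IH o.+1.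
have tr : transitive geq by move=> a' b d ab bd; exact: leq_trans bd ab.
split; last first.
  rewrite all_cat all_nseq leqnn orbT andbT; apply: sub_all a => x; exact: ltnW.
rewrite sorted_pairwise// pairwise_cat -!sorted_pairwise// s /=; apply/andP; split.
  by apply/allrelP => x y /(allP a) ox /nseqP[-> _]; exact: ltnW.
by elim: (m) => [|[|k] IHk]//=; rewrite leqnn.
Qed.

Lemma levels_conjp : levels 0 mults = conjp la.
Proof.
have tr : transitive geq by move=> a' b d ab bd; exact: leq_trans bd ab.
have an : antisymmetric geq by move=> a b; rewrite andbC => /anti_leq.
apply: (sorted_eq tr an); first exact: (levels_sorted _ _).1.
  rewrite /conjp; apply: (homo_sorted (e := leq)); last exact: iota_sorted.
  by move=> i j ij /=; apply: sub_count => x /=; exact: leq_ltn_trans.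
rewrite /perm_eq; apply/allP => x _; apply/eqP.
apply: etrans (count_levels _ 0 x) _; rewrite subn1; case: x => [|x] /=.
  apply/esym/eqP; rewrite -leqn0 leqNgt -has_count; apply/negP => /hasP[y /conjp_bounds h /eqP yE].
  by rewrite yE in h.
rewrite /mults; case: (ltnP x L) => xL; first by rewrite nth_mkseq.
rewrite nth_default ?size_mkseq//; apply/esym/eqP; rewrite -leqn0 leqNgt -has_count; apply/negP => /hasP[y /conjp_bounds h /eqP yE].
by move: h; rewrite yE /= ltnNge (leq_trans xL).
Qed.

Lemma size_levels ms o : size (levels o ms) = sumn ms.
Proof. by elim: ms o => [//|m ms IH] o /=; rewrite size_cat IH size_nseq addnC. Qed.

Lemma count_levels_gt ms o c : count (fun x => (o + c < x)%N) (levels o ms) = sumn (drop c ms).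
Proof.
elim: ms o c => [//|m ms IH] o [|c] /=.
  rewrite addn0 count_cat count_nseq leqnn mul1n addnC; congr (_ + _)%N.
  rewrite (eq_in_count (a2 := predT)) ?count_predT ?size_levels// => x /(allP (levels_sorted ms o.+1).2).
  by move=> /ltnW /= ->.
by rewrite count_cat count_nseq ltnNge addnS ltnS leq_addr /= mul0n addn0 -addSn IH.
Qed.

Lemma sumn_mults c : sumn (drop c mults) = nth 0 la c.
Proof. by rewrite -count_conjp -levels_conjp -(count_levels_gt _ 0). Qed.

Lemma nth_mults c : nth 0 mults c = (nth 0 la c - nth 0 la c.+1)%N.
Proof.
rewrite -!sumn_mults; case: (ltnP c (size mults)) => cs.
  by rewrite (drop_nth 0 cs) /= addnK.
by rewrite nth_default// drop_oversize.
Qed.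

End Conj.
End Partitions.

(** * Enumerating the states of the partition function *)

Section States.
Local Set Implicit Arguments. Local Unset Strict Implicit.
Implicit Types (la ms js : seq nat) (hs : seq (seq nat)) (n L i c : nat).

(** The horizontal labels of the states with top row [ms], as a finite list; left and bottom labels
    are left free. *)
Fixpoint hists n ms : seq (seq (seq nat)) :=
  if n is n'.+1 then [seq js :: hs | js <- row_moves ms, hs <- hists n' (next_row ms js)]
  else [:: [::]].

(* hs lists the horizontal labels row by row; by conservation they determine the
   vertical labels vrow ms hs i below row i. *)
Fixpoint vrow ms hs i {struct i} : seq nat :=
  if i is i'.+1 then (if hs is js :: hs' then vrow (next_row ms js) hs' i' else [::]) else ms.

Lemma hists_cons n ms js hs : (js :: hs \in hists n.+1 ms) =
  (js \in row_moves ms) && (hs \in hists n (next_row ms js)).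
Proof.
rewrite [hists n.+1 ms]/(allpairs_dep _ _ _).
apply/allpairsPdep/andP => [[x [y [h1 h2 [-> ->]]]]//|[h1 h2]].
by exists js, hs.
Qed.

Lemma hists_size n ms hs : hs \in hists n ms -> size hs = n.
Proof.
elim: n ms hs => [|n IH] ms hs; first by rewrite inE => /eqP->.
case: hs => [|js hs].
  by rewrite [hists n.+1 ms]/(allpairs_dep _ _ _) => /allpairsPdep[x [y [_ _]]].
by rewrite hists_cons => /andP[_ /IH /= ->].
Qed.

Lemma hists_uniq n ms : uniq (hists n ms).
Proof.
elim: n ms => [//|n IH] ms; rewrite [hists n.+1 ms]/(allpairs_dep _ _ _).
apply: allpairs_uniq_dep; [exact: uniq_row_moves|by move=> js _; exact: IH|].
by move=> [j js] [j' js'] _ _ /= [-> ->].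
Qed.

Lemma hists_row n ms hs i : hs \in hists n ms -> (i < n)%N ->
  [/\ nth [::] hs i \in row_moves (vrow ms hs i),
      vrow ms hs i.+1 = next_row (vrow ms hs i) (nth [::] hs i) &
      size (vrow ms hs i) = size ms].
Proof.
elim: n ms hs i => [//|n IH] ms [|js hs] i h; first by have := hists_size h.
move: h; rewrite hists_cons => /andP[h1 h2]; case: i => [|i] il; first by split.
have [a b d] := IH _ _ i h2 il; split=> //.
by rewrite d size_next_row// (size_row_moves h1).
Qed.

Lemma hists_total n ms hs : hs \in hists n ms ->
  (\sum_(i < n) head 0%N (nth [::] hs i) + sumn (vrow ms hs n) = sumn ms)%N.
Proof.
elim: n ms hs => [|n IH] ms [|js hs] h; first by rewrite big_ord0.
- by rewrite inE in h.
- by have := hists_size h.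
move: h; rewrite hists_cons => /andP[h1 h2]; rewrite big_ord_recl /=.
by rewrite -addnA IH// addnC; exact: sumn_next_row.
Qed.

(** Conservation together with [H i c.+1 <= V i.+1 c] gives [H i c <= V i c], so each row of labels
    is a legal move. The label 0 on the right edge agrees with the default of [nth] past the end. *)
Lemma hists_build (V H : nat -> nat -> nat) n L :
  (forall i c, (i < n)%N -> (c < L)%N -> (V i.+1 c + H i c = V i c + H i c.+1)%N /\ (H i c.+1 <= V i.+1 c)%N) ->
  (forall i, (i < n)%N -> H i L = 0%N) ->
  mkseq (fun i => mkseq (H i) L) n \in hists n (mkseq (V 0%N) L) /\
  forall i, (i <= n)%N -> vrow (mkseq (V 0%N) L) (mkseq (fun i => mkseq (H i) L) n) i = mkseq (V i) L.
Proof.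
elim: n V H => [|n IH] V H hc hL; first by split=> // -[].
have nx : next_row (mkseq (V 0%N) L) (mkseq (H 0%N) L) = mkseq (V 1%N) L.
  apply: (@eq_from_nth _ 0%N); first by rewrite size_next_row !size_mkseq.
  rewrite size_next_row !size_mkseq// => c cL.
  rewrite nth_next_row ?size_mkseq//.
  have -> : nth 0%N (mkseq (H 0%N) L) c.+1 = H 0%N c.+1.
    case: (ltnP c.+1 L) => cL'; first by rewrite nth_mkseq.
    have -> : c.+1 = L by apply/eqP; rewrite eqn_leq cL cL'.
    by rewrite nth_default ?size_mkseq// hL.
  rewrite !nth_mkseq//; have [] := hc 0%N c isT cL; lia.
have mv : mkseq (H 0%N) L \in row_moves (mkseq (V 0%N) L).
  rewrite mem_row_moves !size_mkseq eqxx /=; apply/allP => -[x y].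
  rewrite /mkseq => /(nthP (0%N, 0%N))[c]; rewrite size_zip !size_map size_iota minnn => cL.
  rewrite nth_zip ?size_map// -!/(mkseq _ _) !nth_mkseq// => -[<- <-] /=.
  have [] := hc 0%N c isT cL; lia.
have [h1 h2] := IH (fun i => V i.+1) (fun i => H i.+1)
  (fun i c il => hc i.+1 c il) (fun i il => hL i.+1 il).
have E : mkseq (fun i => mkseq (H i) L) n.+1 = mkseq (H 0%N) L :: mkseq (fun i => mkseq (H i.+1) L) n.
  by rewrite /mkseq -[iota 0 n.+1]/(0%N :: iota 1 n) map_cons -[1%N]addn0 iotaDl -map_comp.
rewrite E hists_cons mv nx h1; split=> // -[//|i] il.
by rewrite [LHS]/= nx h2.
Qed.

Definition state n L ms hs : 'M[nat]_(n.+1, L) * 'M[nat]_(n, L.+1) :=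
  (\matrix_(i, c) nth 0%N (vrow ms hs i) c, \matrix_(i, c) nth 0%N (nth [::] hs i) c).

Lemma state_inj n L ms : size ms = L -> {in hists n ms &, injective (state n L ms)}.
Proof.
move=> sL hs hs' h h' [_ /matrixP E].
apply: (@eq_from_nth _ [::]); first by rewrite (hists_size h) (hists_size h').
move=> i; rewrite (hists_size h) => il.
have [/size_row_moves a _ b] := hists_row h il; have [/size_row_moves a' _ b'] := hists_row h' il.
apply: (@eq_from_nth _ 0%N); first by rewrite a a' b b'.
move=> c; rewrite a b sL => cL.
by have := E (Ordinal il) (Ordinal (leqW cL)); rewrite !mxE.
Qed.

Lemma fsbig_supp (T : choiceType) (F : zmodType) (D : set T) (ss : seq T) (w : T -> F) :
  uniq ss -> (forall x, x \in ss -> D x) -> (forall x, D x -> w x != 0 -> x \in ss) ->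
  \sum_(x \in D) w x = \sum_(x <- ss) w x.
Proof.
move=> us sD Ds; rewrite [RHS]fsbig_seq//; apply: esym; apply: fsbig_widen; first by move=> x /=; exact: sD.
by move=> x [Dx /= nx] /=; apply/eqP; apply: contraT => /(Ds x Dx) xs; case: nx.
Qed.

(** A nonzero weight forces conservation and [l <= i], so only states built from [hists] contribute.
    A history determines its left labels, whose sum is [part la 1] by [hists_total] when the bottom
    is empty; the sums over [a] and over states merge into one. *)
Lemma fsum_states (F : fieldType) n la (hla : is_part la) (al : 'I_n -> nat -> F)
    (w : 'I_n -> 'I_(size la).+1 -> nat -> nat -> nat -> nat -> F) :
  (forall r (c : 'I_(size la).+1) i j k l, w r c i j k l != 0 -> (i + j = k + l)%N /\ (l <= i)%N) ->
  \sum_(a \in [set a : {ffun 'I_n -> nat} | (\sum_(i < n) a i + part [::] 1 = part la 1)%N])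
    ((\prod_(i < n) al i (a i)) *
     \sum_(vh \in @ZWstates n (size la).+1 a la [::])
        \prod_(r < n) \prod_(c < (size la).+1)
          w r c (vh.1 (lift ord0 r) c) (vh.2 r (widen_ord (leqnSn (size la).+1) c))
            (vh.1 (widen_ord (leqnSn n) r) c) (vh.2 r (lift ord0 c))) =
  \sum_(hs <- hists n (mults la) | sumn (vrow (mults la) hs n) == 0%N)
    \prod_(r < n) (al r (nth 0%N (nth [::] hs r) 0) *
      \prod_(c < (size la).+1)
        w r c (nth 0%N (vrow (mults la) hs r.+1) c) (nth 0%N (nth [::] hs r) c)
            (nth 0%N (vrow (mults la) hs r) c) (nth 0%N (nth [::] hs r) c.+1)).
Proof.
move=> hw; set L := (size la).+1; set ms := mults la.
have sL : size ms = L by rewrite size_mkseq.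
set hh := [seq hs <- hists n ms | sumn (vrow ms hs n) == 0%N].
pose a0 hs : {ffun 'I_n -> nat} := [ffun r : 'I_n => nth 0%N (nth [::] hs r) 0].
pose W (vh : 'M[nat]_(n.+1, L) * 'M[nat]_(n, L.+1)) := \prod_(r < n) \prod_(c < L)
   w r c (vh.1 (lift ord0 r) c) (vh.2 r (widen_ord (leqnSn L) c))
            (vh.1 (widen_ord (leqnSn n) r) c) (vh.2 r (lift ord0 c)).
have hin hs : hs \in hh -> hs \in hists n ms by rewrite mem_filter => /andP[].
have hz hs c : hs \in hh -> nth 0%N (vrow ms hs n) c = 0%N.
  rewrite mem_filter => /andP[/eqP s0 _]; elim: (vrow ms hs n) c s0 => [|x s IH] [|c] //= /eqP;
    by rewrite addn_eq0 => /andP[/eqP x0 /eqP s0] //; exact: IH.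
have inner a : \sum_(vh \in @ZWstates n L a la [::]) W vh =
    \sum_(hs <- hh | a0 hs == a) W (state n L ms hs).
  rewrite (@fsbig_supp _ _ _ [seq state n L ms hs | hs <- hh & a0 hs == a]).
  - by rewrite big_map big_filter.
  - rewrite map_inj_in_uniq; first by rewrite !filter_uniq// hists_uniq.
    move=> hs hs'; rewrite !mem_filter => /andP[_ /andP[_ h]] /andP[_ /andP[_ h']].
    exact: (state_inj sL h h').
  - move=> x /mapP[hs]; rewrite mem_filter => /andP[/eqP aE hsh] ->.
    split=> [c|c|r|r]; rewrite /state mxE /=.
    + by rewrite nth_mkseq.
    + by rewrite hz.
    + by rewrite -aE ffunE.
    + have [/size_row_moves sr _ sv] := hists_row (hin _ hsh) (ltn_ord r).
      by rewrite nth_default// sr sv sL.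
  move=> [v h] [v0 vn ha hL] W0.
  have hwc (r : 'I_n) (c : 'I_L) : (v (lift ord0 r) c + h r (widen_ord (leqnSn L) c) =
       v (widen_ord (leqnSn n) r) c + h r (lift ord0 c))%N /\ (h r (lift ord0 c) <= v (lift ord0 r) c)%N.
    have /= := W0; rewrite /W => /prodf_neq0/(_ r isT)/prodf_neq0/(_ c isT) /=.
    exact: hw.
  pose V i c := (if insub i is Some i' then if insub c is Some c' then v i' c' else 0 else 0)%N.
  pose H i c := (if insub i is Some i' then if insub c is Some c' then h i' c' else 0 else 0)%N.
  have VE (i : 'I_n.+1) (c : 'I_L) : V i c = v i c by rewrite /V !valK.
  have HE (i : 'I_n) (c : 'I_L.+1) : H i c = h i c by rewrite /H !valK.
  have hc i c : (i < n)%N -> (c < L)%N -> (V i.+1 c + H i c = V i c + H i c.+1)%N /\ (H i c.+1 <= V i.+1 c)%N.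
    move=> il cl; have := hwc (Ordinal il) (Ordinal cl).
    by rewrite -!VE -!HE /= /bump /= !add1n.
  have hL' i : (i < n)%N -> H i L = 0%N.
    by move=> il; have := hL (Ordinal il); rewrite -HE /=.
  have [b1 b2] := hists_build hc hL'.
  have msE : mkseq (V 0%N) L = ms.
    apply: (@eq_from_nth _ 0%N); rewrite !size_mkseq// => c cl; rewrite !nth_mkseq//.
    by have := v0 (Ordinal cl); rewrite -VE.
  rewrite msE in b1 b2.
  apply/mapP; exists (mkseq (fun i => mkseq (H i) L) n).
    rewrite !mem_filter b1 andbT b2//; apply/andP; split.
      apply/eqP/ffunP => r; rewrite ffunE nth_mkseq ?ltn_ord// nth_mkseq//.
      by rewrite -(ha r) -HE.
    rewrite (_ : mkseq (V n) L = nseq L 0%N); first by rewrite sumn_nseq mul0n.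
    apply: (@eq_from_nth _ 0%N); rewrite size_mkseq ?size_nseq// => c cl.
    rewrite nth_mkseq// nth_nseq cl.
    have -> : V n c = v ord_max (Ordinal cl) by rewrite -VE.
    by rewrite vn.
  rewrite /state; congr pair; apply/matrixP => i /= c; rewrite mxE.
    by rewrite b2 ?leq_ord// nth_mkseq// VE.
  rewrite nth_mkseq ?ltn_ord//.
  case: (ltnP c L) => cl; first by rewrite nth_mkseq// HE.
  have cE : c = ord_max by apply: val_inj; apply/eqP; rewrite eqn_leq cl -ltnS ltn_ord.
  by rewrite nth_default ?size_mkseq// cE hL.
under eq_fsbigr do rewrite -/(W _).
(* Several histories may share their left labels, hence [undup]; for any other [a] the inner sum is
   empty. *)
rewrite (@fsbig_supp _ _ _ (undup [seq a0 hs | hs <- hh])).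
- under eq_bigr => a _ do rewrite inner mulr_sumr.
  rewrite (exchange_big_dep predT) //= big_filter.
  rewrite big_seq_cond [RHS]big_seq_cond; apply: eq_bigr => hs /andP[h1 h2].
  have hsh : hs \in hh by rewrite mem_filter h2.
  rewrite (eq_bigl (fun a => a == a0 hs)); last by move=> a; rewrite eq_sym.
  rewrite -big_filter filter_pred1_uniq ?undup_uniq ?mem_undup ?map_f// big_seq1.
  rewrite -big_split /=; apply: eq_bigr => r _; rewrite ffunE; congr (_ * _).
  apply: eq_bigr => c _; rewrite /state !mxE /= /bump /= !add1n.
  by [].
- exact: undup_uniq.
- move=> a; rewrite mem_undup => /mapP[hs hsh ->] /=.
  have := hists_total (hin _ hsh); move: hsh; rewrite mem_filter => /andP[/eqP-> _].
  rewrite !addn0 => E; rewrite -[part la 1]/(nth 0%N la 0) -(sumn_mults hla) drop0 -E.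
  by apply: eq_bigr => r _; rewrite ffunE nth0.
move=> a _; apply: contraNT; rewrite mem_undup => na; rewrite inner.
rewrite [X in _ * X](_ : _ = 0) ?mulr0// big_seq_cond big1//.
by move=> hs /andP[hsh /eqP E]; case/negP: na; rewrite -E map_f.
Qed.

End States.

(** * Matching vertex weights with recursion coefficients *)

Section Weights.
Local Set Implicit Arguments. Local Unset Strict Implicit.
Variable F : numFieldType.
Implicit Types (ms js : seq nat) (x y : nat -> F) (kap : F) (o r c : nat).

(** For [o = 0] and [ms = mults la] this is the product of the [x c ^+ nth 0 la c], since tail sums
    of the multiplicities are the parts of [la]. *)
Fixpoint potx x o ms : F :=
  if ms is m :: ms' then x o ^+ sumn ms * potx x o.+1 ms' else 1.

Lemma potxE x o ms : potx x o ms = \prod_(c < size ms) x (o + c)%N ^+ sumn (drop c ms).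
Proof.
elim: ms o => [|m ms IH] o /=; first by rewrite big_ord0.
rewrite big_ord_recl addn0 /= IH; congr (_ * _).
by apply: eq_bigr => c _; rewrite /= addSnnS.
Qed.

Lemma potxM x y o ms : potx (fun i => x i * y i) o ms = potx x o ms * potx y o ms.
Proof. by elim: ms o => [|m ms IH] o /=; rewrite ?mulr1// IH exprMn; ring. Qed.

Lemma potx_neq0 x o ms : (forall i, x i != 0) -> potx x o ms != 0.
Proof. by move=> h; elim: ms o => [|m ms IH] o /=; rewrite ?oner_eq0// mulf_neq0// expf_neq0. Qed.

(** A row lowers the sum of the multiplicities from column c + 1 on by [nth 0 js c], the number of
    parts that pass to column c. *)
Lemma potx_next_row x o ms js : js \in row_moves ms ->
  potx x o ms = (\prod_(c < size ms) x (o + c)%N ^+ nth 0%N js c) * potx x o (next_row ms js).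
Proof.
elim: ms js o => [|m ms IH] [|j js] o h; first by rewrite big_ord0 mulr1.
- by rewrite mem_row_moves in h.
- by rewrite mem_row_moves in h.
have sj := sumn_next_row h.
have h' : js \in row_moves ms by move: h; rewrite !mem_row_moves /= eqSS => /and3P[-> _ ->].
have E : \prod_(c < size ms) x (o + lift ord0 c)%N ^+ nth 0%N (j :: js) (lift ord0 c) =
    \prod_(c < size ms) x (o.+1 + c)%N ^+ nth 0%N js c.
  by apply: eq_bigr => c _; rewrite lift0 addnS addSn.
rewrite big_ord_recl [X in _ * X * _]E addn0.
rewrite [potx x o (m :: ms)]/= [potx x o (next_row _ _)]/= (IH _ _ h').
rewrite -[(m + sumn ms)%N]/(sumn (m :: ms)) -sj /= !exprD.
ring.
Qed.

Lemma potx_levels x o ms :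
  \prod_(l <- levels o ms) \prod_(o <= j < l) x j = potx x o ms.
Proof.
elim: ms o => [|m ms IH] o /=; first by rewrite big_nil.
rewrite big_cat /= big_nseq -Monoid.iteropE /= big_nat1 addnC exprD -mulrA mulrCA mulrC; congr (_ * _).
rewrite -(size_levels ms o.+1) -IH.
have := (levels_sorted ms o.+1).2; elim: (levels o.+1 ms) => [|l w IHw] /=.
  by rewrite !big_nil mulr1.
move=> /andP[ol /IHw E]; rewrite !big_cons E exprS.
rewrite [\prod_(o <= j < l) x j]big_ltn; last exact: ltnW.
ring.
Qed.

Variables (q : F) (xi s rxi rs : nat -> F).
Hypothesis hqq : forall m, qpoch q q m != 0.
Hypothesis hrxi : forall i, rxi i ^+ 2 = xi i.
Hypothesis hrs : forall i, rs i ^+ 2 = s i.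
Hypothesis hxi0 : forall i, xi i != 0.
Hypothesis hs0 : forall i, s i != 0.

(* The points pin i are inside the contour, the points (bout i)^-1 outside. *)
Definition pin i : F := (xi i)^-1 * s i.
Definition bout i : F := s i * xi i.

(** The square roots enter the weights only through this square, a [pin] fixed by the shift times a
    [bout] moved by it. *)
Lemma stau_sq k i : stau rxi rs k i ^+ 2 = pin i * bout (i + k)%N.
Proof.
by rewrite /stau expr_div_n !exprMn !hrxi !hrs /pin /bout; field; exact: hxi0.
Qed.

(** [cfac] for the parameters shifted r times, in terms of multiplicities. *)
Definition rowratio r ms : F :=
  \prod_(c < size ms) (qpoch (pin c.+1 * bout (c.+1 + r)%N) q (nth 0%N ms c) / qpoch q q (nth 0%N ms c)).

Lemma wrowE kap r o ms js : size js = size ms ->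
  wrow q pin bout kap r o ms js =
  \prod_(c < size ms) group_coef q kap (pin (o + c).+1) (bout ((o + c).+1 + r)%N) (nth 0%N ms c) (nth 0%N js c).
Proof.
elim: ms js o => [|m ms IH] [|j js]//= o; first by rewrite big_ord0.
move=> [sj]; rewrite big_ord_recl addn0 /= IH//; congr (_ * _).
by apply: eq_bigr => c _; rewrite /= addSnnS.
Qed.

Definition rowweight r kap ms js : F :=
  ((kap * s 0%N / xi 0%N) ^+ nth 0%N js 0 * (qpoch (kap^-1 * s r.+1 * xi r.+1) q (nth 0%N js 0) / qpoch q q (nth 0%N js 0))) *
  \prod_(c < size ms)
     Wt q (xi (r.+1 + c.+1)%N * s (r.+1 + c.+1)%N / kap) (stau rxi rs r.+1 c.+1)
       (nth 0%N (next_row ms js) c) (nth 0%N js c) (nth 0%N ms c) (nth 0%N js c.+1).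

Lemma prod_qpoch_scale kap a j : kap != 0 ->
  \prod_(i < j) (a * q ^+ i - kap) = (- kap) ^+ j * qpoch (a / kap) q j.
Proof.
move=> k0; elim: j => [|j IH]; first by rewrite big_ord0 qpoch0 mulr1.
by rewrite big_ord_recr /= IH qpochS exprSr; field.
Qed.

(** The product telescopes over the columns. Normalized by [rowratio], the vertex in column c + 1
    equals [X c * Y c.+1], with [X] for the parts that stay and [Y] for a horizontal edge, whereas
    the recursion coefficient gives [X c * Y c]. The difference is [Y 0], the weight of the left
    edge, and [Y (size ms)], which is 1 because the right label is 0. *)
Lemma rowweightE r kap ms js : kap != 0 -> js \in row_moves ms ->
  (forall c m, (1 <= c)%N -> qpoch (pin c * bout (c + r)%N) q m != 0) ->
  (forall c m, (1 <= c)%N -> qpoch (pin c * bout (c + r.+1)%N) q m != 0) ->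
  rowweight r kap ms js * rowratio r.+1 (next_row ms js) =
  (\prod_(c < size ms) (- pin c) ^+ nth 0%N js c) * wrow q pin bout kap r 0 ms js * rowratio r ms.
Proof.
move=> k0 hjs hg hg1.
have sj := size_row_moves hjs.
pose X c := qpoch (kap * pin c.+1) q (nth 0%N ms c - nth 0%N js c) / qpoch q q (nth 0%N ms c - nth 0%N js c).
pose Y c := (kap * pin c) ^+ nth 0%N js c * qpoch (bout (c + r.+1)%N / kap) q (nth 0%N js c) / qpoch q q (nth 0%N js c).
have jm c : (nth 0%N js c <= nth 0%N ms c)%N.
  move: hjs; rewrite mem_row_moves => /andP[_ /allP al].
  case: (ltnP c (size ms)) => cs; last by rewrite nth_default// sj.
  have := al (nth (0%N, 0%N) (zip js ms) c); rewrite nth_zip//=; apply.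
  by rewrite -(nth_zip 0%N 0%N)// mem_nth// size_zip sj minnn.
have E1 (c : 'I_(size ms)) : Wt q (xi (r.+1 + c.+1)%N * s (r.+1 + c.+1)%N / kap) (stau rxi rs r.+1 c.+1)
       (nth 0%N (next_row ms js) c) (nth 0%N js c) (nth 0%N ms c) (nth 0%N js c.+1) *
    (qpoch (pin c.+1 * bout (c.+1 + r.+1)%N) q (nth 0%N (next_row ms js) c) / qpoch q q (nth 0%N (next_row ms js) c))
     = X c * Y c.+1.
  have nE := nth_next_row sj (ltn_ord c); have jmc := jm c.
  rewrite /Wt nE [X in if X then _ else _](_ : _ = true); last by apply/andP; split; [apply/eqP|]; lia.
  rewrite addnK stau_sq [(r.+1 + c.+1)%N]addnC.
  rewrite (_ : pin c.+1 * _ / _ = kap * pin c.+1); last first.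
    rewrite /bout; field; by rewrite k0 hxi0 hs0.
  rewrite (_ : xi _ * s _ / kap = bout (c.+1 + r.+1)%N / kap); last by rewrite /bout [s _ * _]mulrC.
  rewrite /X /Y; have h1 := hg1 c.+1 (nth 0%N ms c - nth 0%N js c + nth 0%N js c.+1)%N isT.
  have h2 := hqq (nth 0%N ms c - nth 0%N js c + nth 0%N js c.+1)%N.
  have h3 := hqq (nth 0%N ms c - nth 0%N js c)%N; have h4 := hqq (nth 0%N js c.+1).
  by field; rewrite h1 h2 h3 h4.
have E2 : (kap * s 0%N / xi 0%N) ^+ nth 0%N js 0 * (qpoch (kap^-1 * s r.+1 * xi r.+1) q (nth 0%N js 0) / qpoch q q (nth 0%N js 0)) = Y 0%N.
  rewrite /Y /pin /bout add0n mulrA; congr (_ ^+ _ * qpoch _ _ _ / _); ring.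
have E3 : Y (size ms) = 1.
  by rewrite /Y -sj nth_default// expr0 !qpoch0 divr1 mulr1.
have E4 (c : 'I_(size ms)) : (- pin c) ^+ nth 0%N js c *
   group_coef q kap (pin c.+1) (bout (c.+1 + r)%N) (nth 0%N ms c) (nth 0%N js c) *
   (qpoch (pin c.+1 * bout (c.+1 + r)%N) q (nth 0%N ms c) / qpoch q q (nth 0%N ms c)) = X c * Y c.
  rewrite /group_coef prod_qpoch_scale// /X /Y exprMn [(- pin c) ^+ _]exprNn [(- kap) ^+ _]exprNn addSnnS.
  have h1 := hg c.+1 (nth 0%N ms c) isT; have h2 := hqq (nth 0%N ms c).
  have h3 := hqq (nth 0%N ms c - nth 0%N js c)%N; have h4 := hqq (nth 0%N js c).
  rewrite addSnnS in h1.
  (* One sign comes from [- pin c], the other from [prod_qpoch_scale]; they cancel. *)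
  have sg : (-1) ^+ nth 0%N js c * (-1) ^+ nth 0%N js c = 1 :> F by rewrite -expr2 sqrr_sign.
  set e := (-1) ^+ nth 0%N js c in sg *.
  transitivity ((e * e) * (qpoch (kap * pin c.+1) q (nth 0%N ms c - nth 0%N js c) / qpoch q q (nth 0%N ms c - nth 0%N js c) *
    (kap ^+ nth 0%N js c * pin c ^+ nth 0%N js c * qpoch (bout (c + r.+1)%N / kap) q (nth 0%N js c) / qpoch q q (nth 0%N js c)))).
    by field; rewrite h1 h2 h3 h4.
  by rewrite sg mul1r.
clearbody X Y.
transitivity (Y 0%N * \prod_(c < size ms) (X c * Y c.+1)).
  rewrite /rowweight E2 /rowratio size_next_row// -mulrA -big_split /=; congr (_ * _).
  by apply: eq_bigr => c _; exact: E1.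
transitivity (\prod_(c < size ms) (X c * Y c)); last first.
  rewrite wrowE// /rowratio -!big_split /=; apply: eq_bigr => c _.
  by rewrite -E4 add0n.
rewrite !big_split /= mulrCA; congr (_ * _).
transitivity (\prod_(c < (size ms).+1) Y c); last by rewrite big_ord_recr /= E3 mulr1.
by rewrite big_ord_recl; congr (_ * _).
Qed.

Lemma sumn0_nth ms c : sumn ms = 0%N -> nth 0%N ms c = 0%N.
Proof.
elim: ms c => [|m ms IH] [|c] //= /eqP; rewrite addn_eq0 => /andP[/eqP m0 /eqP s0] //.
exact: IH.
Qed.

(** [potx] absorbs the powers of [- pin c] and [rowratio] the normalizations of [rowweightE], so
    both telescope from row to row; after the last row all multiplicities are 0 and both equal 1. *)
Lemma sum_hists n (kn : nat -> F) r ms : (forall i, (i < r + n)%N -> kn i != 0) ->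
  (forall k c m, (k <= r + n)%N -> (1 <= c)%N -> qpoch (pin c * bout (c + k)%N) q m != 0) ->
  \sum_(hs <- hists n ms | sumn (vrow ms hs n) == 0%N)
     \prod_(i < n) rowweight (r + i) (kn (r + i)%N) (vrow ms hs i) (nth [::] hs i) =
  potx (fun i => - pin i) 0 ms * rowratio r ms *
    transfer q pin bout [seq kn i | i <- iota r n] r ms.
Proof.
elim: n r ms => [|n IH] r ms hk hg.
  rewrite big_cons big_nil /= big_ord0; case: eqP => s0; last by rewrite mulr0.
  rewrite addr0 mulr1 potxE /rowratio !big1 ?mulr1// => c _.
    by rewrite sumn0_nth// !qpoch0 divr1.
  suff -> : sumn (drop c ms) = 0%N by rewrite expr0.
  have : (sumn (drop c ms) <= sumn ms)%N by rewrite -[X in (_ <= sumn X)%N](cat_take_drop c ms) sumn_cat leq_addl.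
  by rewrite s0 leqn0 => /eqP.
rewrite [hists n.+1 ms]/(allpairs_dep _ _ _) big_mkcond big_allpairs_dep /=.
rewrite mulr_sumr big_seq [RHS]big_seq; apply: eq_bigr => js hjs.
have hr : (r < r + n.+1)%N by rewrite addnS ltnS leq_addr.
have RW := rowweightE (hk r hr) hjs (fun c m => hg r c m (ltnW hr)) (fun c m => hg r.+1 c m hr).
rewrite -big_mkcond /=.
under eq_bigr => hs _.
  rewrite big_ord_recl addn0 /=.
  under [X in _ * X]eq_bigr => i _ do rewrite -addSnnS.
  over.
rewrite -mulr_sumr IH; last 2 first.
- by move=> i; rewrite addSnnS; exact: hk.
- by move=> k c m; rewrite addSnnS; exact: hg.
rewrite (potx_next_row _ 0 hjs).
have -> : \prod_(c < size ms) (- pin (0 + c)%N) ^+ nth 0%N js c = \prod_(c < size ms) (- pin c) ^+ nth 0%N js c.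
  by apply: eq_bigr => c _; rewrite add0n.
set P := potx _ _ _; set T := transfer _ _ _ _ _ _.
transitivity (P * (rowweight r (kn r) ms js * rowratio r.+1 (next_row ms js)) * T); first by ring.
by rewrite RW; ring.
Qed.

End Weights.

(** * Closed form of F and its polynomiality in kappa *)

Section Formula.
Local Set Implicit Arguments. Local Unset Strict Implicit.
Variable F : numFieldType.
Variables (q : F) (xi s rxi rs : nat -> F).
Implicit Types (la ms : seq nat) (n : nat).

Definition extend n (kappa : 'I_n -> F) (i : nat) : F :=
  if insub i is Some j then kappa j else 0.

Lemma extendE n (kappa : 'I_n -> F) (i : 'I_n) : extend kappa i = kappa i.
Proof. by rewrite /extend valK. Qed.

Definition params n (kappa : 'I_n -> F) : seq F := [seq extend kappa i | i <- iota 0 n].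

Local Notation closed_form la kappa :=
  (potx (fun i => (xi i)^-1) 0 (mults la) *
   transfer q (pin xi s) (bout xi s) (params kappa) 0 (mults la)).

Hypothesis hqq : forall m, qpoch q q m != 0.
Hypothesis hrxi : forall i, rxi i ^+ 2 = xi i.
Hypothesis hrs : forall i, rs i ^+ 2 = s i.
Hypothesis hxi0 : forall i, xi i != 0.
Hypothesis hs0 : forall i, s i != 0.

Lemma negpow_potx la : is_part la -> negpow s la = potx (fun i => - s i) 0 (mults la).
Proof.
move=> hla; rewrite potxE size_mkseq big_ord_recr /= sumn_mults// nth_default//= expr0 mulr1.
rewrite /negpow big_add1 big_mkord; apply: eq_bigr => c _ /=.
by rewrite add0n sumn_mults.
Qed.

Lemma cfac_rowratio la : is_part la -> cfac q s la = rowratio q xi s 0 (mults la).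
Proof.
move=> hla; rewrite /rowratio size_mkseq big_ord_recr /= nth_mults// !nth_default// !qpoch0 divr1 mulr1.
rewrite /cfac big_add1 big_mkord; apply: eq_bigr => c _ /=.
rewrite nth_mults// /part /= addn0; congr (qpoch _ _ _ / _).
by rewrite /pin /bout; field; exact: hxi0.
Qed.

(** The prefactors of the empty [mu] are 1, [rowratio] cancels [cfac], and since [pin i] is
    [s i / xi i], dividing the powers of [- pin i] by [negpow s la] leaves those of [(xi i)^-1]. *)
Lemma Fformula_transfer n (kappa : 'I_n -> F) la : is_part la ->
  (forall k i m, (k <= n)%N -> (1 <= i)%N -> qpoch (stau rxi rs k i ^+ 2) q m != 0) ->
  (forall i, kappa i != 0) ->
  Fformula q xi s rxi rs la [::] kappa = closed_form la kappa.
Proof.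
move=> hla hg hk; rewrite /Fformula [X in X / negpow _ _](_ : _ = 1); last first.
  by rewrite /negpow big_geq.
rewrite [X in X / cfac _ _ _](_ : _ = 1); last by rewrite /cfac big_geq.
rewrite maxn0 /ZW.
pose al (r : 'I_n) a := (kappa r * s 0%N / xi 0%N) ^+ a * (qpoch ((kappa r)^-1 * s r.+1 * xi r.+1) q a / qpoch q q a).
pose w (r : 'I_n) (c : 'I_(size la).+1) i j k l :=
  Wt q (xi (r.+1 + c.+1)%N * s (r.+1 + c.+1)%N / kappa r) (stau rxi rs r.+1 c.+1) i j k l.
have hw r (c : 'I_(size la).+1) i j k l : w r c i j k l != 0 -> (i + j = k + l)%N /\ (l <= i)%N.
  by rewrite /w /Wt; case: ifP => [/andP[/eqP-> ->]//|]; rewrite eqxx.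
rewrite (fsum_states hla al hw).
have hgp k c m : (k <= n)%N -> (1 <= c)%N -> qpoch (pin xi s c * bout xi s (c + k)) q m != 0.
  by move=> kn c1; rewrite -(stau_sq hrxi hrs hxi0); exact: hg.
have hkn i : (i < n)%N -> extend kappa i != 0.
  by move=> il; rewrite (extendE kappa (Ordinal il)).
have := @sum_hists F q xi s rxi rs hqq hrxi hrs hxi0 hs0 n (extend kappa) 0 (mults la) hkn hgp.
have -> : \sum_(hs <- hists n (mults la) | sumn (vrow (mults la) hs n) == 0%N)
     \prod_(i < n) rowweight q xi s rxi rs (0 + i) (extend kappa (0 + i)%N) (vrow (mults la) hs i) (nth [::] hs i) =
   \sum_(hs <- hists n (mults la) | sumn (vrow (mults la) hs n) == 0%N)
    \prod_(r < n) (al r (nth 0%N (nth [::] hs r) 0) *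
      \prod_(c < (size la).+1)
        w r c (nth 0%N (vrow (mults la) hs r.+1) c) (nth 0%N (nth [::] hs r) c)
            (nth 0%N (vrow (mults la) hs r) c) (nth 0%N (nth [::] hs r) c.+1)).
  rewrite big_seq_cond [RHS]big_seq_cond; apply: eq_bigr => hs /andP[hin _].
  apply: eq_bigr => r _; have [_ vE sv] := hists_row hin (ltn_ord r).
  rewrite vE add0n extendE /rowweight sv size_mkseq; congr (_ * _).
move=> ->.
have p1 : potx (fun i => - s i) 0 (mults la) != 0 by apply: potx_neq0 => i; rewrite oppr_eq0.
have r1 : rowratio q xi s 0 (mults la) != 0.
  rewrite /rowratio; apply/prodf_neq0 => c _; rewrite mulf_neq0 ?invr_eq0 ?hqq//.
  exact: hgp.
rewrite negpow_potx// cfac_rowratio//.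
have -> : potx (fun i => - pin xi s i) 0 (mults la) = potx (fun i => (xi i)^-1) 0 (mults la) * potx (fun i => - s i) 0 (mults la).
  rewrite -potxM; congr (potx _ _ _); apply: funext => i; by rewrite /pin mulrN.
by field; rewrite p1 r1.
Qed.

Definition polyfun n (f : ('I_n -> F) -> F) := exists P : mpoly n F, forall kappa, meval kappa P = f kappa.

Lemma polyfun_cst n a : polyfun (fun _ : 'I_n -> F => a).
Proof. by exists (mpolyC n a) => kappa; rewrite mevalC. Qed.

Lemma polyfun_coord n (i : 'I_n) : polyfun (fun kappa => kappa i).
Proof. by exists (mpolyX F (mnm1 i)) => kappa; rewrite mevalXU. Qed.

Lemma polyfunD n (f g : ('I_n -> F) -> F) : polyfun f -> polyfun g -> polyfun (fun kappa => f kappa + g kappa).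
Proof. by move=> [P hP] [Q hQ]; exists (P + Q) => kappa; rewrite mevalD hP hQ. Qed.

Lemma polyfunM n (f g : ('I_n -> F) -> F) : polyfun f -> polyfun g -> polyfun (fun kappa => f kappa * g kappa).
Proof. by move=> [P hP] [Q hQ]; exists (P * Q) => kappa; rewrite mevalM hP hQ. Qed.

Lemma polyfun_ext n (f g : ('I_n -> F) -> F) : f =1 g -> polyfun f -> polyfun g.
Proof. by move=> fg [P hP]; exists P => kappa; rewrite hP fg. Qed.

Lemma polyfun_sum n (I : Type) (r : seq I) (f : I -> ('I_n -> F) -> F) :
  (forall i, polyfun (f i)) -> polyfun (fun kappa => \sum_(i <- r) f i kappa).
Proof.
move=> h; elim: r => [|i r IH].
  by apply: polyfun_ext (polyfun_cst n 0) => kappa; rewrite big_nil.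
by apply: polyfun_ext (polyfunD (h i) IH) => kappa; rewrite big_cons.
Qed.

Lemma polyfun_prod n (I : Type) (r : seq I) (f : I -> ('I_n -> F) -> F) :
  (forall i, polyfun (f i)) -> polyfun (fun kappa => \prod_(i <- r) f i kappa).
Proof.
move=> h; elim: r => [|i r IH].
  by apply: polyfun_ext (polyfun_cst n 1) => kappa; rewrite big_nil.
by apply: polyfun_ext (polyfunM (h i) IH) => kappa; rewrite big_cons.
Qed.

Lemma polyfun_extend n i : polyfun (fun kappa : 'I_n -> F => extend kappa i).
Proof.
rewrite /extend; case: insubP => [j _ _|_]; [exact: polyfun_coord|exact: polyfun_cst].
Qed.

Lemma polyfun_wrow n (f : ('I_n -> F) -> F) p b r o ms js : polyfun f ->
  polyfun (fun kappa => wrow q p b (f kappa) r o ms js).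
Proof.
move=> hf; elim: ms js o => [|m ms IH] [|j js] o /=; try exact: polyfun_cst.
apply: polyfunM => //; apply: polyfunM; first exact: polyfun_cst.
apply: polyfunM; last exact: polyfun_cst.
apply: polyfunM; apply: polyfun_prod => i.
  apply: polyfun_ext (polyfunD (polyfun_cst n 1) (polyfunM hf (polyfun_cst n (- (p o.+1 * q ^+ i.-1))))) => kappa.
  by rewrite mulrN mulrA.
apply: polyfun_ext (polyfunD (polyfun_cst n (b (o.+1 + r)%N * q ^+ i)) (polyfunM (polyfun_cst n (-1)) hf)) => kappa.
by rewrite mulN1r.
Qed.

Lemma polyfun_transfer n p b (ids : seq nat) r ms :
  polyfun (fun kappa : 'I_n -> F => transfer q p b [seq extend kappa i | i <- ids] r ms).
Proof.
elim: ids r ms => [|i ids IH] r ms /=; first exact: polyfun_cst.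
apply: polyfun_sum => js; apply: polyfunM; last exact: IH.
by apply: polyfun_wrow; exact: polyfun_extend.
Qed.

(* On a line of direction (1, ..., 1) the nonvanishing condition excludes only
   finitely many points. *)
Lemma meval_eq n (P Q : mpoly n F) :
  (forall kappa, (forall i, kappa i != 0) -> meval kappa P = meval kappa Q) ->
  forall kappa, meval kappa P = meval kappa Q.
Proof.
move=> h kappa.
have line (S : mpoly n F) : exists g : {poly F}, forall t, g.[t] = meval (fun i => kappa i + t) S.
  exists (\sum_(m <- msupp S) mcoeff m S *: \prod_(i < n) ((kappa i)%:P + 'X) ^+ m i) => t.
  rewrite mevalE horner_sum; apply: eq_bigr => m _; rewrite hornerZ horner_prod; congr (_ * _).
  by apply: eq_bigr => i _; rewrite horner_exp hornerD hornerC hornerX.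
have [g hg] := line P; have [g' hg'] := line Q.
(* [D] vanishes exactly where a coordinate of the point at t is 0; elsewhere [g] and [g'] agree, so
   their difference times [D] is 0 at every t. *)
pose D : {poly F} := \prod_(i < n) ('X - (- kappa i)%:P).
have E : (g - g') * D = 0.
  apply: poly_eq_horner => t; rewrite horner0 hornerM hornerD hornerN hg hg' horner_prod.
  case: (boolP [forall i, kappa i + t != 0]) => [/forallP nz|].
    by rewrite h// subrr mul0r.
  rewrite negb_forall => /existsP[j]; rewrite negbK => /eqP kt; rewrite (bigD1 j)//=.
  have -> : ('X - (- kappa j)%:P).[t] = 0 by rewrite hornerXsubC opprK addrC.
  by rewrite mul0r mulr0.
have D0 : D != 0 by apply: monic_neq0; exact: monic_prod_XsubC.
move/eqP: E; rewrite mulf_eq0 (negbTE D0) orbF subr_eq0 => /eqP gg.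
have := congr1 (fun p : {poly F} => p.[0]) gg; rewrite hg hg'.
have -> : (fun i => kappa i + 0) = kappa by apply: funext => i; rewrite addr0.
by [].
Qed.

(** The closed form is polynomial in kappa, so some polynomial meets the condition that defines
    [Fpoly]; [meval_eq] extends the equality to points with vanishing coordinates. *)
Lemma Fla_transfer n (kappa : 'I_n -> F) la : is_part la ->
  (forall k i m, (k <= n)%N -> (1 <= i)%N -> qpoch (stau rxi rs k i ^+ 2) q m != 0) ->
  Fla q xi s rxi rs la kappa = closed_form la kappa.
Proof.
move=> hla hg; rewrite /Fla /Fskew.
have [P hP] : polyfun (fun kappa : 'I_n -> F => closed_form la kappa).
  by apply: polyfunM; [exact: polyfun_cst|exact: polyfun_transfer].
have ex : [set P : mpoly n F | forall kappa : 'I_n -> F, (forall i, kappa i != 0) ->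
      meval kappa P = Fformula q xi s rxi rs la [::] kappa] P.
  by move=> k hk; rewrite hP Fformula_transfer.
have := xgetPex 0 (ex_intro _ P ex); rewrite -/(Fpoly q xi s rxi rs n la [::]) => hF.
rewrite -hP; apply: meval_eq => k hk; rewrite hP -Fformula_transfer//.
exact: hF.
Qed.

End Formula.

(** * The integral formula *)

Section Integrand.
Local Set Implicit Arguments. Local Unset Strict Implicit.
Variable R : realType.
Local Notation C := (R[i]).
Implicit Types (q : C) (xi s : nat -> C) (zs : seq C) (mu : seq nat).

Lemma cross_prodE q zs k : size zs = k ->
  \prod_(be < k) \prod_(al < k | (al < be)%N) cross q zs`_al zs`_be = cross_prod q zs.
Proof.
elim: zs k => [|z zs IH] [|k]//= sz; first by rewrite big_ord0.
move: sz => [sz]; rewrite -(IH k sz).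
rewrite big_ord_recl [X in X * _]big1 ?mul1r; last by move=> al; rewrite ltn0.
have -> : \prod_(y <- zs) cross q z y = \prod_(be < k) cross q z zs`_be.
  by rewrite (big_nth 0) big_mkord sz.
rewrite -big_split /=; apply: eq_bigr => be _.
rewrite [LHS]big_mkcond big_ord_recl; congr (_ * _).
by rewrite [RHS]big_mkcond; apply: eq_bigr.
Qed.

Lemma tail_funE n (kappa : 'I_n -> C) xi s z :
  tail_fun (bout xi s) 0 (params kappa) z =
  \prod_(i < n) ((1 - z * kappa i) / (1 - z * xi i.+1 * s i.+1)).
Proof.
have gen ks r : tail_fun (bout xi s) r ks z =
    \prod_(i < size ks) ((1 - z * ks`_i) / (1 - z * xi (r + i).+1 * s (r + i).+1)).
  elim: ks r => [|kap ks IH] r /=; first by rewrite big_ord0.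
  rewrite big_ord_recl IH; congr (_ * _).
    by rewrite /bout /= addn0; congr (_ / _); ring.
  by apply: eq_bigr => i _; rewrite lift0 /= addSnnS.
rewrite gen size_map size_iota; apply: eq_bigr => i _.
by rewrite (nth_map 0%N) ?size_iota// nth_iota// !add0n extendE.
Qed.

(** For 1 <= j < m, [z * xi j - s j] equals [xi j * (z - pin j)], and the prefactor supplies j = 0;
    the pole at [pin m] carries no [xi m], whence the range 0 <= j < m. *)
Lemma integrand_level_fun n (kappa : 'I_n -> C) xi s m z : (0 < m)%N -> (forall i, xi i != 0) ->
  (xi 0%N)^-1 / (z - (xi m)^-1 * s m)
      * (\prod_(1 <= j < m) ((1 - s j * xi j * z) / (z * xi j - s j)))
      * \prod_(i < n) ((1 - z * kappa i) / (1 - z * xi i.+1 * s i.+1)) =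
  \prod_(0 <= j < m) (xi j)^-1 * level_fun (pin xi s) (bout xi s) 0 (params kappa) m z.
Proof.
case: m => [//|c] _ hxi; rewrite /level_fun tail_funE mulrA; congr (_ * _).
rewrite /phi /= [\prod_(1 <= j < c.+2) _]big_nat_recr//= [\prod_(0 <= j < c.+1) _]big_nat_recl//.
rewrite !big_add1 /= !big_mkord /pin.
have -> : \prod_(i < c) ((1 - s i.+1 * xi i.+1 * z) / (z * xi i.+1 - s i.+1)) =
  (\prod_(i < c) (xi i.+1)^-1) * ((\prod_(i < c) (1 - bout xi s (i + 1)%N * z)) *
    \prod_(i < c) (z - (xi i.+1)^-1 * s i.+1)^-1).
  rewrite -!big_split /=; apply: eq_bigr => i _; rewrite addn1 /bout.
  have -> : z * xi i.+1 - s i.+1 = xi i.+1 * (z - (xi i.+1)^-1 * s i.+1).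
    by rewrite mulrBr mulVKf// mulrC.
  by rewrite invfM; ring.
ring.
Qed.

(** A part l of [conjp mu] contributes the [(xi j)^-1] with j < l; by [potx_levels] they multiply to
    the prefactor of the closed form of F. *)
Lemma integral_Jint (gamma : R -> C) n (kappa : 'I_n -> C) q xi s mu :
  is_part mu -> (forall i, xi i != 0) ->
  piecewise_C1 gamma /\ gamma 0 = gamma 1 -> ~ curve gamma 0 -> q != 0 ->
  (forall z, curve gamma z -> ~ curve gamma (q * z)) ->
  (forall c, (1 <= c)%N -> bounded_lip gamma (level_fun (pin xi s) (bout xi s) 0 (params kappa) c)) ->
  iter_oint gamma (part mu 1) (integrand q xi s kappa mu) =
  potx (fun i => (xi i)^-1) 0 (mults mu) *
    Jint gamma q [seq level_fun (pin xi s) (bout xi s) 0 (params kappa) c | c <- levels 0 (mults mu)].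
Proof.
move=> hmu hxi hgam h0 q0 hq nf; rewrite levels_conjp//.
set w := conjp mu; set G := [seq level_fun _ _ _ _ c | c <- w].
have sw : size w = part mu 1 by rewrite size_map size_iota.
have sG : size G = part mu 1 by rewrite size_map.
have nG : bounded_lips gamma G.
  move=> i; rewrite sG -sw => iw; rewrite /G (@nth_map _ 0%N _ _ _ _ w)//; apply: nf.
  by have /andP[] := conjp_bounds hmu (mem_nth 0%N iw).
rewrite -sG -(iter_ointZ hgam h0 _ (lipn_Jint hgam q0 hq nG)) sG.
apply: iter_ext => zs sz o; rewrite /integrand (cross_prodE q sz) [RHS]mulrCA; congr (_ * _).
have -> : fun_prod G zs = \prod_(al < part mu 1) nth (fun=> 0) G al zs`_al.
  rewrite /fun_prod (big_nth (fun=> 0, 0)) size_zip sG sz minnn big_mkord.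
  by apply: eq_bigr => al _; rewrite nth_zip ?sG ?sz.
rewrite -(potx_levels (fun i => (xi i)^-1)) levels_conjp// -/w (big_nth 0%N) big_mkord sw -big_split /=.
apply: eq_bigr => al _.
have alw : (al < size w)%N by rewrite sw.
have -> : nth (fun=> 0) G al = level_fun (pin xi s) (bout xi s) 0 (params kappa) (nth 0%N w al).
  exact: (nth_map 0%N).
rewrite -integrand_level_fun//.
by have /andP[] := conjp_bounds hmu (mem_nth 0%N alw).
Qed.

End Integrand.

Theorem theorem5p13 (R : realType) (n : nat) (q : R[i]) (kappa : 'I_n -> R[i])
    (xi s rxi rs : nat -> R[i]) (gamma : R -> R[i])
    (hrxi : forall i, rxi i ^+ 2 = xi i)
    (hrs : forall i, rs i ^+ 2 = s i)
    (hxi0 : forall i, xi i != 0)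
    (hs0 : forall i, s i != 0)
    (hgen : forall k i m, (k <= n)%N -> (1 <= i)%N ->
       qpoch (stau rxi rs k i ^+ 2) q m != 0)
    (hq : 0 < `|q| < 1)
    (hgamma : pos_simple_contour gamma)
    (hin0 : inside gamma 0)
    (hin : forall i, (1 <= i)%N -> inside gamma ((xi i)^-1 * s i))
    (hout : forall i, (1 <= i)%N -> outside gamma ((xi i)^-1 * (s i)^-1))
    (hqin : forall z, curve gamma z -> inside gamma (q * z))
    (mu : seq nat) (hmu : is_part mu) :
  Fla q xi s rxi rs mu kappa =
  iter_oint gamma (part mu 1) (integrand q xi s kappa mu).
Proof.
have [pc [cl _] po] := hgamma.
have hgam : piecewise_C1 gamma /\ gamma 0 = gamma 1 by [].
have h0 : ~ curve gamma 0 by case: hin0.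
have hq' z : curve gamma z -> ~ curve gamma (q * z) by case/hqin.
have /andP[q0' q1'] := hq.
have q0 : q != 0 by rewrite -normr_gt0.
have q1 : modc q < 1 by move: q1'; rewrite modc_normE ltcR.
(* Being inside becomes the winding integral 2 pi i, since [wnd] is not divided by [twopii]. *)
have win a : inside gamma a -> wnd gamma a = twopii R.
  move=> /po; rewrite /winding -/(wnd gamma a) => E.
  by rewrite -[LHS](divfK (twopii_neq0 R)) E mul1r.
have wq z : curve gamma z -> wnd gamma (q * z) = twopii R by move=> /hqin/win.
have hp i : (1 <= i)%N -> ~ curve gamma (pin xi s i) /\ wnd gamma (pin xi s i) = twopii R.
  by move=> /hin h; split; [case: h|exact: win].
(* [(bout xi s i)^-1] is the outside point [(xi i)^-1 * (s i)^-1] of the hypotheses. *)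
have hb i : (1 <= i)%N -> [/\ bout xi s i != 0, ~ curve gamma (bout xi s i)^-1 & wnd gamma (bout xi s i)^-1 = 0].
  move=> /hout; rewrite -invfM mulrC -/(bout xi s i) => h; split; first by rewrite mulf_neq0.
    by case: h.
  exact: outside_wnd.
have hdiv := wnd_div hgam q0 q1 hq'.
have {}hdiv z : curve gamma z -> ~ curve gamma (z / q) /\ wnd gamma (z / q) = 0.
  apply: hdiv; exists (gamma 0); first exact: curve0.
  by apply/eqP => E; apply: h0; rewrite -E; exact: curve0.
have hqq m : qpoch q q m != 0.
  rewrite qpochE; apply/prodf_neq0 => i _; rewrite -exprS subr_eq0; apply/eqP => E.
  have := congr1 (@modc R) E; rewrite modc1 modcX => /esym/eqP; apply/negP.
  by rewrite lt_eqF// exprn_ilt1// modc_ge0.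
rewrite (Fla_transfer hqq hrxi hrs hxi0 hs0 kappa hmu hgen).
rewrite (integral_Jint hmu hxi0 hgam h0 q0 hq').
  congr (_ * _); apply/esym; apply: (Jint_transfer hgam h0 q0 hq' hp hb (win 0 hin0) wq hdiv hqq).
  move=> r c m; rewrite size_map size_iota => rn c1.
  by rewrite -(stau_sq hrxi hrs hxi0); apply: hgen => //; exact: ltnW.
by move=> c c1; apply: (bounded_lip_level_fun hgam hp hb); rewrite addn0.
Qed.
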